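(* Let $\mathcal{U}=\{U_i\}_{i\in I}$ be a countable open cover of a locally contractible, paracompact space $B$, and $d\ge1$. Let $0\le\epsilon<2/9$ and let $\Omega\in\check{\mathsf H}^1_\epsilon(\mathcal{U};O(d))$. Then $\mathsf{sw}_1(\Omega)\in\check{\mathsf H}^1(\mathcal{U};\mathbb{Z}/2)$ coincides with the first Stiefel–Whitney class of the vector bundle classified by $\pi_*(\mathsf{cl}(\Omega)):B\to\mathsf{Gr}(d)$.
   Context: Paracompact means Hausdorff and every open cover has a locally finite open refinement. $\|A\|=\sqrt{\mathrm{tr}(A^tA)}$ is the Frobenius norm. $[X,Y]$ is the set of homotopy classes of continuous maps. $N(\mathcal{U})$ is the nerve; write $(i_0\dots i_n)\in N(\mathcal{U})$ for an ordered list with $U_{i_n}\cap\dots\cap U_{i_0}\neq\emptyset$. $\mathsf Z^1_\epsilon(\mathcal{U};O(d))$ is the set of families of continuous maps $\Omega=\{\Omega_{ij}:U_j\cap U_i\to O(d)\}_{(ij)\in N(\mathcal{U})}$ with $\Omega_{ij}(y)=\Omega_{ji}(y)^{-1}$ and $\|\Omega_{ij}(y)\Omega_{jk}(y)-\Omega_{ik}(y)\|<\epsilon$ for all $(ijk)\in N(\mathcal{U})$, $y\in U_k\cap U_j\cap U_i$ (equality if $\epsilon=0$). Families $\Theta=\{\Theta_i:U_i\to O(d)\}$ of continuous maps act by $(\Theta\cdot\Omega)_{ij}=\Theta_i\Omega_{ij}\Theta_j^{-1}$, and $\check{\mathsf H}^1_\epsilon(\mathcal{U};O(d))$ is the quotient.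 $\mathsf{sw}_1([\Omega])\in\check{\mathsf H}^1(\mathcal{U};\mathbb{Z}/2)$ is the class of the Čech cocycle $\{\det\Omega_{ij}\}$ with values in $\{\pm1\}\cong\mathbb{Z}/2$ (for $\epsilon\leq2$ this is indeed a locally constant exact cocycle). ''Coincides'' means: after applying $\check{\mathsf H}^1(\mathcal{U};\mathbb{Z}/2)\to\check{\mathsf H}^1(B;\mathbb{Z}/2)\cong H^1(B;\mathbb{Z}/2)$, where $\check{\mathsf H}^1(B;\mathbb Z/2)$ is the colimit over open covers. $\mathsf{Gr}(d,n)=\{A\in\mathbb{R}^{n\times n}: A=A^t=A^2,\ \mathrm{rank}\,A=d\}$, and $\mathsf V(d,n)$ is the set of real $n\times d$ matrices with orthonormal columns. $\mathsf{Gr}(d)$, $\mathsf V(d)$, $\mathbb{R}^{\infty\times\infty}$ are the unions over $n$ of $\mathsf{Gr}(d,n)$, $\mathsf V(d,n)$, $\mathbb{R}^{n\times n}$ (padding by zeros), with the direct limit topology. For $\epsilon>0$, $\mathsf{Gr}(d)^\epsilon\subseteq\mathbb{R}^{\infty\times\infty}$ is the set of matrices at Frobenius distance $<\epsilon$ from some element of $\mathsf{Gr}(d)$; $\mathsf{Gr}(d)^0=\mathsf{Gr}(d)$. If $\epsilon\leq\sqrt2/2$, every $A\in\mathsf{Gr}(d)^\epsilon$ has a unique Frobenius-closest point $\pi(A)\in\mathsf{Gr}(d)$, $\pi$ is a homotopy inverse of the inclusion, and $\pi_*:[B,\mathsf{Gr}(d)^\epsilon]\to[B,\mathsf{Gr}(d)]$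 is the induced bijection. A map $f:B\to\mathsf{Gr}(d)$ classifies the vector bundle whose fiber at $y$ is the image of the projection $f(y)$. Construction of $\mathsf{cl}$. Choose a partition of unity $\phi=\{\phi_i\}_{i\in I}$ subordinate to $\mathcal{U}$ and an injection $\iota:I\to\{1,2,\dots\}$. For $\Omega\in\mathsf Z^1_\epsilon(\mathcal{U};O(d))$ define $\Phi_i:U_i\to\mathsf V(d)$ by declaring, for each $j\in I$, the rows of $\Phi_i(y)$ from $d\,\iota(j)$ to $d(\iota(j)+1)-1$ to be $\sqrt{\phi_j(y)}\,\Omega_{ij}(y)^t$ (zero if $y\notin U_j$), all other rows zero. Then $\mathsf{cl}([\Omega])\in[B,\mathsf{Gr}(d)^{\sqrt2\epsilon}]$ is the homotopy class of $y\mapsto\sum_{i\in I}\phi_i(y)\,\Phi_i(y)\Phi_i(y)^t$; it does not depend on choices. *)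

(* Defs.v *)
From HB Require Import structures.
From mathcomp Require Import all_boot all_order all_algebra.
From mathcomp Require Import all_classical all_reals all_analysis.
Set Implicit Arguments.
Unset Strict Implicit.
Unset Printing Implicit Defensive.
Import Order.TTheory GRing.Theory Num.Theory.
Import numFieldNormedType.Exports.
Local Open Scope classical_set_scope.
Local Open Scope ring_scope.

Record open_cover (X : topologicalType) := OpenCover {
  cidx : choiceType;
  cset :> cidx -> set X;
  cset_open : forall i, open (cset i);
  cset_cover : \bigcup_i cset i = setT }.

Definition locally_finite (X : topologicalType) (I : Type) (F : I -> set X) :=
  forall x : X, exists2 N, nbhs x N & finite_set [set i | F i `&` N !=set0].

Definition paracompact (X : topologicalType) :=
  hausdorff_space X /\
  forall U : open_cover X, exists V : open_cover X,
    (forall j, exists i, V j `<=` U i) /\ locally_finite V.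

(* [f] and [g] are homotopic as maps from [X] to the subspace [Y] of [T]. *)
Definition homotopic_in (R : realType) (X T : topologicalType) (Y : set T)
    (f g : X -> T) :=
  exists H : X * R -> T,
    [/\ {within [set: X] `*` `[0, 1]%classic, continuous H},
        forall x t, t \in `[0, 1] -> Y (H (x, t)),
        forall x, H (x, 0) = f x & forall x, H (x, 1) = g x].

(* Local contractibility in the weak sense: small neighbourhoods are
   null-homotopic in larger ones.  It is implied by the existence of a
   neighbourhood basis of contractible sets. *)
Definition locally_contractible (R : realType) (X : topologicalType) :=
  forall (x : X) (U : set X), nbhs x U ->
  exists V : set X, [/\ nbhs x V, V `<=` U &
    exists (H : X * R -> X) (c : X),
      [/\ {within V `*` `[0, 1]%classic, continuous H},
          forall y t, V y -> t \in `[0, 1] -> U (H (y, t)),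
          forall y, V y -> H (y, 0) = y & forall y, V y -> H (y, 1) = c]].

Definition partition_of_unity (R : realType) (X : topologicalType)
    (U : open_cover X) (phi : cidx U -> X -> R) :=
  [/\ forall i, continuous (phi i : X -> R^o),
      forall i x, 0 <= phi i x,
      forall i, closure [set x | phi i x != 0] `<=` U i,
      locally_finite (fun i => [set x | phi i x != 0]) &
      forall x, \sum_(i \in [set: cidx U]) phi i x = 1].

(* The direct limit (final) topology. *)
Section LimitTopology.
Context (T : Type) (Y : nat -> topologicalType) (incl : forall n, Y n -> T).

Definition lim_open : set_system T := [set O | forall n, open (@incl n @^-1` O)].

Lemma lim_openT : lim_open setT.
Proof. by move=> n; rewrite preimage_setT; exact: openT. Qed.

Lemma lim_openI : setI_closed lim_open.
Proof. by move=> O P oO oP n; rewrite preimage_setI; exact: openI. Qed.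

Lemma lim_open_bigU (I : Type) (F : I -> set T) :
  (forall i, lim_open (F i)) -> lim_open (\bigcup_i F i).
Proof.
by move=> oF n; rewrite preimage_bigcup; apply: bigcup_open => i _; exact: oF.
Qed.
End LimitTopology.

Section InfiniteMatrices.
Context (R : realType).

(* R^{oo x oo}, indexed from 0. *)
Definition mxinf :=
  {A : nat -> nat -> R | exists n, forall i j, (n <= i)%N || (n <= j)%N -> A i j = 0}.

Definition pad_fun n (A : 'M[R]_n) (i j : nat) : R :=
  if insub i : option 'I_n is Some a then
    if insub j : option 'I_n is Some b then A a b else 0
  else 0.

Lemma pad_subproof n (A : 'M[R]_n) :
  exists m, forall i j, (m <= i)%N || (m <= j)%N -> pad_fun A i j = 0.
Proof.
exists n => i j; rewrite /pad_fun.
by case: insubP => // a ai _; case: insubP => // b bj _; rewrite (leqNgt n i) (leqNgt n j) ai bj.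
Qed.

Definition pad n (A : 'M[R]_n) : mxinf := exist _ (pad_fun A) (pad_subproof A).

HB.instance Definition _ := gen_eqMixin mxinf.
HB.instance Definition _ := gen_choiceMixin mxinf.
HB.instance Definition _ := @isOpenTopological.Build mxinf
  (lim_open pad) (lim_openT pad) (@lim_openI _ _ pad) (@lim_open_bigU _ _ pad).

Definition vecinf := {v : nat -> R | exists n, forall i, (n <= i)%N -> v i = 0}.

Definition vpad_fun n (v : 'cV[R]_n) (i : nat) : R :=
  if insub i : option 'I_n is Some a then v a 0 else 0.

Lemma vpad_subproof n (v : 'cV[R]_n) :
  exists m, forall i, (m <= i)%N -> vpad_fun v i = 0.
Proof.
by exists n => i; rewrite /vpad_fun; case: insubP => // a ai _; rewrite leqNgt ai.
Qed.

Definition vpad n (v : 'cV[R]_n) : vecinf := exist _ (vpad_fun v) (vpad_subproof v).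

HB.instance Definition _ := gen_eqMixin vecinf.
HB.instance Definition _ := gen_choiceMixin vecinf.
HB.instance Definition _ := @isOpenTopological.Build vecinf
  (lim_open vpad) (lim_openT vpad) (@lim_openI _ _ vpad) (@lim_open_bigU _ _ vpad).

Definition frob n (A : 'M[R]_n) : R := Num.sqrt (\tr (A^T *m A)).

(* The sum has finite support, hence is the Frobenius norm of [A - B]
   computed in any R^{n x n} containing both. *)
Definition frob_dist (A B : mxinf) : R :=
  Num.sqrt (\sum_(p \in [set: nat * nat]) (sval A p.1 p.2 - sval B p.1 p.2) ^+ 2).

Definition mxinf_image (A : mxinf) : set vecinf :=
  [set v | exists u : vecinf,
     forall i, sval v i = \sum_(j \in [set: nat]) sval A i j * sval u j].

Definition Gr_fin (d n : nat) : set 'M[R]_n :=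
  [set A | [/\ A = A^T, A = A *m A & \rank A = d]].
Arguments Gr_fin : clear implicits.

(* All subsets of [mxinf] carry the subspace topology; on [Gr d] this is the
   direct limit topology, as each [Gr_fin d n] is closed in R^{n x n}. *)
Definition Gr (d : nat) : set mxinf := \bigcup_n (@pad n @` Gr_fin d n).

Definition Gr_thick (d : nat) (delta : R) : set mxinf :=
  if delta == 0 then Gr d
  else [set A | exists2 P, Gr d P & frob_dist A P < delta].

(* A Frobenius-closest point of [Gr d]; the default value is irrelevant where
   a closest point exists. *)
Definition Gr_proj (d : nat) (A : mxinf) : mxinf :=
  xget A [set P | Gr d P /\ forall Q, Gr d Q -> frob_dist A P <= frob_dist A Q].

End InfiniteMatrices.
Arguments Gr_fin : clear implicits.

(* Cochains on double intersections are represented by total families; only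
   the values on [U i `&` U j] enter the conditions below, so that the nerve
   condition on [(i, j)] and [(i, j, k)] is implicit.  Cohomology classes are
   sets of cocycles. *)
Section ApproximateCohomology.
Context (R : realType) (B : topologicalType) (U : open_cover B) (d : nat).

Definition orth : set 'M[R]_d := [set A | A^T *m A = 1%:M].

Definition mx_cochain := cidx U -> cidx U -> B -> 'M[R]_d.

Definition eps_close (eps : R) (A C : 'M[R]_d) :=
  if eps == 0 then A = C else frob (A - C) < eps.

Definition eps_cocycle (eps : R) (Om : mx_cochain) :=
  [/\ forall i j, {within U i `&` U j, continuous (Om i j)},
      forall i j y, (U i `&` U j) y -> orth (Om i j y),
      forall i j y, (U i `&` U j) y -> Om i j y = invmx (Om j i y) &
      forall i j k y, (U i `&` U j `&` U k) y ->
        eps_close eps (Om i j y *m Om j k y) (Om i k y)].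

Definition eps_equiv (Om Om' : mx_cochain) :=
  exists Th : cidx U -> B -> 'M[R]_d,
    [/\ forall i, {within U i, continuous (Th i)},
        forall i y, U i y -> orth (Th i y) &
        forall i j y, (U i `&` U j) y ->
          Om' i j y = Th i y *m Om i j y *m invmx (Th j y)].

Definition H1_eps (eps : R) : set (set mx_cochain) :=
  [set K | exists2 Om, eps_cocycle eps Om &
     K = [set Om' | eps_cocycle eps Om' /\ eps_equiv Om Om']].

End ApproximateCohomology.

Section CechModTwo.
Context (B : topologicalType).

Definition cochain2 (U : open_cover B) := cidx U -> cidx U -> B -> 'F_2.

Definition locally_constant_on (A : set B) (g : B -> 'F_2) :=
  forall y, A y -> \forall z \near y, A z -> g z = g y.

Definition cocycle2 (U : open_cover B) (c : cochain2 U) :=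
  [/\ forall i j, locally_constant_on (U i `&` U j) (c i j),
      forall i j y, (U i `&` U j) y -> c i j y = - c j i y &
      forall i j k y, (U i `&` U j `&` U k) y -> c i j y + c j k y = c i k y].

Definition equiv2 (U : open_cover B) (c c' : cochain2 U) :=
  exists th : cidx U -> B -> 'F_2,
    (forall i, locally_constant_on (U i) (th i)) /\
    forall i j y, (U i `&` U j) y -> c' i j y = th i y + c i j y - th j y.

Definition pull2 (U V : open_cover B) (r : cidx V -> cidx U) (c : cochain2 U) :
  cochain2 V := fun i j => c (r i) (r j).

Definition colim_equiv2 (U V : open_cover B) (c : cochain2 U) (c' : cochain2 V) :=
  exists (W : open_cover B) (r : cidx W -> cidx U) (r' : cidx W -> cidx V),
    [/\ forall k, W k `<=` U (r k), forall k, W k `<=` V (r' k) &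
        equiv2 (pull2 r c) (pull2 r' c')].

(* The map from the degree one Cech cohomology of [U] to the colimit over all
   open covers.  An element of the colimit is a class of pairs (cover, cocycle),
   written as a family of sets of cocycles indexed by the covers. *)
Definition cech_to_colim (U : open_cover B) (K : set (cochain2 U)) :
    forall V : open_cover B, set (cochain2 V) :=
  fun V => [set c' | cocycle2 c' /\ exists2 c, K c & colim_equiv2 c c'].

End CechModTwo.

(* {+1, -1} is identified with Z/2 by sending +1 to 0 and -1 to 1. *)
Definition det_cochain (R : realType) (B : topologicalType) (U : open_cover B)
    (d : nat) (Om : mx_cochain R U d) : cochain2 U :=
  fun i j y => (\det (Om i j y) != 1)%:R.

Definition sw1 (R : realType) (B : topologicalType) (U : open_cover B) (d : nat)
    (om : set (mx_cochain R U d)) : set (cochain2 U) :=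
  [set c | cocycle2 c /\ exists2 Om, om Om & equiv2 (det_cochain Om) c].

Section ClassifyingMap.
Context (R : realType) (B : topologicalType) (U : open_cover B) (d : nat).

(* Entry of [Phi_i y] in row [a] and column [k].  As [a] counts rows from 0
   and the blocks are placed at rows [d * iota j + r] counted from 1, at most
   one term of the sum is nonzero. *)
Definition Phi (phi : cidx U -> B -> R) (iota : cidx U -> nat)
    (Om : mx_cochain R U d) (i : cidx U) (y : B) (a : nat) (k : 'I_d) : R :=
  \sum_(j \in [set: cidx U]) \sum_(r < d | a.+1 == (d * iota j + r)%N)
    Num.sqrt (phi j y) * (Om i j y)^T r k.

Definition is_cl_map (phi : cidx U -> B -> R) (iota : cidx U -> nat)
    (Om : mx_cochain R U d) (g : B -> mxinf R) :=
  forall y a b, sval (g y) a b =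
    \sum_(i \in [set: cidx U])
      phi i y * \sum_(k < d) Phi phi iota Om i y a k * Phi phi iota Om i y b k.

(* The homotopy class, as a set of maps; it does not depend on the choices of
   representative, partition of unity and injection. *)
Definition cl (eps : R) (om : set (mx_cochain R U d)) : set (B -> mxinf R) :=
  [set g | exists Om phi iota g0,
     [/\ om Om, partition_of_unity phi,
         injective iota /\ (forall i, 0 < iota i)%N, is_cl_map phi iota Om g0 &
         homotopic_in R (Gr_thick d (Num.sqrt 2 * eps)) g0 g]].

(* The effect of [Gr_proj] on homotopy classes. *)
Definition pi_star (K : set (B -> mxinf R)) : set (B -> mxinf R) :=
  [set f | exists2 g, K g & homotopic_in R (Gr d) (Gr_proj d \o g) f].

End ClassifyingMap.

Section SingularCohomology.
Context (R : realType).

Definition stdsimplex n : set 'rV[R]_n.+1 :=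
  [set t | (forall i, 0 <= t 0 i) /\ \sum_i t 0 i = 1].
Arguments stdsimplex : clear implicits.

Section VertexMap.
Context (m n : nat) (th : 'I_m.+1 -> 'I_n.+1).

Definition vertex_fun (t : 'rV[R]_m.+1) : 'rV[R]_n.+1 :=
  \row_k \sum_(i | th i == k) t 0 i.

Lemma vertex_fun_simplex t : stdsimplex m t -> stdsimplex n (vertex_fun t).
Proof.
move=> [t0 t1]; split=> [k|]; first by rewrite mxE; exact: sumr_ge0.
under eq_bigr do rewrite mxE.
rewrite -t1 (partition_big th xpredT) //=.
Qed.

(* The affine map of standard simplices given on vertices by [th]. *)
Definition vertex_map (t : stdsimplex m) : stdsimplex n :=
  exist _ (vertex_fun (set_val t))
    (mem_set (vertex_fun_simplex (set_mem (valP t)))).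

Lemma vertex_fun_continuous : continuous vertex_fun.
Proof.
move=> t W [P tP sPW].
suff : \forall x \near t, forall k, P 0 k (vertex_fun x 0 k).
  apply: (@filterS _ (nbhs t) (nbhs_filter t)) => x Px; apply: sPW => i j.
  by rewrite (ord1 i); exact: Px.
apply: (@filter_forall _ 'I_n.+1 (fun k x => P 0 k (vertex_fun x 0 k)) (nbhs t)
  (nbhs_filter t)) => k.
have c : continuous (fun x : 'rV[R]_m.+1 => \sum_(i | th i == k) x 0 i).
  apply: (@continuous_big R^o 'I_m.+1 +%R 0 (fun i => th i == k)).
    exact: (@add_continuous R^o).
  by move=> i _; exact: coord_continuous.
have /(c t) : nbhs (\sum_(i | th i == k) t 0 i : R^o) (P 0 k).
  by have := tP 0 k; rewrite mxE.
by apply: (@filterS _ (nbhs t) (nbhs_filter t)) => x; rewrite /= mxE.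
Qed.

Lemma vertex_map_continuous : continuous vertex_map.
Proof.
apply: continuous_comp_initial => t.
apply: (@continuous_comp _ _ _ (set_val : stdsimplex m -> _) vertex_fun).
  exact: initial_continuous.
exact: vertex_fun_continuous.
Qed.

HB.instance Definition _ := isContinuous.Build _ _ vertex_map vertex_map_continuous.
End VertexMap.

Context (X : topologicalType).

Definition sing n := continuousType (stdsimplex n) X.

Definition restr m n (th : 'I_m.+1 -> 'I_n.+1) (s : sing n) : sing m :=
  (s : stdsimplex n -> X) \o vertex_map th.

(* Coefficients in Z/2: no signs are needed. *)
Definition cobound n (c : sing n -> 'F_2) : sing n.+1 -> 'F_2 :=
  fun s => \sum_(i < n.+2) c (restr (lift i) s).

Definition coboundary n : set (sing n -> 'F_2) :=
  match n with 0 => [set 0] | m.+1 => range (@cobound m) end.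

Definition cohom_class n (A : set (sing n -> 'F_2)) :=
  exists c, cobound c = 0 /\ A = [set c' | coboundary (c' - c)].

Definition cohomology n := {A : set (sing n -> 'F_2) | cohom_class A}.

(* Cup product in degree [n] of cochains of degrees [p] and [q], for
   [p + q = n]. *)
Definition cup n p q (a : sing p -> 'F_2) (b : sing q -> 'F_2) : sing n -> 'F_2 :=
  fun s => a (restr (fun k : 'I_p.+1 => inord k) s) *
           b (restr (fun k : 'I_q.+1 => inord (n - q + k)) s).

End SingularCohomology.
Arguments cup {R X} n {p q}.
Arguments stdsimplex : clear implicits.

Section Pullback.
Context (R : realType) (X Y : topologicalType) (f : continuousType X Y).

Definition push n (s : sing R X n) : sing R Y n :=
  f \o (s : stdsimplex R n -> X).

Definition pullback n (c : sing R Y n -> 'F_2) : sing R X n -> 'F_2 :=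
  fun s => c (push s).

End Pullback.

Section VectorBundles.
Context (R : realType).

(* Real vector bundle of constant rank [n]; [vincl x] identifies the vector
   space [vfib x] with the fibre of [vproj] over [x]. *)
Record vbundle (X : topologicalType) (n : nat) := VBundle {
  vtotal : topologicalType;
  vproj : vtotal -> X;
  vfib : X -> lmodType R;
  vincl : forall x, vfib x -> vtotal;
  vproj_continuous : continuous vproj;
  vincl_inj : forall x, injective (@vincl x);
  vincl_range : forall x, range (@vincl x) = vproj @^-1` [set x];
  vbundle_trivial : forall x, exists (U : set X)
      (h : forall y, {linear 'rV[R]_n -> vfib y}) (k : vtotal -> 'rV[R]_n),
    [/\ open U, U x,
        forall y, U y ->
          cancel (h y) (k \o @vincl y) /\ cancel (k \o @vincl y) (h y),
        {within U `*` [set: 'rV[R]_n], continuous (fun p => vincl (h p.1 p.2))} &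
        {within vproj @^-1` U, continuous k}] }.

Arguments vincl {X n} E {x} : rename.

(* A bundle map covering [f], isomorphic on fibres. *)
Definition bundle_map (X Y : topologicalType) (n : nat) (f : X -> Y)
    (E : vbundle X n) (F : vbundle Y n) (g : vtotal E -> vtotal F) :=
  continuous g /\
  forall x, exists l : {linear vfib E x -> vfib F (f x)},
    bijective l /\ forall v, g (vincl E v) = vincl F (l v).

(* [G] is isomorphic to the Whitney sum of [E] and [F]. *)
Definition whitney_sum (X : topologicalType) (m n : nat)
    (E : vbundle X m) (F : vbundle X n) (G : vbundle X (m + n)) :=
  exists s : vtotal E * vtotal F -> vtotal G,
    {within [set p | vproj p.1 = vproj p.2], continuous s} /\
    forall x, exists l : {linear (vfib E x * vfib F x)%type -> vfib G x},
      bijective l /\ forall u v, s (vincl E u, vincl F v) = vincl G (l (u, v)).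

(* [L] is isomorphic to the tautological line bundle over the projective line
   of rank one projections of R^2. *)
Definition tautological_line (L : vbundle (Gr_fin R 1 2) 1) :=
  exists g : vtotal L -> 'cV[R]_2,
    continuous g /\
    forall A, exists l : {linear vfib L A -> 'cV[R]_2},
      [/\ injective l, range l = range (mulmx (set_val A)) &
          forall v, g (vincl L v) = l v].

(* Stiefel-Whitney classes, by their defining axioms. *)
Record stiefel_whitney := StiefelWhitney {
  sw : forall (X : topologicalType) n, vbundle X n ->
    forall i, cohomology R X i;
  sw_deg0 : forall (X : topologicalType) n (E : vbundle X n),
    sval (sw E 0) (fun=> 1);
  sw_rank : forall (X : topologicalType) n (E : vbundle X n) i, (n < i)%N ->
    sval (sw E i) 0;
  sw_natural : forall (X Y : topologicalType) n (f : continuousType X Y)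
      (E : vbundle X n) (F : vbundle Y n) (g : vtotal E -> vtotal F) i c,
    bundle_map f g -> sval (sw F i) c -> sval (sw E i) (pullback f c);
  sw_whitney : forall (X : topologicalType) m n
      (E : vbundle X m) (F : vbundle X n) (G : vbundle X (m + n)) k
      (a b : forall i, sing R X i -> 'F_2),
    whitney_sum E F G ->
    (forall i, sval (sw E i) (a i)) -> (forall i, sval (sw F i) (b i)) ->
    sval (sw G k) (\sum_(i < k.+1) cup k (a i) (b (k - i)%N));
  sw_tautological : forall L : vbundle (Gr_fin R 1 2) 1,
    tautological_line L -> ~ sval (sw L 1) 0 }.

(* [E] is the bundle classified by [f], up to isomorphism: its fibre over [y]
   is the image of the projection [f y]. *)
Definition classified_by (B : topologicalType) (d : nat) (E : vbundle B d)
    (f : B -> mxinf R) :=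
  exists g : vtotal E -> vecinf R,
    continuous g /\
    forall y,
      [/\ forall a (u v : vfib E y) i,
            sval (g (vincl E (a *: u + v))) i =
            a * sval (g (vincl E u)) i + sval (g (vincl E v)) i,
          injective (fun v : vfib E y => g (vincl E v)) &
          range (fun v : vfib E y => g (vincl E v)) = mxinf_image (f y)].

End VectorBundles.

Section CechToSingular.
Context (R : realType) (B : topologicalType).

(* The comparison in the double complex of Cech cochains with values in
   singular cochains: [c] and [s] correspond if some family [f] of singular
   0-cochains on the members of [V] has Cech coboundary [c] and singular
   coboundary the restrictions of [s]. *)
Definition cech_sing (V : open_cover B) (c : cochain2 V)
    (s : sing R B 1 -> 'F_2) :=
  exists f : cidx V -> sing R B 0 -> 'F_2,
    (forall i (p : sing R B 1), range p `<=` V i -> s p = cobound (f i) p) /\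
    (forall i j (p : sing R B 0), range p `<=` V i `&` V j ->
      forall t, c i j (p t) = f j p - f i p).

(* The map from Cech to singular cohomology in degree one, an isomorphism when
   [B] is paracompact and locally contractible. *)
Definition colim_to_sing (K : forall V : open_cover B, set (cochain2 V)) :
    set (sing R B 1 -> 'F_2) :=
  [set s | cobound s = 0 /\ exists V, exists2 c, K V c & cech_sing c s].

End CechToSingular.

(* Main.v *)
Require Import Defs.
From HB Require Import structures.
From mathcomp Require Import all_boot all_order all_algebra.
From mathcomp Require Import all_classical all_reals all_analysis.
From mathcomp Require Import ring lra.
From mathcomp Require Import finmap.

(** A singular 1-cocycle is determined, up to coboundaries, by its values on loops.  Along a
    loop a vector bundle of rank m + 1 is trivial after cutting, and since an invertible
    matrix can be joined to 1 or to diag(-1, 1, ..., 1), it is the pullback of the trivial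
    bundle or of the sum of the tautological line and a trivial bundle over the projective
    line.  Hence the axioms force w_1 to take the value 0 or 1 on the loop according to whether
    the bundle is orientable along it.

    For projections P, Q, S of the same rank with |P - Q|, |P - S| < 1 / sqrt 2, spanned by
    frames F, G, H, one has det(F^t G) det(G^t H) det(F^t H) > 0.  So the signs of Gram
    determinants transport orientations along any path of matrices near the Grassmannian,
    and the resulting holonomy of loops is invariant under homotopy: it is the same for
    the classified projection f and for the map cl(Omega), whose values lie within
    sqrt 2 * (2/9) of the projection to the span of each frame Phi_i.  The sign of
    det(Phi_i^t Phi_j) is that of det Omega_ij, because Phi_i^t Phi_j is an average of
    orthogonal matrices close to Omega_ij.

    As w_1 agrees with the holonomy of these frames on loops, it differs from the transport of
    orientations along paths by a difference of potentials; this potential provides the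
    0-cochains on the members of the cover that relate det Omega to w_1. *)

Set Implicit Arguments.
Unset Strict Implicit.
Unset Printing Implicit Defensive.
Import Order.TTheory GRing.Theory Num.Theory.
Import numFieldNormedType.Exports.
Local Open Scope classical_set_scope.
Local Open Scope ring_scope.

(** The frames at hand are mostly chosen point by point, without continuity. Continuity is therefore
    replaced by signs: along a path, frames carry a function to F_2 that has to change by exactly
    the sign of the Gram determinant of neighbouring frames, and one family of frames near the path
    can be exchanged for another.

    The bound 1 / sqrt 2 comes from |P - Q P|^2 = |P - Q|^2 / 2 for projections of equal rank: below
    it, every nonzero vector of the image of P makes an angle of less than 30 degrees with the image
    of Q. Two projections within sqrt 2 * eps of one matrix are within 2 sqrt 2 * eps of each other,
    which is below 1 / sqrt 2 for eps < 1 / 4. The margin between 2 / 9 and 1 / 4 pays for rational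
    radii and for moving the matrix.

    The comparison of Cech and singular classes asks for explicit 0-cochains, whereas the axioms are
    exploited on loops only. Hence the detour through a potential, obtained by integrating from a
    base point of each path component. *)

(** * Induction on an interval, and gluing of continuous maps *)

Section IntervalInduction.
Context (R : realType).

(** The supremum of the points reachable from [a] is itself reachable, and the local hypothesis at
    it would reach further if it were below [b]. This serves as compactness of the interval; [P x y]
    may also be the existence of a structure over [x, y], in which case the last hypothesis is
    gluing. *)
Lemma interval_ind (P : R -> R -> Prop) (a b : R) : a <= b ->
  (forall t, a <= t <= b -> exists2 e, 0 < e & forall x y, a <= x -> x <= y ->
     y <= b -> `|x - t| < e -> `|y - t| < e -> P x y) ->
  (forall x y z, x <= y <= z -> P x y -> P y z -> P x z) -> P a b.
Proof.
move=> ab Ploc Ptr.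
pose S := [set x | a <= x <= b /\ P a x].
have Sa : S a.
  split; first by rewrite lexx.
  have [|e e0 Pe] := Ploc a; first by rewrite lexx.
  by apply: Pe; rewrite ?subrr ?normr0.
have supS : has_sup S by split; [exists a|exists b => x [/andP[]]].
have Sub : ubound S (sup S) by exact: sup_upper_bound.
have ac : a <= sup S by exact: Sub.
have cb : sup S <= b by apply: ge_sup; [exists a|move=> x [/andP[]]].
have [|e e0 Pe] := Ploc (sup S); first by rewrite ac.
have [x Sx] := sup_adherent e0 supS.
move=> xe; have xc := Sub _ Sx.
have reach y : sup S <= y <= b -> `|y - sup S| < e -> S y.
  move=> /andP[cy yb] ye; have xy := le_trans xc cy.
  case: Sx => /andP[ax xb] Pax; split; first by rewrite yb (le_trans ac).
  apply: (Ptr a x y); rewrite ?ax ?xy //.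
  by apply: Pe => //; rewrite ltr_distl; apply/andP; split; lra.
have [->|cb'] := eqVneq b (sup S).
  by case: (reach (sup S)); rewrite ?lexx ?subrr ?normr0.
have {cb'}cb' : sup S < b by rewrite lt_neqAle cb eq_sym cb'.
pose y := Num.min b (sup S + e / 2).
have cy : sup S < y by rewrite lt_min cb' /=; lra.
have yb : y <= b by rewrite ge_min lexx.
have ye : y <= sup S + e / 2 by rewrite ge_min lexx orbT.
have /Sub : S y.
  by apply: reach; rewrite ?(ltW cy) // ltr_distl; apply/andP; split; lra.
by rewrite leNgt cy.
Qed.

Lemma near_ball (t : R) (Q : R -> Prop) : (\forall x \near t, Q x) ->
  exists2 e, 0 < e & forall x, `|x - t| < e -> Q x.
Proof.
by move=> /nbhs_ballP[e e0 Qe]; exists e => // x xt; apply: Qe; rewrite /ball /= distrC.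
Qed.

Lemma ball_near (t e : R) (Q : R -> Prop) : 0 < e ->
  (forall x, `|x - t| < e -> Q x) -> \forall x \near t, Q x.
Proof.
move=> e0 Qe; apply/nbhs_ballP; exists e => // x; rewrite /ball /= distrC; exact: Qe.
Qed.

Lemma near_closed_ball (t : R) (Q : R -> Prop) : (\forall x \near t, Q x) ->
  exists2 e, 0 < e & forall x, `|x - t| <= e -> Q x.
Proof.
move=> /near_ball[e e0 Qe]; exists (e / 2); first by rewrite divr_gt0.
by move=> x xe; apply: Qe; apply: le_lt_trans xe _; lra.
Qed.

Lemma interval_iff (Q : R -> Prop) :
  (forall t : R, 0 <= t <= 1 -> \forall x \near t, 0 <= x <= 1 -> (Q x <-> Q t)) ->
  Q 0 <-> Q 1.
Proof.
move=> Qloc; apply: (@interval_ind (fun x y => Q x <-> Q y)) => // [t t01|x y z _ -> ->//].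
have [e e0 Qe] := near_ball (Qloc t t01); exists e => // x y x0 xy y1 xt yt.
have Qx := Qe x xt; have Qy := Qe y yt.
by rewrite Qx ?x0 ?(le_trans xy) // Qy ?y1 ?(le_trans x0).
Qed.

Lemma interval_const (T : Type) (b : R -> T) :
  (forall t : R, 0 <= t <= 1 -> \forall x \near t, 0 <= x <= 1 -> b x = b t) -> b 0 = b 1.
Proof.
move=> bloc; apply/esym; apply/(interval_iff (Q := fun x => b x = b 0)) => // t t01.
by apply: filterS (bloc t t01) => x /[apply] ->.
Qed.

(** Retraction of the line onto the closed ball of radius [e] about [t]. Precomposing a path with it
    makes a property that holds near [t] hold at every real parameter. *)
Definition clamp_at (t e x : R) : R := Num.max (t - e) (Num.min (t + e) x).

Lemma clamp_at_continuous t e : continuous (clamp_at t e : R -> R).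
Proof.
move=> x; apply: (@continuous_max R R (fun=> t - e) (fun z => Num.min (t + e) z)).
  exact: cst_continuous.
by apply: (@continuous_min R R (fun=> t + e) id); [exact: cst_continuous|].
Qed.

Lemma clamp_at_id t e x : `|x - t| <= e -> clamp_at t e x = x.
Proof.
rewrite ler_norml => /andP[h1 h2]; rewrite /clamp_at min_r ?max_r //; lra.
Qed.

Lemma clamp_at_near t e x : 0 < e -> `|clamp_at t e x - t| <= e.
Proof.
move=> e0; have e1 : t - e <= clamp_at t e x by rewrite le_max lexx.
have e2 : clamp_at t e x <= t + e by rewrite ge_max ge_min lexx andbT; lra.
by rewrite ler_norml; apply/andP; split; lra.
Qed.

End IntervalInduction.

Section Glue.
Context (R : realType) (X Y : topologicalType).

Lemma glue_continuous (p : X -> R) (b : R) (f g : X -> Y) : continuous p ->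
  continuous f -> continuous g -> (forall x, p x = b -> f x = g x) ->
  continuous (fun x => if p x <= b then f x else g x).
Proof.
move=> pc fc gc fg x; have [pb|pb|pb] := ltgtP (p x) b.
- rewrite /continuous_at (ltW pb); apply: cvg_trans (fc x); apply: near_eq_cvg.
  have H : \forall y \near x, p y < b.
    apply: (pc x [set y | y < b]); apply: open_nbhs_nbhs; split => //; exact: open_lt.
  by apply: (@filterS _ (nbhs x) (nbhs_filter x) _ _ _ H) => y /ltW ->.
- rewrite /continuous_at leNgt pb /=; apply: cvg_trans (gc x); apply: near_eq_cvg.
  have H : \forall y \near x, b < p y.
    apply: (pc x [set y | b < y]); apply: open_nbhs_nbhs; split => //; exact: open_gt.
  by apply: (@filterS _ (nbhs x) (nbhs_filter x) _ _ _ H) => y yb; rewrite leNgt yb.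
- move=> W; rewrite pb lexx => Wx.
  have fW := fc x W Wx; have gW := gc x W; rewrite -(fg x pb) in gW.
  by apply: (@filterS2 _ (nbhs x) (nbhs_filter x)) fW (gW Wx) => y /=; case: ifP.
Qed.

End Glue.

(** * Singular 1-cocycles along paths *)

Section SingularPaths.
Context (R : realType).

Lemma simplex_coord_continuous n (i : 'I_n.+1) :
  continuous (fun t : stdsimplex R n => (set_val t : 'rV[R]_n.+1) 0 i : R^o).
Proof.
move=> t; apply: (@continuous_comp _ _ _ (set_val : stdsimplex R n -> 'rV[R]_n.+1)
  (fun v => v 0 i : R^o)); first exact: initial_continuous.
exact: coord_continuous.
Qed.

(** Homotopies of paths are given below by maps of the plane into [X]; composing them with affine
    simplices of the plane gives singular simplices whose faces are read off from the vertices. *)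
Definition affine_simplex n (v : 'I_n.+1 -> R * R) (t : stdsimplex R n) : R * R :=
  (\sum_i (set_val t : 'rV[R]_n.+1) 0 i * (v i).1,
   \sum_i (set_val t : 'rV[R]_n.+1) 0 i * (v i).2).

Lemma affine_simplex_continuous n (v : 'I_n.+1 -> R * R) : continuous (affine_simplex v).
Proof.
have c (w : 'I_n.+1 -> R) : continuous (fun t : stdsimplex R n =>
    \sum_i (set_val t : 'rV[R]_n.+1) 0 i * w i : R^o).
  apply: continuous_big; first exact: (@add_continuous R^o).
  move=> i _ u; apply: (@continuousM R (stdsimplex R n)).
    exact: simplex_coord_continuous.
  exact: cst_continuous.
by move=> t; exact: (cvg_pair (c (fun i => (v i).1) t) (c (fun i => (v i).2) t)).
Qed.

Context (X : topologicalType).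

Definition affine_sing (F : R * R -> X) (cF : continuous F) n (v : 'I_n.+1 -> R * R) :
  sing R X n := mkcts cF \o mkcts (@affine_simplex_continuous n v).

Lemma restr_affine_sing (F : R * R -> X) (cF : continuous F) m n
    (th : 'I_m.+1 -> 'I_n.+1) v :
  restr th (affine_sing cF v) = affine_sing cF (v \o th).
Proof.
apply/continuousEP => t /=; congr (F (_, _)).
  transitivity (\sum_k \sum_(i | th i == k) (set_val t : 'rV[R]_m.+1) 0 i * (v (th i)).1).
    apply: eq_bigr => k _; rewrite mxE mulr_suml; apply: eq_bigr => i /eqP -> //.
  by rewrite [RHS](partition_big th xpredT).
transitivity (\sum_k \sum_(i | th i == k) (set_val t : 'rV[R]_m.+1) 0 i * (v (th i)).2).
  apply: eq_bigr => k _; rewrite mxE mulr_suml; apply: eq_bigr => i /eqP -> //.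
by rewrite [RHS](partition_big th xpredT).
Qed.

Definition edge_sing (F : R * R -> X) (cF : continuous F) (p q : R * R) : sing R X 1 :=
  affine_sing cF (fun i : 'I_2 => if i == 0 :> nat then p else q).

Definition point_sing (x : X) : sing R X 0 := cst x.

Lemma vertex_simplexP : stdsimplex R 0 (const_mx 1).
Proof. by split=> [i|]; rewrite ?big_ord1 mxE. Qed.

Definition vertex_point : stdsimplex R 0 :=
  exist _ (const_mx 1) (mem_set vertex_simplexP).

Definition point_cochain (g : X -> 'F_2) (p : sing R X 0) : 'F_2 := g (p vertex_point).

Lemma sing0E (s : sing R X 0) : exists x, s = point_sing x.
Proof.
exists (s vertex_point); apply/continuousEP => t /=.
congr (s _); apply/val_inj/rowP => i /=; rewrite mxE ord1.
by case: t => t tS /=; move: (set_mem tS) => [_]; rewrite big_ord1.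
Qed.

Lemma edge_sing_val (t : stdsimplex R 1) : exists a b : R, [/\ 0 <= a, 0 <= b, a + b = 1 &
  forall (F : R * R -> X) (cF : continuous F) (p q : R * R), edge_sing cF p q t =
    F (a * p.1 + b * q.1, a * p.2 + b * q.2)].
Proof.
exists ((set_val t : 'rV[R]_2) 0 ord0), ((set_val t : 'rV[R]_2) 0 (lift ord0 ord0)).
case: (set_mem (valP t)) => t0 t1; split; rewrite ?t0 //.
  by move: t1; rewrite !big_ord_recl big_ord0 addr0.
by move=> F cF p q; congr (F (_, _)); rewrite !big_ord_recl big_ord0 addr0.
Qed.

Lemma edge_sing_ext (F G : R * R -> X) (cF : continuous F) (cG : continuous G) (p q p' q' : R * R) :
  (forall a b : R, 0 <= a -> 0 <= b -> a + b = 1 ->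
    F (a * p.1 + b * q.1, a * p.2 + b * q.2) = G (a * p'.1 + b * q'.1, a * p'.2 + b * q'.2)) ->
  edge_sing cF p q = edge_sing cG p' q'.
Proof.
move=> FG; apply/continuousEP => t.
by have [a [b [a0 b0 ab E]]] := edge_sing_val t; rewrite (E F) ?(E G); exact: FG.
Qed.

Lemma edge_sing_cst (F : R * R -> X) (cF : continuous F) (p q : R * R) x :
  (forall a b : R, 0 <= a -> 0 <= b -> a + b = 1 ->
    F (a * p.1 + b * q.1, a * p.2 + b * q.2) = x) ->
  edge_sing cF p q = (cst x : continuousType _ _).
Proof.
move=> FG; apply/continuousEP => t.
by have [a [b [a0 b0 ab E]]] := edge_sing_val t; rewrite (E F); exact: FG.
Qed.

Lemma F2_addxx (x : 'F_2) : x + x = 0.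
Proof. by case: x => [[|[|//]] ?]; apply/val_inj. Qed.

Lemma F2_opp (x : 'F_2) : - x = x.
Proof. by case: x => [[|[|//]] ?]; apply/val_inj. Qed.

Lemma F2_addK (x y : 'F_2) : x + y + y = x.
Proof. by rewrite -addrA F2_addxx addr0. Qed.

Lemma F2_eq (x y : 'F_2) : x + y = 0 -> x = y.
Proof. by move=> xy; rewrite -[x](F2_addK _ y) xy add0r. Qed.

Lemma comp_fst_continuous (h : R -> X) : continuous h -> continuous (h \o (@fst R R)).
Proof. by move=> ch t; apply: continuous_comp; [exact: cvg_fst|exact: ch]. Qed.

Definition path_sing (h : R -> X) (ch : continuous h) (a b : R) : sing R X 1 :=
  edge_sing (comp_fst_continuous ch) (a, 0) (b, 0).

Lemma path_sing_ext (h k : R -> X) (ch : continuous h) (ck : continuous k) (a b a' b' : R) :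
  (forall x y : R, 0 <= x -> 0 <= y -> x + y = 1 ->
    h (x * a + y * b) = k (x * a' + y * b')) ->
  path_sing ch a b = path_sing ck a' b'.
Proof. by move=> hk; apply: edge_sing_ext => x y /= x0 y0 xy; exact: hk. Qed.

Definition clamp (t : R) : R := Num.max 0 (Num.min 1 t).

Lemma clamp_continuous : continuous (clamp : R -> R).
Proof.
move=> t; apply: (@continuous_max R R); first exact: cst_continuous.
by apply: (@continuous_min R R); [exact: cst_continuous|].
Qed.

Lemma clamp_id t : 0 <= t <= 1 -> clamp t = t.
Proof. by move=> /andP[t0 t1]; rewrite /clamp min_r // max_r. Qed.

Lemma clamp_ge0 t : 0 <= clamp t <= 1.
Proof.
rewrite /clamp le_max lexx /= ge_max ler01 /=; by rewrite ge_min lexx.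
Qed.

Definition simplex_point (t : R) : 'rV[R]_2 := \row_(i < 2) if i == 0 :> nat then 1 - clamp t else clamp t.

Lemma simplex_pointP t : stdsimplex R 1 (simplex_point t).
Proof.
have /andP[t0 t1] := clamp_ge0 t; split=> [i|]; last by rewrite !big_ord_recl big_ord0 !mxE /=; ring.
by rewrite mxE; case: ifP; rewrite ?subr_ge0.
Qed.

Definition segment_point (t : R) : stdsimplex R 1 :=
  exist _ (simplex_point t) (mem_set (simplex_pointP t)).

Lemma segment_point_continuous : continuous segment_point.
Proof.
apply: continuous_comp_initial => t W [P tP sPW].
suff : \forall x \near t, forall k, P 0 k (simplex_point x 0 k).
  apply: (@filterS _ (nbhs t) (nbhs_filter t)) => x Px; apply: sPW => i j.
  by rewrite (ord1 i); exact: Px.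
apply: (@filter_forall _ 'I_2 (fun k x => P 0 k (simplex_point x 0 k)) (nbhs t)
  (nbhs_filter t)) => k.
have c : continuous (fun x : R => simplex_point x 0 k : R^o).
  rewrite (_ : (fun x : R => _) =
    fun x : R => if k == 0 :> nat then 1 - clamp x else clamp x); last first.
    by apply/funext => x; rewrite mxE.
  case: (k == 0 :> nat) => x; last exact: clamp_continuous.
  by apply: (@continuousB R R^o R); [exact: cst_continuous|exact: clamp_continuous].
exact: (c t _ (tP 0 k)).
Qed.

(** Clamping the parameter to [0, 1] extends a singular edge to a path on the whole line without
    enlarging its image. *)
Lemma sing1E (p : sing R X 1) : exists h (ch : continuous h),
  [/\ p = path_sing ch 0 1, forall t, range p (h t), h 0 = p (segment_point 0) & h 1 = p (segment_point 1)].
Proof.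
have ch : continuous ((p : stdsimplex R 1 -> X) \o segment_point).
  move=> t; apply: (@continuous_comp _ _ _ segment_point p).
    exact: segment_point_continuous.
  exact: cts_fun.
exists (p \o segment_point), ch; split; [|by move=> t; exists (segment_point t)|by []|by []].
apply/continuousEP => t.
change (p t = p (segment_point (affine_simplex
  (fun i : 'I_2 => if i == 0 :> nat then (0, 0) else (1, 0)) t).1)).
rewrite /affine_simplex !big_ord_recl !big_ord0 /=.
congr (p _); apply/val_inj/rowP => i /=; rewrite mxE mulr0 add0r mulr1 addr0.
case: t => t tS /=; move: (set_mem tS) => [t0]; rewrite !big_ord_recl big_ord0 addr0 => t1.
rewrite clamp_id; last by rewrite t0 -t1 lerDr t0.
case: ifP => [/eqP i0|i0]; rewrite -?t1 ?addrK; congr (t 0 _); apply/val_inj => //=.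
by case: i i0 => [[|[|//]] ?].
Qed.

Context (s : sing R X 1 -> 'F_2) (cs : cobound s = 0).

Lemma cobound_sing_triple (t : sing R X 2) :
  s (restr (lift ord0) t) + (s (restr (lift (lift ord0 ord0)) t)
   + s (restr (lift (lift ord0 (lift ord0 ord0))) t)) = 0.
Proof.
have : cobound s t = 0 by rewrite cs.
by rewrite /cobound !big_ord_recl big_ord0 addr0.
Qed.

(** The cocycle condition on the affine triangle with vertices [p], [q], [r], which may be
    degenerate. *)
Lemma edge_add (F : R * R -> X) (cF : continuous F) p q r :
  s (edge_sing cF p q) + s (edge_sing cF q r) = s (edge_sing cF p r).
Proof.
pose v (i : 'I_3) := if i == 0 :> nat then p else if i == 1 :> nat then q else r.
have := cobound_sing_triple (affine_sing cF v); rewrite !restr_affine_sing.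
have e (th : 'I_2 -> 'I_3) x y : v (th ord0) = x -> v (th ord_max) = y ->
    affine_sing cF (v \o th) = edge_sing cF x y.
  move=> vx vy; congr affine_sing; apply/funext => i /=.
  by case: ifP => i0; rewrite -?vx -?vy; congr (v (th _)); apply/val_inj => //=;
    [exact/eqP|case: i i0 => [[|[|//]] ?]].
rewrite (e _ q r) // (e _ p r) // (e _ p q) // => /F2_eq ->.
by rewrite addrC F2_addK.
Qed.

(** The three faces of the constant 2-simplex are the constant edge, and three times a value is that
    value mod 2. *)
Lemma cst_sing0 (x : X) : s (cst x : continuousType _ _) = 0.
Proof.
have := cobound_sing_triple (cst x : sing R X 2).
have e (th : 'I_2 -> 'I_3) : restr th (cst x : sing R X 2) = (cst x : sing R X 1).
  by apply/continuousEP.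
by rewrite !e F2_addxx addr0.
Qed.

Lemma path_add h (ch : continuous h) a b c :
  s (path_sing ch a b) + s (path_sing ch b c) = s (path_sing ch a c).
Proof. exact: edge_add. Qed.

Lemma path_refl h (ch : continuous h) a : s (path_sing ch a a) = 0.
Proof. by have := path_add ch a a a; rewrite F2_addxx. Qed.

Lemma path_sym h (ch : continuous h) a b : s (path_sing ch a b) = s (path_sing ch b a).
Proof. by apply: F2_eq; rewrite path_add path_refl. Qed.

(** [F] contracts [phi] along straight lines to [phi a]. On the rectangle [0, 1] x [a, b] the side
    at 0 is [k], the side at height b is the straight path of [h] from [phi b] to [phi a], and the
    two other sides are constant. *)
Lemma path_reparam h (ch : continuous h) k (ck : continuous k) (phi : R -> R) a b :
  continuous phi -> (forall t, k t = h (phi t)) ->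
  s (path_sing ck a b) = s (path_sing ch (phi a) (phi b)).
Proof.
move=> cphi hk; pose F (p : R * R) := h ((1 - p.1) * phi p.2 + p.1 * phi a).
have cF : continuous F.
  move=> p; apply: (@continuous_comp _ _ _
    (fun p : R * R => (1 - p.1) * phi p.2 + p.1 * phi a : R) h); last exact: ch.
  apply: (@continuousD R R^o (R * R)%type).
    apply: (@continuousM R (R * R)%type).
      by apply: (@continuousB R R^o (R * R)%type); [exact: cst_continuous|exact: cvg_fst].
    by apply: (@continuous_comp _ _ _ (@snd R R) phi); [exact: cvg_snd|exact: cphi].
  by apply: (@continuousM R (R * R)%type); [exact: cvg_fst|exact: cst_continuous].
have E1 : edge_sing cF (0, a) (0, b) = path_sing ck a b.
  by apply: edge_sing_ext => x y _ _ _ /=; rewrite hk /F /=; congr (h _); ring.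
have E2 : edge_sing cF (0, b) (1, b) = path_sing ch (phi b) (phi a).
  apply: edge_sing_ext => x y _ _ xy /=; rewrite /F /=; congr (h _).
  have -> : x * b + y * b = b by rewrite -mulrDl xy mul1r.
  have -> : x = 1 - y by lra.
  ring.
have E3 : edge_sing cF (1, b) (1, a) = (cst (h (phi a)) : continuousType _ _).
  by apply: edge_sing_cst => x y _ _ xy /=; rewrite /F /= !mulr1 xy; congr (h _); ring.
have E4 : edge_sing cF (1, a) (0, a) = (cst (h (phi a)) : continuousType _ _).
  apply: edge_sing_cst => x y _ _ xy /=; rewrite /F /=; congr (h _).
  have -> : x * a + y * a = a by rewrite -mulrDl xy mul1r.
  ring.
rewrite (path_sym ch (phi a)) -E1 -E2; apply: F2_eq.
rewrite edge_add; have := edge_add cF (0, a) (1, b) (1, a).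
rewrite E3 cst_sing0 addr0 => ->; have := edge_add cF (0, a) (1, a) (0, a).
rewrite E4 cst_sing0 addr0 => ->.
by have := edge_add cF (0, a) (0, a) (0, a); rewrite F2_addxx.
Qed.

Lemma cobound_path (m : sing R X 0 -> 'F_2) h (ch : continuous h) a b :
  cobound m (path_sing ch a b) = m (point_sing (h b)) + m (point_sing (h a)).
Proof.
have e (v : 'I_1 -> R * R) : affine_sing (comp_fst_continuous ch) v = point_sing (h (v ord0).1).
  apply/continuousEP => t; change (h (affine_simplex v t).1 = h (v ord0).1).
  rewrite /affine_simplex /= big_ord1; congr h.
  by case: (set_mem (valP t)) => _; rewrite big_ord1 => ->; rewrite mul1r.
by rewrite /cobound !big_ord_recl big_ord0 addr0 !restr_affine_sing !e.
Qed.

Lemma cobound_of_paths (r : sing R X 1 -> 'F_2) (m : sing R X 0 -> 'F_2) :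
  (forall h (ch : continuous h),
    r (path_sing ch 0 1) = m (point_sing (h 0)) + m (point_sing (h 1))) ->
  r = cobound m.
Proof.
move=> rm; apply/funext => p; have [h [ch [-> _ _ _]]] := sing1E p.
by rewrite rm cobound_path addrC.
Qed.

Section Concatenation.
Variables (h k : R -> X).
Hypotheses (ch : continuous h) (ck : continuous k) (hk : h 1 = k 0).

Definition cat_path (t : R) := if t <= 2^-1 then h (2 * t) else k (2 * t - 1).

Lemma cat_path_continuous : continuous cat_path.
Proof.
have c2 : continuous (fun t : R => 2 * t : R^o).
  by move=> t; apply: (@cvgM R); [exact: cvg_cst|exact: cvg_id].
apply: (@glue_continuous R R X id); first by move=> t; exact: cvg_id.
- by move=> t; apply: (@continuous_comp _ _ _ (fun t : R => 2 * t) h); [exact: c2|exact: ch].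
- move=> t; apply: (@continuous_comp _ _ _ (fun t : R => 2 * t - 1) k); last exact: ck.
  by apply: (@continuousB R R^o R); [exact: c2|exact: cst_continuous].
- by move=> t ->; rewrite mulfV ?pnatr_eq0 // subrr.
Qed.

Lemma cat_path0 : cat_path 0 = h 0.
Proof. by rewrite /cat_path mulr0 ifT // invr_ge0. Qed.

Lemma cat_path1 : cat_path 1 = k 1.
Proof.
rewrite /cat_path ifF; first by congr k; ring.
by apply/negbTE; rewrite -ltNge invf_lt1 ?ltr1n.
Qed.

Lemma cat_path_left t : 0 <= t <= 1 -> cat_path (t / 2) = h t.
Proof.
move=> /andP[t0 t1]; have tt : t / 2 <= 2^-1 by rewrite ler_pdivrMr // mulVf ?pnatr_eq0.
by rewrite /cat_path tt; congr h; field.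
Qed.

Lemma cat_path_right t : 0 <= t <= 1 -> cat_path ((t + 1) / 2) = k t.
Proof.
move=> /andP[t0 t1]; rewrite /cat_path ler_pdivrMr // mulVf ?pnatr_eq0 //; case: ifP => tt.
  have -> : t = 0 by lra.
  by rewrite -hk; congr h; field.
by congr k; field.
Qed.

Lemma path_cat (cc : continuous cat_path) :
  s (path_sing cc 0 1) = s (path_sing ch 0 1) + s (path_sing ck 0 1).
Proof.
rewrite -(path_add cc 0 2^-1 1); congr (s _ + s _); apply: path_sing_ext => x y x0 y0 xy.
  rewrite !mulr0 !add0r mulr1; apply: cat_path_left; rewrite y0 -xy lerDr //.
rewrite mulr0 add0r !mulr1 -cat_path_right; last by rewrite y0 -xy lerDr.
by congr cat_path; rewrite -{2}xy; field.
Qed.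

End Concatenation.

Lemma path_rev (h k : R -> X) (ch : continuous h) (ck : continuous k) :
  (forall t, k t = h (1 - t)) -> s (path_sing ck 0 1) = s (path_sing ch 0 1).
Proof.
move=> hk; rewrite (path_sym ch); congr s; apply: path_sing_ext => x y _ _ xy.
rewrite hk; congr h; have -> : x = 1 - y by lra.
ring.
Qed.

(** Telescoping: the values of [m] at intermediate points occur twice and cancel mod 2, so short
    subintervals suffice. *)
Lemma path_local (h : R -> X) (ch : continuous h) (m : R -> 'F_2) :
  (forall t, 0 <= t <= 1 -> exists2 e, 0 < e & forall x y, 0 <= x -> x <= y -> y <= 1 ->
    `|x - t| < e -> `|y - t| < e -> s (path_sing ch x y) = m x + m y) ->
  s (path_sing ch 0 1) = m 0 + m 1.
Proof.
move=> loc; apply: (interval_ind (P := fun x y => s (path_sing ch x y) = m x + m y)) => //.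
by move=> x y z _ xy yz; rewrite -(path_add ch x y z) xy yz addrA F2_addK.
Qed.

End SingularPaths.

(** * Limits of matrices and positivity of determinants *)

Section MatrixLimits.
Context (R : realType).

Lemma cvg_sum (T : Type) (F : set_system T) (FF : Filter F) (I : Type) (r : seq I)
    (P : pred I) (f : I -> T -> R) (l : I -> R) :
  (forall i, P i -> (f i x : R^o) @[x --> F] --> (l i : R^o)) ->
  (\sum_(i <- r | P i) f i x : R^o) @[x --> F] --> (\sum_(i <- r | P i) l i : R^o).
Proof. by move=> fl; apply: (@cvg_big R^o) fl; exact: (@add_continuous R^o). Qed.

Lemma cvg_mxP (T : Type) (F : set_system T) (FF : Filter F) m n (A : T -> 'M[R]_(m, n))
    (B : 'M[R]_(m, n)) :
  A x @[x --> F] --> B <-> forall i j, (A x i j : R^o) @[x --> F] --> (B i j : R^o).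
Proof.
split=> [AB i j|AB W [P nP sPW]].
  apply: (@cvg_comp _ _ _ A (fun M : 'M[R]_(m, n) => M i j : R^o)); first exact: AB.
  exact: coord_continuous.
have H : \forall x \near F, forall i j, P i j (A x i j).
  apply: (@filter_forall _ 'I_m (fun i x => forall j, P i j (A x i j)) F) => i.
  apply: (@filter_forall _ 'I_n (fun j x => P i j (A x i j)) F) => j.
  exact: AB (nP i j).
by apply: filterS H => x Hx; exact: sPW.
Qed.

Lemma cvg_mulmx (T : Type) (F : set_system T) (FF : Filter F) m n p
    (A : T -> 'M[R]_(m, n)) (B : T -> 'M[R]_(n, p)) (A' : 'M[R]_(m, n)) (B' : 'M[R]_(n, p)) :
  A x @[x --> F] --> A' -> B x @[x --> F] --> B' ->
  A x *m B x @[x --> F] --> A' *m B'.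
Proof.
move=> /cvg_mxP cA /cvg_mxP cB; apply/cvg_mxP => i j; rewrite mxE.
rewrite (_ : (fun x => _) = fun x => \sum_k A x i k * B x k j); last first.
  by apply/funext => x; rewrite mxE.
by apply: cvg_sum => k _; apply: (@cvgM R).
Qed.

Lemma cvg_det (T : Type) (F : set_system T) (FF : Filter F) n
    (A : T -> 'M[R]_n) (A' : 'M[R]_n) : A x @[x --> F] --> A' ->
  (\det (A x) : R^o) @[x --> F] --> (\det A' : R^o).
Proof.
move=> /cvg_mxP cA; apply: cvg_sum => s _; apply: (@cvgM R); first exact: cvg_cst.
by apply: (@cvg_big R^o); [exact: (@mul_continuous R)|move=> i _; exact: cA].
Qed.

Lemma cvg_trmx (T : Type) (F : set_system T) (FF : Filter F) m n
    (A : T -> 'M[R]_(m, n)) (A' : 'M[R]_(m, n)) : A x @[x --> F] --> A' -> (A x)^T @[x --> F] --> A'^T.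
Proof.
move=> /cvg_mxP cA; apply/cvg_mxP => i j; rewrite mxE.
by under eq_fun do rewrite mxE; exact: cA.
Qed.

Lemma unitmx_near (T : Type) (F : set_system T) (FF : Filter F) n
    (A : T -> 'M[R]_n) (A' : 'M[R]_n) : A x @[x --> F] --> A' -> A' \in unitmx ->
  \forall x \near F, A x \in unitmx.
Proof.
move=> /cvg_det cA; rewrite unitmxE unitfE => u.
have H : nbhs (\det A' : R^o) [set y | y != 0].
  by apply: open_nbhs_nbhs; split => //; exact: open_neq.
have cH : F [set x | \det (A x) != 0] := cA _ H.
by apply: filterS cH => x /=; rewrite unitmxE unitfE.
Qed.

Lemma cvg_invmx (T : Type) (F : set_system T) (FF : Filter F) n
    (A : T -> 'M[R]_n) (A' : 'M[R]_n) : A x @[x --> F] --> A' -> A' \in unitmx ->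
  invmx (A x) @[x --> F] --> invmx A'.
Proof.
move=> cA uA; have nu := unitmx_near FF cA uA.
have dA := cvg_det FF cA.
have dA' : \det A' != 0 by rewrite -unitfE -unitmxE.
have -> : invmx A' = (\det A')^-1 *: \adj A' by rewrite /invmx uA.
suff H : (\det (A x))^-1 *: \adj (A x) @[x --> F] --> (\det A')^-1 *: \adj A'.
  apply: cvg_trans H; apply: near_eq_cvg; apply: filterS nu => x ux.
  by rewrite /invmx ux.
apply/cvg_mxP => i j; rewrite !mxE; under eq_fun do rewrite !mxE.
apply: (@cvgM R); first exact: (@cvgV R).
apply: (@cvgM R); first exact: cvg_cst.
apply: cvg_det; apply/cvg_mxP => k l; rewrite !mxE; under eq_fun do rewrite !mxE.
by move/cvg_mxP : cA; exact.
Qed.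

Lemma continuous_mxP (T : topologicalType) m n (A : T -> 'M[R]_(m, n)) :
  (forall i j, continuous (fun x => A x i j : R^o)) -> continuous A.
Proof. by move=> cA x; apply/cvg_mxP => i j; exact: cA. Qed.

Lemma colsq_ge0 n (v : 'cV[R]_n) : 0 <= (v^T *m v) 0 0.
Proof. by rewrite mxE; apply: sumr_ge0 => i _; rewrite mxE -expr2 sqr_ge0. Qed.

Lemma colsq_gt0 n (v : 'cV[R]_n) : v != 0 -> 0 < (v^T *m v) 0 0.
Proof.
move=> v0; rewrite lt_neqAle colsq_ge0 andbT eq_sym.
apply: contra v0 => /eqP s0; apply/eqP/colP => i; rewrite mxE.
move: s0; rewrite mxE (bigD1 i) //= mxE -expr2 => /eqP.
rewrite paddr_eq0 ?sqr_ge0 //; last first.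
  by apply: sumr_ge0 => k _; rewrite mxE -expr2 sqr_ge0.
by rewrite sqrf_eq0 => /andP[/eqP].
Qed.

(* The determinant does not vanish along the segment from 1 to [M]. *)
Lemma posdef_det n (M : 'M[R]_n) :
  (forall x : 'cV[R]_n, x != 0 -> 0 < (x^T *m M *m x) 0 0) -> 0 < \det M.
Proof.
move=> pM; pose D (t : R) : R := \det ((1 - t)%:M + t *: M : 'M[R]_n).
have D0 t : 0 <= t <= 1 -> D t != 0.
  move=> /andP[t0 t1]; rewrite -unitfE -unitmxE -row_free_unit -kermx_eq0.
  apply: contraT => /rowV0Pn[v /sub_kermxP vM v0].
  have vT0 : v^T != 0 by rewrite -(inj_eq trmx_inj) trmxK trmx0.
  have := congr1 (fun A : 'rV_n => (A *m v^T) 0 0) vM.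
  rewrite mulmxDr mulmxDl mul0mx -scalemxAr -scalemxAl mul_mx_scalar -scalemxAl !mxE => E.
  have := pM _ vT0; rewrite trmxK mxE => p0.
  have := colsq_gt0 vT0; rewrite trmxK => q0.
  move: q0 p0 E; rewrite !mxE.
  set q := \sum_j _; set p := \sum_j _ => q0 p0 E.
  have [tz|tnz] := eqVneq t 0; first by move: E; rewrite tz; nra.
  have : 0 < t by rewrite lt_neqAle eq_sym tnz.
  by nra.
have cD : continuous (D : R -> R^o).
  move=> t; apply: cvg_det; apply/cvg_mxP => i j; rewrite !mxE.
  under eq_fun do rewrite !mxE.
  apply: (@cvgD R R^o); last by apply: (@cvgM R); [exact: cvg_id|exact: cvg_cst].
  case: (i == j); last exact: cvg_cst.
  by apply: (@cvgB R R^o); [exact: cvg_cst|exact: cvg_id].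
have D0E : D 0 = 1 by rewrite /D subr0 scale0r addr0 det1.
have D1E : D 1 = \det M by rewrite /D subrr raddf0 add0r scale1r.
rewrite ltNge -D1E; apply/negP => D1.
have [||c /itvP c01 Dc] := @IVT R D 0 1 0 ler01.
- by apply: continuous_subspaceT.
- by rewrite D0E ge_min le_max D1 ler01 orbT.
- by move: (D0 c); rewrite !c01 Dc eqxx => /(_ isT).
Qed.

End MatrixLimits.

(** * Joining an invertible matrix to 1 or to a reflection *)

Section GLPaths.
Context (R : realType) (m : nat).
Implicit Types A B C : 'M[R]_m.+1.

Definition GL_path A B := exists h : R -> 'M[R]_m.+1,
  [/\ continuous h, h 0 = A, h 1 = B & forall t, h t \in unitmx].

Lemma GL_path_trans A B C : GL_path A B -> GL_path B C -> GL_path A C.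
Proof.
move=> [h [ch h0 h1 uh]] [k [ck k0 k1 uk]]; exists (cat_path h k); split.
- by apply: cat_path_continuous; rewrite ?h1 ?k0.
- by rewrite cat_path0.
- by rewrite cat_path1.
- by move=> t; rewrite /cat_path; case: ifP.
Qed.

Lemma GL_path_unit A B : GL_path A B -> B \in unitmx.
Proof. by move=> [h [_ _ <- uh]]. Qed.

Lemma unipotent_unit (N : 'M[R]_m.+1) : N *m N = 0 -> 1%:M + N \in unitmx.
Proof.
move=> NN; have : (1%:M + N) *m (1%:M - N) = 1%:M.
  by rewrite mulmxDl mul1mx mulmxBr mulmx1 NN subr0 subrK.
by case/mulmx1_unit.
Qed.

(** As [N] squares to zero, 1 + t N has the inverse 1 - t N for every real t, so the straight line
    from 1 to 1 + N stays invertible. *)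
Lemma GL_path_unipotent A N : A \in unitmx -> N *m N = 0 ->
  GL_path A ((1%:M + N) *m A) /\ GL_path A (A *m (1%:M + N)).
Proof.
move=> uA NN; have cN : continuous (fun t : R => 1%:M + t *: N).
  move=> t; apply/cvg_mxP => i j; rewrite !mxE; under eq_fun do rewrite !mxE.
  apply: (@cvgD R R^o); first exact: cvg_cst.
  by apply: (@cvgM R); [exact: cvg_id|exact: cvg_cst].
have uN (t : R) : 1%:M + t *: N \in unitmx.
  by apply: unipotent_unit; rewrite -scalemxAl -scalemxAr NN !scaler0.
split; [exists (fun t => (1%:M + t *: N) *m A)|exists (fun t => A *m (1%:M + t *: N))]; split.
- by move=> t; apply: cvg_mulmx; [exact: cN|exact: cvg_cst].
- by rewrite scale0r addr0 mul1mx.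
- by rewrite scale1r.
- by move=> t; rewrite unitmx_mul uN.
- by move=> t; apply: cvg_mulmx; [exact: cvg_cst|exact: cN].
- by rewrite scale0r addr0 mulmx1.
- by rewrite scale1r.
- by move=> t; rewrite unitmx_mul uA uN.
Qed.

(** This is multiplication by 1 + u e_j^t, and the square of u e_j^t is u_j u e_j^t = 0. One step
    adds multiples of row [j] to all other rows at once. *)
Lemma GL_path_row A (u : 'I_m.+1 -> R) j : A \in unitmx -> u j = 0 ->
  GL_path A (\matrix_(p, q) (A p q + u p * A j q)).
Proof.
move=> uA uj; pose N := (\col_p u p) *m delta_mx 0 j : 'M[R]_m.+1.
have NN : N *m N = 0.
  rewrite /N mulmxA -(mulmxA (\col_p u p)) -rowE (_ : row j _ = 0) ?mulmx0 ?mul0mx //.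
  by apply/rowP => i; rewrite !mxE.
have [H _] := GL_path_unipotent uA NN.
suff -> : (\matrix_(p, q) (A p q + u p * A j q)) = (1%:M + N) *m A by [].
rewrite mulmxDl mul1mx -mulmxA -rowE; apply/matrixP => p q.
by rewrite !mxE big_ord1 !mxE.
Qed.

Lemma GL_path_col A (w : 'I_m.+1 -> R) j : A \in unitmx -> w j = 0 ->
  GL_path A (\matrix_(p, q) (A p q + A p j * w q)).
Proof.
move=> uA wj; pose N := delta_mx j 0 *m (\row_q w q) : 'M[R]_m.+1.
have NN : N *m N = 0.
  rewrite /N -mulmxA (mulmxA (\row_q w q)) -colE (_ : col j _ = 0) ?mul0mx ?mulmx0 //.
  by apply/colP => i; rewrite !mxE.
have [_ H] := GL_path_unipotent uA NN.
suff -> : (\matrix_(p, q) (A p q + A p j * w q)) = A *m (1%:M + N) by [].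
rewrite mulmxDr mulmx1 mulmxA -colE; apply/matrixP => p q.
by rewrite !mxE big_ord1 !mxE.
Qed.

Definition reduced (S : {set 'I_m.+1}) A :=
  forall s p, s \in S -> A s p = (s == p)%:R /\ A p s = (s == p)%:R.

(** If column [i] has a nonzero entry in a row r different from i, a multiple of row r added to row
    i makes the pivot 1. Otherwise the diagonal entry is nonzero, and row i is added to row 0 to
    create such an entry; this is why index 0 is never eliminated. *)
Lemma reduce_pivot (S : {set 'I_m.+1}) A i : A \in unitmx -> reduced S A ->
  i \notin S -> ord0 \notin S -> i != ord0 ->
  exists A', [/\ GL_path A A', reduced S A' & A' i i = 1].
Proof.
move=> uA rA iS oS io.
have step B r : B \in unitmx -> reduced S B -> r != i -> r \notin S -> B r i != 0 ->
  exists A', [/\ GL_path B A', reduced S A' & A' i i = 1].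
  move=> uB rB ri rS Bri.
  pose u (p : 'I_m.+1) := if p == i then (1 - B i i) / B r i else 0 : R.
  have ur : u r = 0 by rewrite /u (negbTE ri).
  exists (\matrix_(p, q) (B p q + u p * B r q)); split; first exact: GL_path_row.
    move=> s p sS; rewrite !mxE; have [Bs Bp] := rB s p sS; have [_ Br] := rB s r sS.
    rewrite Bs Bp Br /u.
    have /negbTE -> : s != i by apply: contra iS => /eqP <-.
    have /negbTE -> : s != r by apply: contra rS => /eqP <-.
    by rewrite mul0r mulr0 addr0.
  by rewrite mxE /u eqxx; field.
case: (pickP (fun r => (r != i) && (A r i != 0))) => [r /andP[ri Ari]|A0].
  apply: (step _ r) => //; apply/negP => rS; move: Ari.
  by have [-> _] := rA r i rS; rewrite (negbTE ri) eqxx.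
have Ai0 r : r != i -> A r i = 0.
  by move=> ri; have := A0 r; rewrite ri /= => /negbFE/eqP.
have Aii : A i i != 0.
  apply/eqP => Aii; have c0 : A *m delta_mx i 0 = 0 :> 'cV_m.+1.
    apply/colP => p; rewrite -colE !mxE.
    by have [->|] := eqVneq p i; [|exact: Ai0].
  have := congr1 (mulmx (invmx A)) c0; rewrite mulKmx // mulmx0 => /colP/(_ i).
  by rewrite !mxE !eqxx => /eqP; rewrite oner_eq0.
pose u (p : 'I_m.+1) := (p == ord0)%:R : R.
have ui : u i = 0 by rewrite /u (negbTE io).
have P1 := GL_path_row uA ui.
have [||||A' [P2 rA' A'ii]] := step _ ord0 (GL_path_unit P1).
- move=> s p sS; rewrite !mxE; have [Bs Bp] := rA s p sS; have [_ Bi] := rA s i sS.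
  rewrite Bs Bp Bi /u.
  have /negbTE -> : s != i by apply: contra iS => /eqP <-.
  have /negbTE -> : s != ord0 by apply: contra oS => /eqP <-.
  by rewrite mul0r mulr0 addr0.
- by rewrite eq_sym.
- by [].
- have A0i : A ord0 i = 0 by apply: Ai0; rewrite eq_sym.
  by rewrite mxE A0i /u eqxx mul1r add0r.
by exists A'; split => //; exact: GL_path_trans P1 P2.
Qed.

(** Once the pivot is 1, row operations clear column [i] and column operations clear row [i]; rows
    and columns in [S] have zeros where they would be affected. *)
Lemma reduce_step (S : {set 'I_m.+1}) A i : A \in unitmx -> reduced S A ->
  i \notin S -> ord0 \notin S -> i != ord0 ->
  exists2 A', GL_path A A' & reduced (i |: S) A'.
Proof.
move=> uA rA iS oS io.
have [A1 [P1 r1 A1ii]] := reduce_pivot uA rA iS oS io.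
pose u (p : 'I_m.+1) := if p == i then 0 else - A1 p i.
have ui : u i = 0 by rewrite /u eqxx.
have P2 := GL_path_row (GL_path_unit P1) ui.
set A2 := (X in GL_path _ X) in P2.
have sSi s : s \in S -> (s == i) = false by move=> sS; apply/negbTE; apply: contra iS => /eqP <-.
have A2i p : A2 p i = (p == i)%:R.
  by rewrite mxE A1ii /u; have [->|pi] := eqVneq p i; rewrite ?A1ii ?mul0r ?addr0 // mulr1 subrr.
have r2 : reduced S A2.
  move=> s p sS; rewrite !mxE; have [Bs Bp] := r1 s p sS; have [Bsi Bi] := r1 s i sS.
  rewrite Bs Bp Bi /u (sSi s sS) Bsi (sSi s sS) /=.
  by rewrite mulr0 oppr0 mul0r !addr0.
clearbody A2; pose w (q : 'I_m.+1) := if q == i then 0 else - A2 i q.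
have wi : w i = 0 by rewrite /w eqxx.
have P3 := GL_path_col (GL_path_unit P2) wi.
set A3 := (X in GL_path _ X) in P3.
exists A3; first exact: GL_path_trans (GL_path_trans P1 P2) P3.
move=> s p; rewrite !inE => /orP[/eqP->|sS].
  rewrite !mxE !A2i wi mulr0 addr0 eqxx mul1r /w (eq_sym i); split=> //.
  by have [->|pi] := eqVneq p i; rewrite ?A2i ?eqxx ?addr0 // subrr.
have [Bs Bp] := r2 s p sS; have [Bsi Bi] := r2 s i sS.
rewrite !mxE Bs Bp Bsi /w (sSi s sS) Bi (sSi s sS) mul0r addr0; split=> //.
by rewrite oppr0 mulr0 addr0.
Qed.

Definition flip0 (b : bool) : 'M[R]_m.+1 :=
  \matrix_(i, j) ((i == j)%:R * (if b && (i == ord0) then -1 else 1)).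

(** Eliminating every index except 0 leaves a diagonal matrix with a single entry [a] other than 1,
    which is then moved in a straight line to its sign. *)
Lemma GL_path_to_flip A : A \in unitmx -> exists b, GL_path A (flip0 b).
Proof.
move=> uA.
suff [A' P rA'] : exists2 A', GL_path A A' & reduced [set~ ord0] A'.
  have A'0 p q : p != ord0 \/ q != ord0 -> A' p q = (p == q)%:R.
    move=> [p0|q0]; first by have [|-> //] := rA' p q; rewrite !inE.
    by have [|_ ->] := rA' q p; rewrite ?inE // eq_sym.
  pose a := A' ord0 ord0.
  have a0 : a != 0.
    apply/eqP => a0; have c0 : A' *m delta_mx ord0 0 = 0 :> 'cV_m.+1.
      apply/colP => p; rewrite -colE !mxE; have [->//|p0] := eqVneq p ord0.
      by rewrite A'0 ?(negbTE p0) //; left.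
    have := congr1 (mulmx (invmx A')) c0; rewrite mulKmx ?(GL_path_unit P) // mulmx0.
    by move=> /colP/(_ ord0); rewrite !mxE !eqxx => /eqP; rewrite oner_eq0.
  (* A segment between two numbers of the same sign; clamping keeps it away from 0 for all real t,
     as [GL_path] demands. *)
  pose c (t : R) := (1 - clamp t) * a + clamp t * (if a < 0 then -1 else 1).
  have cn t : c t != 0.
    have /andP[t0 t1] := clamp_ge0 t; rewrite /c; case: ltgtP a0 => // a0 _.
      by apply/eqP; nra.
    by apply/eqP; nra.
  have cc : continuous (c : R -> R^o).
    move=> t; apply: (@cvgD R R^o); apply: (@cvgM R); last exact: cvg_cst.
    - by apply: (@cvgB R R^o); [exact: cvg_cst|exact: clamp_continuous].
    - exact: cvg_cst.
    - exact: clamp_continuous.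
  exists (a < 0); apply: (GL_path_trans P).
  exists (fun t => diag_mx (\row_i (if i == ord0 then c t else 1))); split.
  - move=> t; apply/cvg_mxP => i j; rewrite !mxE; under eq_fun do rewrite !mxE.
    case: (i == j); last exact: cvg_cst.
    by case: (i == ord0); [exact: cc|exact: cvg_cst].
  - apply/matrixP => i j; rewrite !mxE /c clamp_id ?lexx ?ler01 // subr0 mul1r mul0r addr0.
    have [->|i0] := eqVneq i ord0; last by rewrite A'0 //; left.
    have [<-//|j0] := eqVneq ord0 j.
    by rewrite A'0 ?(negbTE j0) //; right; rewrite eq_sym.
  - apply/matrixP => i j; rewrite !mxE /c clamp_id ?lexx ?ler01 // subrr mul0r mul1r add0r.
    have [_|_] := eqVneq i j; rewrite ?mul0r // mul1r mulr1n.
    by rewrite andbC; case: (i == ord0).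
  - move=> t; rewrite unitmxE det_diag unitfE; apply/prodf_neq0 => i _; rewrite mxE.
    by case: ifP; rewrite ?oner_eq0.
(* Induction on the number of indices still to be eliminated; index 0 remains at the end, hence the
   successor. *)
suff H : forall k (S : {set 'I_m.+1}), #|~: S| = k.+1 -> ord0 \notin S -> forall A, A \in unitmx ->
    reduced S A -> exists2 A', GL_path A A' & reduced [set~ ord0] A'.
  apply: (H m finset.set0 _ _ A uA); rewrite ?inE //; first by rewrite finset.setC0 cardsT card_ord.
  by move=> s p; rewrite inE.
elim=> [|k IH] S cS oS B uB rB.
  have -> : [set~ ord0]%SET = S.
    apply/setP => i; rewrite !inE; apply/idP/idP => [i0|iS]; last first.
      by apply: contraNneq oS => <-.
    apply: contraT => iS; suff : (#|[set i; ord0]%SET| <= 1)%N by rewrite cards2 i0.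
    by rewrite -cS; apply: subset_leq_card; apply/fintype.subsetP => j; rewrite !inE => /orP[]/eqP->.
  exists B => //; exists (fun=> B); split=> // x; exact: cvg_cst.
have [i] : exists i, i \in (~: S :\ ord0)%SET.
  apply/set0Pn; rewrite -card_gt0; have := cardsD1 ord0 (~: S)%SET.
  by rewrite cS inE oS add1n => /eqP; rewrite eqSS => /eqP <-.
rewrite !inE => /andP[i0 iS].
have [B1 P1 r1] := reduce_step uB rB iS oS i0.
have [||A' P2 rA'] := IH (i |: S)%SET _ _ B1 (GL_path_unit P1) r1.
- have := cardsD1 i (~: S)%SET; rewrite cS inE iS add1n => /eqP; rewrite eqSS => /eqP ->; congr (#|pred_of_set _|).
  by apply/setP => j; rewrite !inE negb_or.
- by rewrite !inE negb_or eq_sym i0.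
by exists A' => //; exact: GL_path_trans P1 P2.
Qed.

End GLPaths.

(** * Frames and projections in finite dimension *)

Section FiniteFrames.
Context (R : realType).

Definition mxip m n (A B : 'M[R]_(m, n)) : R := \tr (A^T *m B).

Lemma mxipE m n (A B : 'M[R]_(m, n)) : mxip A B = \sum_j \sum_i A i j * B i j.
Proof. by apply: eq_bigr => j _; rewrite mxE; apply: eq_bigr => i _; rewrite mxE. Qed.

Lemma mxip_ge0 m n (A : 'M[R]_(m, n)) : 0 <= mxip A A.
Proof. by rewrite mxipE; do 2!apply: sumr_ge0 => ? _; rewrite -expr2 sqr_ge0. Qed.

Lemma mxipC m n (A B : 'M[R]_(m, n)) : mxip A B = mxip B A.
Proof. by rewrite /mxip -mxtrace_tr trmx_mul trmxK. Qed.

Lemma mxipDl m n (A B C : 'M[R]_(m, n)) : mxip (A + B) C = mxip A C + mxip B C.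
Proof. by rewrite /mxip raddfD mulmxDl raddfD. Qed.

Lemma mxipZl m n a (A B : 'M[R]_(m, n)) : mxip (a *: A) B = a * mxip A B.
Proof. by rewrite /mxip linearZ -scalemxAl linearZ. Qed.

Lemma mxipNl m n (A B : 'M[R]_(m, n)) : mxip (- A) B = - mxip A B.
Proof. by rewrite -scaleN1r mxipZl mulN1r. Qed.

Lemma mxipDr m n (A B C : 'M[R]_(m, n)) : mxip C (A + B) = mxip C A + mxip C B.
Proof. by rewrite mxipC mxipDl !(mxipC C). Qed.

Lemma mxipNr m n (A B : 'M[R]_(m, n)) : mxip A (- B) = - mxip A B.
Proof. by rewrite mxipC mxipNl mxipC. Qed.

Lemma mxipZr m n a (A B : 'M[R]_(m, n)) : mxip A (a *: B) = a * mxip A B.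
Proof. by rewrite mxipC mxipZl mxipC. Qed.

Definition mxipE_lin := (mxipDl, mxipDr, mxipNl, mxipNr, mxipZl, mxipZr).

Lemma mxip_eq0 m n (A : 'M[R]_(m, n)) : mxip A A = 0 -> A = 0.
Proof.
move=> A0; apply/matrixP => i j; rewrite mxE; apply/eqP; rewrite -sqrf_eq0.
rewrite eq_le sqr_ge0 andbT -A0 mxipE (bigD1 j) //= (bigD1 i) //= -expr2 -addrA lerDl.
by apply: addr_ge0; do ?[apply: sumr_ge0 => ? _]; rewrite -?expr2 ?sqr_ge0.
Qed.

Lemma mxip_CS m n (A B : 'M[R]_(m, n)) : mxip A B ^+ 2 <= mxip A A * mxip B B.
Proof.
have [B0|B0] := eqVneq (mxip B B) 0.
  by rewrite (mxip_eq0 B0) /mxip !mulmx0 !mxtrace0 expr0n mulr0.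
have Bp : 0 < mxip B B by rewrite lt_neqAle eq_sym B0 mxip_ge0.
have := mxip_ge0 (mxip B B *: A - mxip A B *: B).
rewrite !mxipE_lin (mxipC B A) => H.
have {H} : 0 <= mxip B B * (mxip A A * mxip B B - mxip A B ^+ 2).
  by apply: le_trans H _; rewrite le_eqVlt; apply/orP; left; apply/eqP; ring.
by rewrite pmulr_rge0 // subr_ge0.
Qed.

Definition mxnorm m n (A : 'M[R]_(m, n)) : R := Num.sqrt (mxip A A).

Lemma mxnormD m n (A B : 'M[R]_(m, n)) : mxnorm (A + B) <= mxnorm A + mxnorm B.
Proof.
have A0 := sqrtr_ge0 (mxip A A); have B0 := sqrtr_ge0 (mxip B B).
rewrite -(@ler_pXn2r _ 2) ?nnegrE ?addr_ge0 ?sqrtr_ge0 // sqr_sqrtr ?mxip_ge0 //.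
rewrite sqrrD !sqr_sqrtr ?mxip_ge0 // !mxipE_lin (mxipC B A).
suff : mxip A B <= mxnorm A * mxnorm B by rewrite /mxnorm; lra.
apply: le_trans (ler_norm _) _; rewrite -sqrtrM ?mxip_ge0 // -sqrtr_sqr.
by rewrite ler_sqrt ?mxip_CS // mulr_ge0 ?mxip_ge0.
Qed.

(** Cauchy-Schwarz for each entry of the product, summed over the entries. *)
Lemma mxip_mulmx m n p (A : 'M[R]_(m, n)) (B : 'M[R]_(n, p)) :
  mxip (A *m B) (A *m B) <= mxip A A * mxip B B.
Proof.
rewrite [leLHS]mxipE [mxip B B]mxipE mulr_sumr; apply: ler_sum => j _.
have -> : mxip A A = \sum_i \sum_k A i k * A i k by rewrite mxipE exchange_big.
rewrite mulr_suml; apply: ler_sum => i _.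
have E (u v : 'I_n -> R) : mxip (\row_k u k) (\row_k v k) = \sum_k u k * v k.
  by rewrite mxipE; apply: eq_bigr => k _; rewrite big_ord1 !mxE.
by have := mxip_CS (\row_k A i k) (\row_k B k j); rewrite !E mxE expr2.
Qed.

Context (n d : nat).
Implicit Types F G : 'M[R]_(n, d).

(** The orthogonal projection to the column space of [F], whose columns are independent but not
    necessarily orthonormal. *)
Definition frame_proj F : 'M[R]_n := F *m invmx (F^T *m F) *m F^T.

Lemma gram_gt0 F : F^T *m F \in unitmx -> 0 < \det (F^T *m F).
Proof.
move=> uF; apply: posdef_det => x x0.
rewrite mulmxA -trmx_mul -mulmxA; apply: colsq_gt0.
apply: contra x0 => /eqP Fx; have := congr1 (mulmx (invmx (F^T *m F) *m F^T)) Fx.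
by rewrite mulmx0 mulmxA -(mulmxA _ F^T) mulVmx // mul1mx => ->.
Qed.

Lemma frame_proj_sym F : (frame_proj F)^T = frame_proj F.
Proof.
rewrite /frame_proj !trmx_mul trmxK mulmxA; congr (_ *m _ *m _).
by rewrite trmx_inv trmx_mul trmxK.
Qed.

Lemma frame_proj_id F : F^T *m F \in unitmx -> frame_proj F *m F = F.
Proof. by move=> uF; rewrite /frame_proj -!mulmxA mulVmx // mulmx1. Qed.

Lemma frame_proj_idem F : F^T *m F \in unitmx -> frame_proj F *m frame_proj F = frame_proj F.
Proof. by move=> uF; rewrite {2}/frame_proj !mulmxA frame_proj_id. Qed.

Lemma frame_proj_trace F : F^T *m F \in unitmx -> \tr (frame_proj F) = d%:R.
Proof. by move=> uF; rewrite /frame_proj mxtrace_mulC mulmxA mulmxV // mxtrace1. Qed.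

(** Both projections have trace d, so the two squared norms are d - tr(P Q) on the left and 2 d - 2
    tr(P Q) before halving on the right. *)
Lemma frame_proj_defect F G : F^T *m F \in unitmx -> G^T *m G \in unitmx ->
  let P := frame_proj F in let Q := frame_proj G in
  mxip (P - Q *m P) (P - Q *m P) = mxip (P - Q) (P - Q) / 2.
Proof.
move=> uF uG P Q.
have Ps : P^T = P by exact: frame_proj_sym.
have Qs : Q^T = Q by exact: frame_proj_sym.
have PP : P *m P = P by exact: frame_proj_idem.
have QQ : Q *m Q = Q by exact: frame_proj_idem.
have tP : \tr P = d%:R by exact: frame_proj_trace.
have tQ : \tr Q = d%:R by exact: frame_proj_trace.
have tPQP : \tr (P *m Q *m P) = \tr (P *m Q) by rewrite mxtrace_mulC mulmxA PP.
have PQP : mxip P (Q *m P) = \tr (P *m Q) by rewrite /mxip Ps mulmxA.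
have PQ : mxip P Q = \tr (P *m Q) by rewrite /mxip Ps.
have QP : mxip (Q *m P) (Q *m P) = \tr (P *m Q).
  by rewrite /mxip trmx_mul Ps Qs mulmxA -(mulmxA P) QQ.
have P2 : mxip P P = d%:R by rewrite /mxip Ps PP.
have Q2 : mxip Q Q = d%:R by rewrite /mxip Qs QQ.
by rewrite !mxipE_lin (mxipC (Q *m P) P) (mxipC Q P) PQP PQ QP P2 Q2; field.
Qed.

(* The form x |-> <Q F x, S F x> is positive definite: both (1 - Q) and (1 - S) shrink
   vectors of the image of F by more than a factor 1/2. *)
Lemma frame_triple F G H : F^T *m F \in unitmx -> G^T *m G \in unitmx ->
  H^T *m H \in unitmx ->
  mxip (frame_proj F - frame_proj G) (frame_proj F - frame_proj G) < 1 / 2 ->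
  mxip (frame_proj F - frame_proj H) (frame_proj F - frame_proj H) < 1 / 2 ->
  0 < \det (F^T *m G) * \det (G^T *m H) * \det (F^T *m H).
Proof.
move=> uF uG uH FG FH.
set P := frame_proj F; set Q := frame_proj G; set S := frame_proj H.
have g0 := gram_gt0 uG; have h0 := gram_gt0 uH.
(* This determinant is the product of the three Gram determinants divided by the positive numbers
   det(G^t G) and det(H^t H). *)
suff : 0 < \det (F^T *m (Q *m S) *m F).
  have -> : F^T *m (Q *m S) *m F =
      (F^T *m G) *m invmx (G^T *m G) *m (G^T *m H) *m invmx (H^T *m H) *m (H^T *m F).
    by rewrite /Q /S /frame_proj !mulmxA.
  have -> : \det (F^T *m H) = \det (H^T *m F) by rewrite -det_tr trmx_mul trmxK.
  rewrite (det_mulmx _ (H^T *m F)) !(det_mulmx _ (invmx _)) (det_mulmx _ (G^T *m H)).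
  rewrite (det_mulmx _ (invmx _)) !det_inv => D0.
  have := mulr_gt0 D0 (mulr_gt0 g0 h0).
  by congr (_ < _); field; rewrite !gt_eqF.
apply: posdef_det => x x0; set y := F *m x.
have y0 : y != 0.
  apply: contra x0 => /eqP Fx; have := congr1 (mulmx (invmx (F^T *m F) *m F^T)) Fx.
  by rewrite mulmx0 mulmxA -(mulmxA _ F^T) mulVmx // mul1mx => ->.
have -> : x^T *m (F^T *m (Q *m S) *m F) *m x = (Q *m y)^T *m (S *m y).
  rewrite (trmx_mul Q y) (_ : Q^T = Q); last exact: frame_proj_sym.
  by rewrite (trmx_mul F x) !mulmxA.
have yp : 0 < mxip y y by rewrite /mxip trace_mx11; exact: colsq_gt0.
rewrite -trace_mx11 -/(mxip (Q *m y) (S *m y)).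
have Py : P *m y = y by rewrite mulmxA (_ : P *m F = F) //; exact: frame_proj_id.
have bound K : K^T *m K \in unitmx ->
    mxip (P - frame_proj K) (P - frame_proj K) < 1 / 2 ->
    mxip (y - frame_proj K *m y) (y - frame_proj K *m y) < mxip y y / 4 /\
    mxip y (y - frame_proj K *m y) = mxip (y - frame_proj K *m y) (y - frame_proj K *m y).
  move=> uK FK; set T := frame_proj K; split.
    have -> : y - T *m y = (P - T *m P) *m y by rewrite mulmxBl -(mulmxA T P y) !Py.
    have D : mxip (P - T *m P) (P - T *m P) = mxip (P - T) (P - T) / 2 := frame_proj_defect uF uK.
    apply: (le_lt_trans (mxip_mulmx _ _)); rewrite D.
    rewrite [ltRHS]mulrC ltr_pM2r //; lra.
  have -> : y - T *m y = (1%:M - T) *m y by rewrite mulmxBl mul1mx.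
  have Ts : (1%:M - T)^T = 1%:M - T by rewrite linearB /= trmx1 frame_proj_sym.
  have TT : (1%:M - T) *m (1%:M - T) = 1%:M - T.
    by rewrite mulmxBl mul1mx mulmxBr mulmx1 frame_proj_idem // subrr subr0.
  by rewrite /mxip (trmx_mul (1%:M - T) y) Ts -(mulmxA y^T (1%:M - T) _) (mulmxA (1%:M - T) (1%:M - T) y) TT.
have [Qy1 Qy2] := bound G uG FG; have [Sy1 Sy2] := bound H uH FH.
rewrite -[Q *m y](subKr y) -[S *m y](subKr y).
move: Qy1 Qy2 Sy1 Sy2; rewrite -/Q -/S; set q := y - Q *m y; set r := y - S *m y.
clearbody q r => Qy1 Qy2 Sy1 Sy2.
(* Since <y, q> = |q|^2 and <y, r> = |r|^2, the product <y - q, y - r> is |y|^2 - |q|^2 - |r|^2 +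
   <q, r>. By |q + r|^2 >= 0 it is at least |y|^2 - (3/2) (|q|^2 + |r|^2), which exceeds |y|^2 /
   4. *)
have := mxip_ge0 (q + r); rewrite !mxipE_lin (mxipC r q) (mxipC q y) Qy2 Sy2; lra.
Qed.

End FiniteFrames.

(** * Frames of finitely supported vectors and signs of Gram determinants *)

Section InfiniteFrames.
Context (R : realType).

Lemma nat_fsum n (f : nat -> R) : (forall i, (n <= i)%N -> f i = 0) ->
  \sum_(i \in [set: nat]) f i = \sum_(i < n) f i.
Proof.
move=> f0; rewrite fsbig_ord; apply/esym/fsbig_widen => // i [_ /= ni].
by apply: f0; rewrite leqNgt; apply/negP.
Qed.

Lemma nat2_fsum n (f : nat * nat -> R) :
  (forall i j, (n <= i)%N || (n <= j)%N -> f (i, j) = 0) ->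
  \sum_(p \in [set: nat * nat]) f p = \sum_(j < n) \sum_(i < n) f (i : nat, j : nat).
Proof.
move=> f0; rewrite (@fsbig_ord _ _ _ n (fun j => \sum_(i < n) f (i : nat, j))).
under eq_fsbigr do rewrite (@fsbig_ord _ _ _ n (fun i => f (i, _))).
rewrite exchange_fsbig ?pair_fsbig; try exact: finite_II.
rewrite (@eq_fsbigr _ _ _ _ (fun p : nat * nat => f (p.1, p.2)) f); last by case.
apply/esym/fsbig_widen => // -[i j] [_ /= ij]; apply: f0.
by apply/negPn/negP; rewrite negb_or -!ltnNge => /andP.
Qed.

Definition vec_size (u : vecinf R) : nat := sval (cid (svalP u)).

Lemma vec_sizeP u i : (vec_size u <= i)%N -> sval u i = 0.
Proof. exact: (svalP (cid (svalP u))). Qed.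

Definition mx_size (A : mxinf R) : nat := sval (cid (svalP A)).

Lemma mx_sizeP A i j : (mx_size A <= i)%N || (mx_size A <= j)%N -> sval A i j = 0.
Proof. exact: (svalP (cid (svalP A))). Qed.

Definition mx_trunc n (A : mxinf R) : 'M[R]_n := \matrix_(i, j) sval A i j.

Implicit Types A B C : mxinf R.

Definition mx_bounded n A := forall i j, (n <= i)%N || (n <= j)%N -> sval A i j = 0.

Lemma mx_size_bounded n A : (mx_size A <= n)%N -> mx_bounded n A.
Proof.
move=> An i j ij; apply: mx_sizeP.
by case/orP: ij => /(leq_trans An) ->; rewrite ?orbT.
Qed.

Lemma frob_distE n A B : mx_bounded n A -> mx_bounded n B ->
  frob_dist A B = mxnorm (mx_trunc n A - mx_trunc n B).
Proof.
move=> An Bn; rewrite /frob_dist /mxnorm mxipE (@nat2_fsum n) /=.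
  by congr Num.sqrt; do 2!apply: eq_bigr => ? _; rewrite !mxE expr2.
by move=> i j ij; rewrite /= An // Bn // subrr expr0n.
Qed.

Lemma frob_dist_ge0 A B : 0 <= frob_dist A B.
Proof. exact: sqrtr_ge0. Qed.

Lemma frob_distC A B : frob_dist A B = frob_dist B A.
Proof. by congr Num.sqrt; apply: eq_fsbigr => p _; rewrite -sqrrN opprB. Qed.

Lemma frob_dist_trans C A B : frob_dist A B <= frob_dist A C + frob_dist C B.
Proof.
pose n := maxn (mx_size A) (maxn (mx_size B) (mx_size C)).
rewrite !(@frob_distE n); do ?by apply: mx_size_bounded; rewrite ?leq_max ?leqnn ?orbT.
by apply: le_trans (mxnormD _ _); rewrite addrA subrK.
Qed.

Lemma frob_distxx A : frob_dist A A = 0.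
Proof.
by rewrite (frob_distE (mx_size_bounded (leqnn _)) (mx_size_bounded (leqnn _))) subrr /mxnorm /mxip mulmx0 mxtrace0 sqrtr0.
Qed.

Definition vec_ip (u v : vecinf R) : R := \sum_(i \in [set: nat]) sval u i * sval v i.

Context (d : nat).
Definition frame := 'I_d -> vecinf R.
Implicit Types F G H : frame.

Definition frame_size F : nat := \max_a vec_size (F a).

Definition frame_bounded n F := forall a i, (n <= i)%N -> sval (F a) i = 0.

Lemma frame_size_bounded n F : (frame_size F <= n)%N -> frame_bounded n F.
Proof.
move=> Fn a i ni; apply: vec_sizeP; apply: leq_trans ni; apply: leq_trans Fn.
exact: (leq_bigmax a).
Qed.

Definition frame_trunc n F : 'M[R]_(n, d) := \matrix_(i, a) sval (F a) i.

Definition gram F G : 'M[R]_d := \matrix_(a, b) vec_ip (F a) (G b).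

Lemma gramE n F G : frame_bounded n F -> gram F G = (frame_trunc n F)^T *m frame_trunc n G.
Proof.
move=> Fn; apply/matrixP => a b; rewrite !mxE /vec_ip (@nat_fsum n).
  by apply: eq_bigr => i _; rewrite !mxE.
by move=> i ni; rewrite Fn ?mul0r.
Qed.

Lemma gram_tr F G : (gram F G)^T = gram G F.
Proof.
by apply/matrixP => a b; rewrite !mxE; apply: eq_fsbigr => i _; rewrite mulrC.
Qed.

(** The entries of F (F^t F)^-1 F^t: the counterpart of [frame_proj] for columns of unbounded
    length. *)
Definition frame_mx_fun F (i j : nat) : R :=
  \sum_a \sum_b sval (F a) i * invmx (gram F F) a b * sval (F b) j.

Lemma frame_mx_fun0 n F i j : frame_bounded n F -> (n <= i)%N || (n <= j)%N ->
  frame_mx_fun F i j = 0.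
Proof.
move=> Fn ij; rewrite /frame_mx_fun big1 // => a _; rewrite big1 // => b _.
by case/orP: ij => /Fn ->; rewrite ?mulr0 ?mul0r.
Qed.

Lemma frame_mx_subproof F :
  exists n, forall i j, (n <= i)%N || (n <= j)%N -> frame_mx_fun F i j = 0.
Proof. by exists (frame_size F) => i j; exact/frame_mx_fun0/frame_size_bounded. Qed.

Definition frame_mx F : mxinf R := exist _ (frame_mx_fun F) (frame_mx_subproof F).

Lemma frame_mx_bounded n F : frame_bounded n F -> mx_bounded n (frame_mx F).
Proof. by move=> Fn i j; exact: frame_mx_fun0. Qed.

Lemma mx_trunc_frame n F : frame_bounded n F ->
  mx_trunc n (frame_mx F) = frame_proj (frame_trunc n F).
Proof.
move=> Fn; rewrite /frame_proj -gramE //; apply/matrixP => i j; rewrite !mxE /= /frame_mx_fun.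
rewrite exchange_big /=; apply: eq_bigr => b _; rewrite !mxE mulr_suml.
by apply: eq_bigr => a _; rewrite !mxE.
Qed.

(** The sign of a nonzero number, written additively so that it can be compared with cochains mod
    2. *)
Definition sign_bit (x : R) : 'F_2 := (x < 0)%R%:R.

Lemma sign_bit_mul x y z : 0 < x * y * z -> sign_bit x + sign_bit y = sign_bit z.
Proof.
move=> xyz; have x0 : x != 0 by apply: contraTneq xyz => ->; rewrite !mul0r ltxx.
have y0 : y != 0 by apply: contraTneq xyz => ->; rewrite mulr0 mul0r ltxx.
rewrite /sign_bit; case: (ltgtP x 0) x0 => // xs _; case: (ltgtP y 0) y0 => // ys _;
  case: (ltrP z 0) => zs /=; do ?[by apply/val_inj]; exfalso; move: xyz;
  by (first [have : 0 < x * y by nra | have : x * y < 0 by nra]); nra.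
Qed.

Definition frame_sign F G : 'F_2 := sign_bit (\det (gram F G)).

Lemma frame_signC F G : frame_sign F G = frame_sign G F.
Proof. by rewrite /frame_sign -det_tr gram_tr. Qed.

(** All three frames live in a common R^n, where [frame_triple] applies because (7/10)^2 < 1/2. *)
Lemma frame_sign_triple F G H : gram F F \in unitmx -> gram G G \in unitmx ->
  gram H H \in unitmx ->
  frob_dist (frame_mx F) (frame_mx G) < 7 / 10 -> frob_dist (frame_mx F) (frame_mx H) < 7 / 10 ->
  frame_sign F G + frame_sign G H = frame_sign F H.
Proof.
move=> uF uG uH FG FH.
pose n := maxn (frame_size F) (maxn (frame_size G) (frame_size H)).
have [Fn Gn Hn] : [/\ frame_bounded n F, frame_bounded n G & frame_bounded n H].
  by split; apply: frame_size_bounded; rewrite /n !leq_max !leqnn ?orbT.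
have [Fm Gm Hm] := And3 (frame_mx_bounded Fn) (frame_mx_bounded Gn) (frame_mx_bounded Hn).
move: FG FH; rewrite !(@frob_distE n) // !mx_trunc_frame // => FG FH.
have sq m (A : 'M[R]_m) : mxnorm A < 7 / 10 -> mxip A A < 1 / 2.
  move=> A7; rewrite -(sqr_sqrtr (mxip_ge0 A)) -/(mxnorm A).
  have := sqrtr_ge0 (mxip A A); rewrite -/(mxnorm A); nra.
apply: sign_bit_mul; rewrite !(@gramE n) //; apply: frame_triple; rewrite -?gramE //; exact: sq.
Qed.

(** For three copies of one frame the triple formula reads x + x = x. *)
Lemma frame_signxx F : gram F F \in unitmx -> frame_sign F F = 0.
Proof.
move=> uF; have := frame_sign_triple uF uF uF; rewrite frob_distxx => /(_ _ _) H.
by rewrite -[RHS](F2_addxx (frame_sign F F)) H ?divr_gt0.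
Qed.

(* Radii: sqrt 2 * eps < 63/200 < 8/25 < 1/3 for eps < 2/9, while the triple sign
   formula needs projections closer than sqrt (1/2), and 1/3 + 1/50 + 1/3 < 7/10. *)
Definition near_frame (r : R) A F :=
  gram F F \in unitmx /\ frob_dist A (frame_mx F) < r.

Lemma near_frame_le r r' A F : r <= r' -> near_frame r A F -> near_frame r' A F.
Proof. by move=> rr [uF AF]; split=> //; exact: lt_le_trans AF rr. Qed.

Lemma near_frame_triple A B C F G H : near_frame (1 / 3) A F -> near_frame (1 / 3) B G ->
  near_frame (1 / 3) C H -> frob_dist A B < 1 / 50 -> frob_dist A C < 1 / 50 ->
  frame_sign F G + frame_sign G H = frame_sign F H.
Proof.
move=> [uF AF] [uG BG] [uH CH] AB AC; apply: frame_sign_triple => //.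
  have := frob_dist_trans A (frame_mx F) (frame_mx G); rewrite (frob_distC _ A).
  have := frob_dist_trans B A (frame_mx G); lra.
have := frob_dist_trans A (frame_mx F) (frame_mx H); rewrite (frob_distC _ A).
have := frob_dist_trans C A (frame_mx H); lra.
Qed.

Lemma near_frame_triple1 A F G H : near_frame (1 / 3) A F -> near_frame (1 / 3) A G ->
  near_frame (1 / 3) A H -> frame_sign F G + frame_sign G H = frame_sign F H.
Proof. by move=> AF AG AH; apply: near_frame_triple AF AG AH _ _; rewrite frob_distxx divr_gt0. Qed.

End InfiniteFrames.

(** * Transport of orientations and its holonomy *)

Section Holonomy.
Context (R : realType) (d : nat).
Implicit Types (F : R -> frame R d) (b : R -> 'F_2) (A : R -> mxinf R).

(** [b t] tells whether the frame [F t] agrees with an orientation transported along the path. The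
    frames may jump; a jump that reverses orientation shows up in [b]. For continuous frames a
    constant [b] is coherent. *)
Definition coherent F b := forall t : R, 0 <= t <= 1 ->
  \forall t' \near t, 0 <= t' <= 1 -> b t' = b t + frame_sign (F t) (F t').

(** The trace of continuity that the sign arguments use; it also makes sense for the path of closest
    points, which is not given as a continuous map. *)
Definition tame A := forall t : R, 0 <= t <= 1 ->
  \forall t' \near t, 0 <= t' <= 1 -> frob_dist (A t) (A t') < 1 / 100.

Definition near_frames (r : R) A F := forall t : R, 0 <= t <= 1 -> near_frame r (A t) (F t).

(** The two ways from F t to G t', through F t' and through G t, have the same sign by the triple
    formula. *)
Lemma coherent_change A F G b : tame A -> near_frames (1 / 3) A F -> near_frames (1 / 3) A G ->
  coherent F b -> coherent G (fun t => b t + frame_sign (F t) (G t)).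
Proof.
move=> tA AF AG cF t t01; apply: filterS2 (tA t t01) (cF t t01) => t' At bt t'01.
have {}At := At t'01; rewrite (bt t'01).
have AtS : frob_dist (A t) (A t') < 1 / 50 by lra.
have z : frob_dist (A t) (A t) < 1 / 50 by rewrite frob_distxx divr_gt0.
have E1 := near_frame_triple (AF t t01) (AF t' t'01) (AG t' t'01) AtS AtS.
have E2 := near_frame_triple (AF t t01) (AG t t01) (AG t' t'01) z AtS.
by rewrite -addrA E1 -E2 addrA.
Qed.

(** The sum of two coherent functions is locally constant on [0, 1], hence has equal values at the
    ends. *)
Lemma coherent_unique F b b' : coherent F b -> coherent F b' -> b 0 + b 1 = b' 0 + b' 1.
Proof.
move=> cb cb'; apply: F2_eq.
have : b 0 + b' 0 = b 1 + b' 1.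
  apply: (interval_const (b := fun t => b t + b' t)) => t t01.
  apply: filterS2 (cb t t01) (cb' t t01) => t' + + t'01.
  move=> /(_ t'01) -> /(_ t'01) ->.
  by rewrite addrACA F2_addxx addr0.
rewrite addrACA => ->; exact: F2_addxx.
Qed.

(* [q] is 1 if transport along the loop [A] reverses orientation, and 0 otherwise. *)
Definition holonomy A (q : 'F_2) := exists F b,
  [/\ near_frames (1 / 3) A F, coherent F b & q = b 0 + b 1 + frame_sign (F 0) (F 1)].

(** The holonomy can be computed from any frames near the loop: the corrections at the two ends are
    signs between frames near the same matrix, and the triple formula absorbs them into the closing
    sign. *)
Lemma holonomy_coherent A F q : tame A -> A 0 = A 1 -> near_frames (1 / 3) A F ->
  holonomy A q -> exists2 b, coherent F b & q = b 0 + b 1 + frame_sign (F 0) (F 1).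
Proof.
move=> tA A01 AF [G [b [AG cb ->]]].
exists (fun t => b t + frame_sign (G t) (F t)); first exact: (coherent_change tA).
have i0 : 0 <= (0 : R) <= 1 by rewrite lexx ler01.
have i1 : 0 <= (1 : R) <= 1 by rewrite lexx ler01.
have G0 := AG 0 i0; have F0 := AF 0 i0; have G1 := AG 1 i1; have F1 := AF 1 i1.
rewrite A01 in G0 F0.
rewrite [in RHS]addrACA -[RHS]addrA; congr (_ + _).
rewrite -(near_frame_triple1 G0 F0 G1) -(near_frame_triple1 F0 F1 G1).
by rewrite (frame_signC (F 1)) -!addrA; congr (_ + _); rewrite addrC.
Qed.

Definition jointly_tame (A : R -> R -> mxinf R) := forall u t : R, 0 <= u <= 1 -> 0 <= t <= 1 ->
  exists2 e, 0 < e & forall u' t' : R, 0 <= u' <= 1 -> 0 <= t' <= 1 ->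
    `|u' - u| < e -> `|t' - t| < e -> frob_dist (A u t) (A u' t') < 1 / 200.

Lemma jointly_tame_tame (A : R -> R -> mxinf R) (u : R) : 0 <= u <= 1 -> jointly_tame A -> tame (A u).
Proof.
move=> u01 jA t t01; have [e e0 Ae] := jA u t u01 t01.
apply: (ball_near e0) => t' t'e t'01.
have := Ae u t' u01 t'01; rewrite subrr normr0 => /(_ e0 t'e); lra.
Qed.

(** Compactness of [0, 1] in the parameter t, by interval induction with the smaller of two radii.
    Comparing through A u t costs 1/200 twice. *)
Lemma jointly_tame_uniform (A : R -> R -> mxinf R) (u : R) : 0 <= u <= 1 -> jointly_tame A ->
  \forall u' \near u, 0 <= u' <= 1 -> forall t : R, 0 <= t <= 1 ->
    frob_dist (A u t) (A u' t) < 1 / 100.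
Proof.
move=> u01 jA.
have [e e0 Ae] : exists2 e : R, 0 < e & forall t : R, 0 <= t <= 1 -> forall u', 0 <= u' <= 1 ->
    `|u' - u| < e -> frob_dist (A u t) (A u' t) < 1 / 100.
  apply: (interval_ind (P := fun x y => exists2 e : R, 0 < e & forall t, x <= t <= y ->
    forall u', 0 <= u' <= 1 -> `|u' - u| < e -> frob_dist (A u t) (A u' t) < 1 / 100)) => //.
    move=> t t01; have [e e0 Ae] := jA u t u01 t01.
    exists e => // x y x0 xy y1 xt yt; exists e => // t' /andP[xt' ty'] u' u'01 u'e.
    have t'01 : 0 <= t' <= 1 by rewrite (le_trans x0) // (le_trans ty').
    have t'e : `|t' - t| < e.
      by move: xt yt; rewrite !ltr_norml => /andP[? ?] /andP[? ?]; apply/andP; split; lra.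
    have H1 := Ae u' t' u'01 t'01 u'e t'e.
    have := Ae u t' u01 t'01; rewrite subrr normr0 => /(_ e0 t'e) H2.
    have := frob_dist_trans (A u t) (A u t') (A u' t'); rewrite (frob_distC (A u t') (A u t)); lra.
  move=> x y z xyz [e e0 Ae] [e' e'0 Ae']; exists (Num.min e e'); first by rewrite lt_min e0.
  move=> t /andP[xt tz] u' u'01; rewrite lt_min => /andP[ue ue'].
  have [ty|yt] := leP t y; first by apply: Ae => //; rewrite xt.
  by apply: Ae' => //; rewrite tz ltW.
by apply: (ball_near e0) => u' u'e u'01 t t01; exact: Ae.
Qed.

(** Frames within 8/25 of the loop at time u are still within 1/3 of the loops at nearby times, so
    the same frames and the same [b] give the same holonomy there. Having holonomy [q] is thus a
    locally constant property of u. *)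
Lemma holonomy_homotopy (A : R -> R -> mxinf R) (q : 'F_2) : jointly_tame A -> (forall u : R, 0 <= u <= 1 -> A u 0 = A u 1) ->
  (forall u t : R, 0 <= u <= 1 -> 0 <= t <= 1 -> exists K : frame R d, near_frame (8 / 25) (A u t) K) ->
  holonomy (A 0) q <-> holonomy (A 1) q.
Proof.
move=> jA A01 nA.
have step u u' : 0 <= u <= 1 -> 0 <= u' <= 1 ->
    (forall t : R, 0 <= t <= 1 -> frob_dist (A u t) (A u' t) < 1 / 100) ->
    holonomy (A u) q -> holonomy (A u') q.
  move=> u01 u'01 uu hq.
  have /choice[F AF] : forall t : R, exists K : frame R d, 0 <= t <= 1 -> near_frame (8 / 25) (A u t) K.
    move=> t.
    (* [choice] wants a frame at every real t; outside [0, 1] an arbitrary one is supplied. *)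
    have [K0 _] := nA u 0 u01 (introT andP (conj (lexx 0) ler01)).
    have [t01|t01] := boolP (0 <= t <= 1); last by exists K0 => /idPn.
    by have [K AK] := nA u t u01 t01; exists K.
  have AF' : near_frames (1 / 3) (A u) F.
    by move=> t t01; apply: near_frame_le (AF t t01); lra.
  have [b cb qb] := holonomy_coherent (jointly_tame_tame u01 jA) (A01 u u01) AF' hq.
  exists F, b; split=> // t t01; have [uF AFt] := AF t t01; split=> //.
  (* 8/25 + 1/100 < 1/3. *)
  have := frob_dist_trans (A u t) (A u' t) (frame_mx (F t)).
  by have := uu t t01; rewrite (frob_distC (A u t)); lra.
apply: (interval_iff (Q := fun u => holonomy (A u) q)) => u u01.
apply: filterS (jointly_tame_uniform u01 jA) => u' /[swap] u'01 /(_ u'01) uu.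
by split; apply: step => // t t01; rewrite frob_distC uu.
Qed.

End Holonomy.

(** * Continuity in the direct limits, and frames of points near the Grassmannian *)

Section FrameTopology.
Context (R : realType).

Lemma mxinf_continuous (T : topologicalType) (f : mxinf R -> T) :
  (forall n, continuous (fun A : 'M[R]_n => f (pad A))) -> continuous f.
Proof.
move=> cf; apply/continuousP => O oO; change (lim_open (@pad R) (f @^-1` O)) => n.
by move: (cf n) => /continuousP/(_ O oO).
Qed.

Lemma vecinf_continuous (T : topologicalType) (f : vecinf R -> T) :
  (forall n, continuous (fun v : 'cV[R]_n => f (vpad v))) -> continuous f.
Proof.
move=> cf; apply/continuousP => O oO; change (lim_open (@vpad R) (f @^-1` O)) => n.
by move: (cf n) => /continuousP/(_ O oO).
Qed.

Lemma pad_bounded n (A : 'M[R]_n) : mx_bounded n (pad A).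
Proof.
move=> i j ij /=; rewrite /pad_fun; case: insubP => // a ai _; case: insubP => // b bj _.
by move: ij; rewrite (leqNgt n i) (leqNgt n j) ai bj.
Qed.

Lemma mx_trunc_pad n (A : 'M[R]_n) : mx_trunc n (pad A) = A.
Proof. by apply/matrixP => i j; rewrite mxE /= /pad_fun !valK. Qed.

Lemma mx_bounded_le m n (A : mxinf R) : (m <= n)%N -> mx_bounded m A -> mx_bounded n A.
Proof.
move=> mn Am i j ij; apply: Am; by case/orP: ij => /(leq_trans mn) ->; rewrite ?orbT.
Qed.

(** With [P] fixed, the distance on n x n matrices is the square root of a polynomial in their
    entries, and the limit topology only has to be tested on each n. *)
Lemma frob_dist_continuous (P : mxinf R) : continuous (fun A : mxinf R => frob_dist A P : R^o).
Proof.
apply: mxinf_continuous => n A.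
pose N := maxn n (mx_size P).
have E (B : 'M[R]_n) : frob_dist (pad B) P =
    Num.sqrt (\sum_j \sum_(i < N) (pad_fun B i (j : 'I_N) - sval P i j) ^+ 2).
  rewrite (@frob_distE _ N).
  - rewrite /mxnorm mxipE; congr Num.sqrt.
    by do 2!apply: eq_bigr => ? _; rewrite !mxE -expr2.
  - exact: (mx_bounded_le (leq_maxl _ _) (pad_bounded B)).
  - exact: (mx_size_bounded (leq_maxr _ _)).
rewrite /continuous_at E; under eq_fun do rewrite E.
have c : continuous (fun B : 'M[R]_n => \sum_j \sum_(i < N)
    (pad_fun B i (j : 'I_N) - sval P i j) ^+ 2 : R^o).
  move=> B; apply: (cvg_sum (nbhs_filter B)) => j _.
  apply: (cvg_sum (nbhs_filter B)) => i _.
  have cp : continuous (fun B : 'M[R]_n => pad_fun B i j - sval P i j : R^o).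
    move=> C; apply: (@cvgB R R^o _ _ (nbhs_filter C)); last exact: cvg_cst.
    rewrite /pad_fun; case: insubP => [a _ _|_]; last exact: cvg_cst.
    by case: insubP => [b _ _|_]; [exact: coord_continuous|exact: cvg_cst].
  by apply: (@continuous_comp _ _ _ _ (fun x : R => x ^+ 2) B); [exact: cp|exact: exprn_continuous].
by apply: (@continuous_comp _ _ _ _ (@Num.sqrt R) A); [exact: c|exact: sqrt_continuous].
Qed.

Lemma vec_ip_continuous (u : vecinf R) : continuous (vec_ip u : vecinf R -> R^o).
Proof.
apply: vecinf_continuous => n v.
have E (w : 'cV[R]_n) : vec_ip u (vpad w) = \sum_(i < vec_size u) sval u i * vpad_fun w i.
  by rewrite /vec_ip (@nat_fsum _ (vec_size u)) // => i ui; rewrite vec_sizeP // mul0r.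
rewrite /continuous_at E; under eq_fun do rewrite E.
apply: (cvg_sum (nbhs_filter v)) => i _.
apply: (@cvgM R _ _ (nbhs_filter v)); first exact: cvg_cst.
rewrite /vpad_fun; case: insubP => [a _ _|_]; last exact: cvg_cst.
exact: coord_continuous.
Qed.

Lemma frame_bounded_size d (F : frame R d) : frame_bounded (frame_size F) F.
Proof. exact: frame_size_bounded. Qed.

Lemma gram_unit_gt0 d (F : frame R d) : gram F F \in unitmx -> 0 < \det (gram F F).
Proof. by rewrite !(gramE _ (@frame_bounded_size _ F)); exact: gram_gt0. Qed.

(** The Gram determinant of [F] with itself is positive, and it depends continuously on the second
    frame. *)
Lemma frame_sign_near (T : Type) (Z : set_system T) (FZ : Filter Z) d (K : T -> frame R d)
    (F : frame R d) : gram F F \in unitmx ->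
  (forall a, K x a @[x --> Z] --> F a) -> \forall x \near Z, frame_sign F (K x) = 0.
Proof.
move=> uF cK.
have cg : (\det (gram F (K x)) : R^o) @[x --> Z] --> (\det (gram F F) : R^o).
  apply: cvg_det; apply/cvg_mxP => a b; rewrite !mxE; under eq_fun do rewrite !mxE.
  apply: (@cvg_comp _ _ _ (fun x => K x b) (vec_ip (F a) : vecinf R -> R^o)); first exact: cK.
  exact: vec_ip_continuous.
have H : nbhs (\det (gram F F) : R^o) [set y | 0 < y].
  by apply: open_nbhs_nbhs; split; [exact: open_gt|exact: gram_unit_gt0].
have cH : Z [set x | 0 < \det (gram F (K x))] := cg _ H.
apply: filterS cH => x /= x0; rewrite /frame_sign /sign_bit ltNge ltW //.
Qed.

Section FiniteGr.
Context (d n : nat).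

Lemma gram_unit_rank (F : 'M[R]_(n, d)) : \rank F = d -> F^T *m F \in unitmx.
Proof.
move=> rF; rewrite -row_free_unit -kermx_eq0; apply: contraT => /rowV0Pn[v /sub_kermxP vF].
apply: contraNT => _; have FF : (v *m F^T)^T^T *m (v *m F^T)^T = 0.
  by rewrite trmxK trmx_mul trmxK mulmxA -(mulmxA v) vF mul0mx.
have [z|nz] := eqVneq (v *m F^T)^T 0; last first.
  by have := colsq_gt0 nz; rewrite FF mxE ltxx.
have : v *m F^T = 0 by apply: trmx_inj; rewrite trmx0.
move=> /(congr1 (mulmx^~ (pinvmx F^T))); rewrite mul0mx mulmxKp ?/row_free ?mxrank_tr ?rF //.
by move=> ->; rewrite eqxx.
Qed.

(** [P] and the projection Q to the columns of [F] have the same image, so Q P = P and P Q = Q; as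
    both are symmetric, transposing gives P = Q. *)
Lemma frame_proj_eq (F : 'M[R]_(n, d)) (W : 'M[R]_(d, n)) (P : 'M[R]_n) :
  F^T *m F \in unitmx -> P = P^T -> P = F *m W -> P *m F = F -> frame_proj F = P.
Proof.
move=> uF Ps PFW PF.
have E1 : frame_proj F *m P = P by rewrite {1}PFW mulmxA frame_proj_id // -PFW.
have E2 : P *m frame_proj F = frame_proj F by rewrite /frame_proj !mulmxA PF.
by rewrite -E2 {1}Ps -frame_proj_sym -trmx_mul E1 -Ps.
Qed.

Lemma factor_rank (F : 'M[R]_(n, d)) (W : 'M[R]_(d, n)) (P : 'M[R]_n) :
  P = F *m W -> \rank P = d -> \rank F = d.
Proof.
move=> PFW rP; apply/eqP; rewrite eqn_leq rank_leq_col /= -{1}rP PFW.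
exact: mxrankM_maxl.
Qed.

(** A rank factorization P = F W provides the frame; cancelling the full-rank W in P F W = F W gives
    P F = F. *)
Lemma Gr_fin_frame (P : 'M[R]_n) : Gr_fin R d n P ->
  exists2 F : 'M[R]_(n, d), F^T *m F \in unitmx & frame_proj F = P.
Proof.
move=> [Ps PP rP].
have [F [W PFW]] : exists (F : 'M[R]_(n, d)) (W : 'M[R]_(d, n)), P = F *m W.
  by rewrite -rP; exists (col_base P), (row_base P); rewrite mulmx_base.
have rF := factor_rank PFW rP.
have rW : row_free W.
  by rewrite /row_free eqn_leq rank_leq_row /= -{1}rP PFW mxrankM_maxr.
have uF := gram_unit_rank rF.
exists F => //; apply: (frame_proj_eq uF Ps PFW).
by apply: (row_free_inj rW); rewrite -mulmxA -PFW -PP.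
Qed.

End FiniteGr.

Lemma frame_of_mx d n (F : 'M[R]_(n, d)) : exists2 K : frame R d,
  frame_bounded n K & frame_trunc n K = F.
Proof.
exists (fun a => vpad (col a F)).
  by move=> a i ni /=; rewrite /vpad_fun; case: insubP => // b bn _; rewrite leqNgt bn in ni.
by apply/matrixP => i a; rewrite mxE /= /vpad_fun valK mxE.
Qed.

Lemma Gr_frame d (P : mxinf R) : Gr d P ->
  exists2 F : frame R d, gram F F \in unitmx & frob_dist P (frame_mx F) = 0.
Proof.
move=> [n _ [Q GQ <-]]; have [F uF FQ] := Gr_fin_frame GQ.
have [K bK KF] := frame_of_mx F; exists K; first by rewrite (gramE _ bK) KF.
rewrite (frob_distE (pad_bounded Q) (frame_mx_bounded bK)) mx_trunc_pad mx_trunc_frame // KF FQ.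
by rewrite subrr /mxnorm /mxip mulmx0 mxtrace0 sqrtr0.
Qed.

Lemma Gr_thick_frame d (delta : R) (A : mxinf R) : delta < 8 / 25 -> Gr_thick d delta A ->
  exists F : frame R d, near_frame (8 / 25) A F.
Proof.
move=> d8; rewrite /Gr_thick; case: ifP => [_ /Gr_frame[F uF AF]|_ [P /Gr_frame[F uF PF] AP]].
  by exists F; split=> //; rewrite AF divr_gt0.
exists F; split=> //; have := frob_dist_trans P A (frame_mx F); rewrite PF; lra.
Qed.

Lemma Gr_proj_dist d (delta : R) (A : mxinf R) : delta < 8 / 25 -> Gr_thick d delta A ->
  Gr d (Gr_proj d A) -> frob_dist A (Gr_proj d A) < 8 / 25.
Proof.
move=> d8 tA GA.
have [P GP AP] : exists2 P, Gr d P & frob_dist A P < 8 / 25.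
  move: tA; rewrite /Gr_thick; case: ifP => [_ G|_ [P GP AP]].
    by exists A => //; rewrite frob_distxx divr_gt0.
  by exists P => //; exact: lt_trans AP d8.
apply: le_lt_trans AP; rewrite /Gr_proj; case: xgetP => [Q _ [_ QA]|nex].
  exact: QA.
(* In the default case of [xget] the value is [A] itself, at distance zero. *)
by rewrite frob_distxx frob_dist_ge0.
Qed.

(** Recognizes [A] as the projection to the span of [K]. The columns of [A] are combinations of the
    d vectors of [K], and [A] has rank d, so these vectors are independent. *)
Lemma image_frame d (A : mxinf R) (K : frame R d) : Gr d A ->
  (forall a, mxinf_image A (K a)) ->
  (forall v, mxinf_image A v -> exists c : 'I_d -> R,
     forall i, sval v i = \sum_a c a * sval (K a) i) ->
  gram K K \in unitmx /\ frob_dist A (frame_mx K) = 0.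
Proof.
move=> [n _ [P [Ps PP rP] <-]] AK KA.
have mulA (u : vecinf R) i : \sum_(j \in [set: nat]) sval (pad P) i j * sval u j =
    \sum_(j < n) pad_fun P i j * sval u j.
  by apply: nat_fsum => j nj; rewrite (pad_bounded P) ?nj ?orbT // mul0r.
have bK : frame_bounded n K.
  move=> a i ni; have [u ->] := AK a; rewrite mulA big1 // => j _.
  have -> : pad_fun P i j = 0 by apply: (@pad_bounded n P); rewrite ni.
  by rewrite mul0r.
pose F := frame_trunc n K.
have PF : P *m F = F.
  have H a : exists u : 'cV_n, col a F = P *m u.
    have [u Ku] := AK a; exists (\col_i sval u i); apply/colP => i.
    rewrite !mxE Ku mulA; apply: eq_bigr => j _.
    by rewrite !mxE /pad_fun !valK.
  apply/matrixP => i a; have [u Fu] := H a.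
  have -> : (P *m F) i a = (P *m col a F) i 0 by rewrite !mxE; apply: eq_bigr => j _; rewrite !mxE.
  by rewrite Fu mulmxA -PP -Fu mxE.
have [W PFW] : exists W, P = F *m W.
  have H (j : 'I_n) : exists c : 'I_d -> R, forall i, P i j = \sum_a F i a * c a.
    have [|c Pc] := KA (vpad (col j P)).
      exists (vpad (delta_mx j 0)) => i; rewrite mulA.
      rewrite (bigD1 j) //= big1 ?addr0; last first.
        by move=> k kj; rewrite /vpad_fun valK mxE (negbTE kj) mulr0.
      rewrite /vpad_fun valK mxE !eqxx mulr1 /pad_fun valK.
      by case: insubP => // b _ _; rewrite mxE.
    exists c => i; have := Pc i; rewrite /= /vpad_fun valK mxE => ->.
    by apply: eq_bigr => a _; rewrite mxE mulrC.
  have /choice[c Pc] := H.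
  by exists (\matrix_(a, j) c j a); apply/matrixP => i j; rewrite !mxE Pc; apply: eq_bigr => a _; rewrite !mxE.
have uF := gram_unit_rank (factor_rank PFW rP).
split; first by rewrite (gramE _ bK).
rewrite (frob_distE (pad_bounded P) (frame_mx_bounded bK)) mx_trunc_pad mx_trunc_frame //.
by rewrite -/F (frame_proj_eq uF Ps PFW PF) subrr /mxnorm /mxip mulmx0 mxtrace0 sqrtr0.
Qed.

(** The distance to a fixed value of [H] is continuous, and [H] is continuous relative to times in
    [0, 1], which is why [jointly_tame] restricts its parameters. *)
Lemma homotopy_jointly_tame (T : topologicalType) (H : T * R -> mxinf R) (h : R -> T) :
  {within [set: T] `*` `[0, 1]%classic, continuous H} -> continuous h ->
  jointly_tame (fun u t => H (h t, u)).
Proof.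
move=> /subspace_continuousP cH ch u t u01 t01.
have O : nbhs (H (h t, u)) [set A | frob_dist A (H (h t, u)) < 1 / 200].
  have := @frob_dist_continuous (H (h t, u)) (H (h t, u)).
  rewrite /continuous_at frob_distxx => c.
  by apply: (c [set x | x < 1 / 200]); apply: open_nbhs_nbhs; split; [exact: open_lt|rewrite /= divr_gt0].
have dom (x : T) (v : R) : 0 <= v <= 1 -> ([set: T] `*` `[0, 1]%classic) (x, v).
  by move=> v01; split => //=; rewrite in_itv.
have := cH _ (dom (h t) u u01) _ O.
rewrite /nbhs /= /within /= => -[[P Q] [/= Pt Qu] PQ].
have [e e0 eP] := near_ball (ch t _ Pt); have [e' e'0 eQ] := near_ball Qu.
exists (Num.min e e'); first by rewrite lt_min e0.
move=> u' t' u'01 t'01; rewrite !lt_min => /andP[_ ue] /andP[te _].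
by rewrite frob_distC; apply: (PQ (h t', u')); [split; [exact: eP|exact: eQ]|exact: dom].
Qed.

End FrameTopology.

(** * Block sums, averages and determinants of orthogonal matrices *)

Section BlockSum.
Context (R : realType) (d : nat) (J : choiceType) (L : seq J) (e : J -> 'I_d -> nat).
Hypotheses (uL : uniq L)
  (e_inj : forall j r j' r', e j r = e j' r' -> j = j' /\ r = r').

(** The positions [e j r] are pairwise distinct, so each row of the stacked blocks receives at most
    one term and no cross terms survive. *)
Lemma block_sum N (f g : J -> 'I_d -> R) : (forall j r, j \in L -> (e j r < N)%N) ->
  \sum_(n < N) (\sum_(j <- L) \sum_(r < d | n == e j r :> nat) f j r) *
    (\sum_(j <- L) \sum_(r < d | n == e j r :> nat) g j r) =
  \sum_(j <- L) \sum_(r < d) f j r * g j r.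
Proof.
move=> eN.
have G j r : j \in L -> \sum_(j' <- L) \sum_(r' < d | e j r == e j' r') g j' r' = g j r.
  move=> jL; rewrite (bigD1_seq j) //= [X in _ + X]big1 ?addr0; last first.
    move=> j' jj'; rewrite big1 // => r' /eqP/e_inj[E _].
    by rewrite E eqxx in jj'.
  rewrite (bigD1 r) //= big1 ?addr0 // => r' /andP[/eqP/e_inj[_ E]].
  by rewrite E eqxx.
under eq_bigr do rewrite mulr_suml.
rewrite exchange_big /= big_seq [RHS]big_seq; apply: eq_bigr => j jL.
under eq_bigr do rewrite mulr_suml.
rewrite (exchange_big_dep xpredT) //=; apply: eq_bigr => r _.
rewrite (big_pred1 (Ordinal (eN j r jL))); last first.
  by move=> n; apply/eqP/eqP => [E|->//]; exact: val_inj.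
by rewrite /= G.
Qed.

End BlockSum.

Section OrthogonalAverage.
Context (R : realType) (d : nat) (J : eqType) (L : seq J) (w : J -> R) (O : J -> 'M[R]_d)
  (Q : 'M[R]_d) (r : R).
Hypotheses (w0 : forall j, 0 <= w j) (w1 : \sum_(j <- L) w j = 1)
  (oO : forall j, j \in L -> (O j)^T *m O j = 1%:M) (oQ : Q^T *m Q = 1%:M)
  (OQ : forall j, j \in L -> mxip (O j - Q) (O j - Q) <= r).
Let G := \sum_(j <- L) w j *: O j.

Lemma mxip_suml m n (F : J -> 'M[R]_(m, n)) (A : 'M[R]_(m, n)) :
  mxip (\sum_(j <- L) w j *: F j) A = \sum_(j <- L) w j * mxip (F j) A.
Proof.
elim: L => [|j s IH]; first by rewrite !big_nil /mxip trmx0 mul0mx mxtrace0.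
by rewrite !big_cons mxipDl mxipZl IH.
Qed.

(** The bound on |O_j - Q|^2 says <O_j, Q> >= d - r / 2; averaging gives the same for <G, Q>, and |G
    - Q|^2 >= 0 yields |G|^2 >= 2 <G, Q> - d. *)
Lemma orth_average_norm : d%:R - mxip G G <= r.
Proof.
have dd (A : 'M[R]_d) : A^T *m A = 1%:M -> mxip A A = d%:R by rewrite /mxip => ->; rewrite mxtrace1.
have E : \sum_(j <- L) w j * (2 * d%:R - 2 * mxip (O j) Q) = 2 * d%:R - 2 * mxip G Q.
  rewrite /G mxip_suml mulr_sumr; under eq_bigr do rewrite mulrBr.
  rewrite sumrB -mulr_suml w1 mul1r; congr (_ - _).
  by apply: eq_bigr => j _; rewrite mulrCA.
have H1 : 2 * d%:R - 2 * mxip G Q <= r.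
  have <- : \sum_(j <- L) w j * r = r by rewrite -mulr_suml w1 mul1r.
  rewrite -E big_seq [leRHS]big_seq; apply: ler_sum => j jL; apply: ler_wpM2l => //.
  have := OQ jL; rewrite !mxipE_lin (dd _ (oO jL)) (dd _ oQ) (mxipC Q); lra.
have := mxip_ge0 (G - Q); rewrite !mxipE_lin (dd _ oQ) (mxipC Q); lra.
Qed.

(** Q^t G is positive definite: <O_j x, Q x> >= (1 - r / 2) |x|^2 for each j, because O_j and Q
    preserve |x|, and the average inherits the bound. *)
Lemma orth_average_det : r < 2 -> 0 < \det Q * \det G.
Proof.
move=> r2; rewrite -(det_tr Q) -det_mulmx; apply: posdef_det => x x0.
have xx : 0 < mxip x x by rewrite /mxip trace_mx11; exact: colsq_gt0.
have iso (A : 'M[R]_d) : A^T *m A = 1%:M -> mxip (A *m x) (A *m x) = mxip x x.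
  by move=> oA; rewrite /mxip trmx_mul -mulmxA (mulmxA A^T) oA mul1mx.
have -> : (x^T *m (Q^T *m G) *m x) 0 0 = mxip (G *m x) (Q *m x).
  by rewrite mxipC /mxip trace_mx11 trmx_mul !mulmxA.
have -> : G *m x = \sum_(j <- L) w j *: (O j *m x).
  by rewrite mulmx_suml; apply: eq_bigr => j _; rewrite scalemxAl.
rewrite mxip_suml; apply: (@lt_le_trans _ _ ((1 - r / 2) * mxip x x)).
  by apply: mulr_gt0 => //; lra.
have <- : \sum_(j <- L) w j * ((1 - r / 2) * mxip x x) = (1 - r / 2) * mxip x x.
  by rewrite -mulr_suml w1 mul1r.
rewrite big_seq [leRHS]big_seq; apply: ler_sum => j jL.
apply: ler_wpM2l => //.
have := le_trans (mxip_mulmx (O j - Q) x) (ler_wpM2r (ltW xx) (OQ jL)).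
rewrite mulmxBl !mxipE_lin (mxipC (Q *m x)) !iso ?oO //; lra.
Qed.

End OrthogonalAverage.

Section OrthogonalSigns.
Context (R : realType) (B : topologicalType) (d : nat).

Lemma within_open_cvg (T : topologicalType) (A : set B) (f : B -> T) y :
  {within A, continuous f} -> open A -> A y -> f z @[z --> y] --> f y.
Proof. by move=> cf oA Ay; move: cf; rewrite continuous_open_subspace // => /(_ y); apply; exact: mem_set. Qed.

Lemma orth_det (A : 'M[R]_d) : A^T *m A = 1%:M -> \det A = 1 \/ \det A = -1.
Proof.
move=> oA; have : \det A ^+ 2 = 1 by rewrite expr2 -{1}det_tr -det_mulmx oA det1.
by move=> /eqP; rewrite sqrf_eq1 => /orP[]/eqP->; [left|right].
Qed.

Lemma neg1_neq1 : (-1 : R) != 1.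
Proof. by rewrite -subr_eq0 -opprD oppr_eq0 -mulr2n pnatr_eq0. Qed.

(** The determinant takes only the values 1 and -1 on [Z], so a change by less than 1 is no
    change. *)
Lemma det_bit_locally_constant (Z : set B) (A : B -> 'M[R]_d) : open Z ->
  {within Z, continuous A} -> (forall y, Z y -> (A y)^T *m A y = 1%:M) ->
  locally_constant_on Z (fun y => (\det (A y) != 1)%:R).
Proof.
move=> oZ cA oA y Zy; have cd := cvg_det (nbhs_filter y) (within_open_cvg cA oZ Zy).
have H : nbhs (\det (A y) : R^o) [set x | `|x - \det (A y)| < 1].
  by apply: (ball_near ltr01) => x.
have cH : nbhs y [set z | `|\det (A z) - \det (A y)| < 1] := cd _ H.
apply: filterS cH => z /= zy Zz; congr (nat_of_bool _)%:R.
case: (orth_det (oA z Zz)) (orth_det (oA y Zy)) zy => -> [] -> //;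
  rewrite ltr_norml => /andP[? ?]; lra.
Qed.

Lemma det_bit_mul (A C : 'M[R]_d) : A^T *m A = 1%:M -> C^T *m C = 1%:M ->
  (\det (A *m C) != 1)%:R = (\det A != 1)%:R + (\det C != 1)%:R :> 'F_2.
Proof.
move=> oA oC; rewrite det_mulmx.
by case: (orth_det oA) => ->; case: (orth_det oC) => ->;
  rewrite ?mulrNN ?mulN1r ?mul1r ?eqxx ?neg1_neq1; apply/val_inj.
Qed.

End OrthogonalSigns.

(** * The frames Phi_i and the map cl(Omega) *)

Section PhiFrames.
Context (R : realType) (B : topologicalType) (U : open_cover B) (d : nat) (d0 : (0 < d)%N).
Variables (eps : R) (phi : cidx U -> B -> R) (iota : cidx U -> nat) (Om : mx_cochain R U d).
Hypotheses (eps1 : eps < 2 / 9) (pou : partition_of_unity phi)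
  (iota_inj : injective iota) (iota0 : forall i, (0 < iota i)%N) (cOm : eps_cocycle eps Om).

Definition pou_supp (y : B) : set (cidx U) := [set j | phi j y != 0].

Lemma pou_supp_finite y : finite_set (pou_supp y).
Proof.
case: pou => _ _ _ lf _; have [N Ny fN] := lf y.
apply: sub_finite_set fN => j /= jy; exists y; split=> //; exact: nbhs_singleton.
Qed.

Lemma pou_supp_sub y j : phi j y != 0 -> U j y.
Proof. by case: pou => _ _ sp _ _ jy; apply: sp; exact: subset_closure. Qed.

Lemma supp_fsum (V : nmodType) (D : set (cidx U)) (f : cidx U -> V) : finite_set D ->
  (forall j, ~ D j -> f j = 0) -> \sum_(j \in [set: cidx U]) f j = \sum_(j <- fset_set D) f j.
Proof.
move=> fD f0; rewrite -fsbig_finite //; apply/esym/fsbig_widen => // j [_ nD] /=.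
exact: f0.
Qed.

Lemma pou_sum (D : set (cidx U)) y : finite_set D -> pou_supp y `<=` D ->
  \sum_(j <- fset_set D) phi j y = 1.
Proof.
move=> fD yD; case: pou => _ _ _ _ /(_ y) <-; rewrite (supp_fsum fD) // => j nD.
by apply/eqP; apply: contra_notT nD => jy; exact: yD.
Qed.

Lemma pou_ge0 j y : 0 <= phi j y.
Proof. by case: pou. Qed.

(** Rows are counted from 0 here, so block [j] starts at row d * iota j - 1, which makes sense as d
    and [iota j] are positive. [D] is any finite set containing the support, so that different
    points can share it. *)
Lemma PhiE (D : set (cidx U)) i y n a : finite_set D -> pou_supp y `<=` D ->
  Phi phi iota Om i y n a =
  \sum_(j <- fset_set D) \sum_(r < d | n == (d * iota j + r).-1)
    Num.sqrt (phi j y) * (Om i j y)^T r a.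
Proof.
move=> fD yD; rewrite /Phi (supp_fsum fD).
  apply: eq_bigr => j _; apply: eq_bigl => r.
  by rewrite -[(d * iota j + r)%N in LHS]prednK // addn_gt0 muln_gt0 d0 iota0.
move=> j nD; rewrite big1 // => r _.
have /eqP -> : phi j y == 0 by apply: contra_notT nD => jy; exact: yD.
by rewrite sqrtr0 mul0r.
Qed.

Definition Phi_bound (D : set (cidx U)) := \max_(j <- fset_set D) (d * iota j + d)%N.

Lemma Phi_boundP (D : set (cidx U)) j (r : 'I_d) : j \in fset_set D ->
  ((d * iota j + r).-1 < Phi_bound D)%N.
Proof.
move=> jD; rewrite prednK ?addn_gt0 ?muln_gt0 ?d0 ?iota0 //.
have : (d * iota j + d <= Phi_bound D)%N by exact: leq_bigmax_seq.
by apply: leq_trans; rewrite leq_add2l ltnW.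
Qed.

Lemma Phi_finite (D : set (cidx U)) i y n a : finite_set D -> pou_supp y `<=` D ->
  (Phi_bound D <= n)%N -> Phi phi iota Om i y n a = 0.
Proof.
move=> fD yD nD; rewrite (PhiE _ _ _ fD yD) big_seq big1 // => j jD.
rewrite big1 // => r /eqP nE.
by have := Phi_boundP r jD; rewrite -nE ltnNge nD.
Qed.

Lemma Phi_frame_subproof i y a :
  exists m, forall n, (m <= n)%N -> Phi phi iota Om i y n a = 0.
Proof.
by exists (Phi_bound (pou_supp y)) => n; apply: Phi_finite => //; exact: pou_supp_finite.
Qed.

Definition Phi_frame i y : frame R d := fun a =>
  exist _ (fun n => Phi phi iota Om i y n a) (Phi_frame_subproof i y a).

Lemma block_index_inj j (r : 'I_d) j' (r' : 'I_d) :
  (d * iota j + r).-1 = (d * iota j' + r').-1 -> j = j' /\ r = r'.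
Proof.
move=> E; have {}E : (d * iota j + r = d * iota j' + r')%N.
  by rewrite -[LHS]prednK ?E ?prednK // addn_gt0 muln_gt0 d0 iota0.
have q : iota j = iota j'.
  have := congr1 (fun x => x %/ d)%N E.
  by rewrite ![(d * _)%N]mulnC !divnMDl // !divn_small // !addn0.
split; first exact: iota_inj.
by apply/val_inj; move: E; rewrite q => /addnI.
Qed.

Lemma gram_Phi (D : set (cidx U)) i k y z : finite_set D -> pou_supp y `<=` D ->
  pou_supp z `<=` D ->
  gram (Phi_frame i y) (Phi_frame k z) =
  \sum_(j <- fset_set D) (Num.sqrt (phi j y) * Num.sqrt (phi j z)) *: (Om i j y *m (Om k j z)^T).
Proof.
move=> fD yD zD; apply/matrixP => a b; rewrite mxE summxE /vec_ip (@nat_fsum _ (Phi_bound D)); last first.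
  by move=> n nD; rewrite /= (Phi_finite _ _ fD yD) ?mul0r.
under eq_bigr do rewrite /= (PhiE _ _ _ fD yD) (PhiE _ _ _ fD zD).
rewrite (@block_sum _ _ _ _ (fun j (r : 'I_d) => (d * iota j + r).-1)).
- apply: eq_bigr => j _; rewrite !mxE mulr_sumr; apply: eq_bigr => r _.
  by rewrite !mxE mulrACA.
- exact: fset_uniq.
- by move=> j r j' r'; exact: block_index_inj.
- by move=> j r; exact: Phi_boundP.
Qed.

Lemma supp_fset y j : j \in fset_set (pou_supp y) -> U j y.
Proof.
rewrite in_fset_set; last exact: pou_supp_finite.
by move=> /set_mem; exact: pou_supp_sub.
Qed.

Lemma Om_orth i j y : U i y -> U j y -> (Om i j y)^T *m Om i j y = 1%:M.
Proof. by case: cOm => _ oOm _ _ Ui Uj; exact: oOm. Qed.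

Lemma Om_tr i j y : U i y -> U j y -> (Om i j y)^T = Om j i y.
Proof.
case: cOm => _ _ iOm _ Ui Uj; rewrite (iOm j i y) //.
have o := Om_orth Ui Uj; have [_ u] := mulmx1_unit o.
by rewrite -[LHS]mulmx1 -(mulmxV u) mulmxA o mul1mx.
Qed.

Lemma Om_close i j k y : U i y -> U j y -> U k y ->
  mxip (Om i j y *m Om j k y - Om i k y) (Om i j y *m Om j k y - Om i k y) <= 4 / 81.
Proof.
case: cOm => _ _ _ cl Ui Uj Uk; have := cl i j k y (conj (conj Ui Uj) Uk).
rewrite /eps_close; case: ifP => [_ ->|_ H].
  by rewrite subrr /mxip mulmx0 mxtrace0 divr_ge0.
have {}H : mxnorm (Om i j y *m Om j k y - Om i k y) < eps := H.
move: H; rewrite /mxnorm; set x := mxip _ _ => H.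
have x0 : 0 <= x by exact: mxip_ge0.
rewrite -(sqr_sqrtr x0) (_ : 4 / 81 = (2 / 9) ^+ 2); last by field.
by rewrite ler_pXn2r ?nnegrE ?sqrtr_ge0 ?divr_ge0 //; exact: ltW (lt_trans H eps1).
Qed.

Lemma gram_Phi1 i k y : U i y -> U k y -> gram (Phi_frame i y) (Phi_frame k y) =
  \sum_(j <- fset_set (pou_supp y)) phi j y *: (Om i j y *m Om j k y).
Proof.
move=> Ui Uk; rewrite (gram_Phi _ _ (pou_supp_finite y)) //.
rewrite big_seq [RHS]big_seq; apply: eq_bigr => j /supp_fset Uj.
by rewrite -expr2 sqr_sqrtr ?pou_ge0 // Om_tr.
Qed.

Lemma gram_Phi_self i y : U i y -> gram (Phi_frame i y) (Phi_frame i y) = 1%:M.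
Proof.
move=> Ui; rewrite gram_Phi1 //.
have <- : \sum_(j <- fset_set (pou_supp y)) phi j y *: (1%:M : 'M[R]_d) = 1%:M.
  by rewrite -scaler_suml (pou_sum (pou_supp_finite y)) // scale1r.
rewrite big_seq [RHS]big_seq; apply: eq_bigr => j /supp_fset Uj.
by rewrite -(Om_tr Ui Uj) (mulmx1C (Om_orth Ui Uj)).
Qed.

Lemma Phi_orthO i k y j : U i y -> U k y -> j \in fset_set (pou_supp y) ->
  (Om i j y *m Om j k y)^T *m (Om i j y *m Om j k y) = 1%:M.
Proof.
move=> Ui Uk /supp_fset Uj; rewrite trmx_mul -mulmxA (mulmxA (Om i j y)^T).
by rewrite (Om_orth Ui Uj) mul1mx (Om_orth Uj Uk).
Qed.

Lemma Phi_sign i k y : U i y -> U k y ->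
  frame_sign (Phi_frame i y) (Phi_frame k y) = det_cochain Om i k y.
Proof.
move=> Ui Uk; have := @orth_average_det _ _ _ _ (fun j => phi j y)
  (fun j => Om i j y *m Om j k y) (Om i k y) (4 / 81) (pou_ge0^~ y)
  (pou_sum (pou_supp_finite y) (@subset_refl _ _)) (fun j => Phi_orthO Ui Uk)
  (Om_orth Ui Uk) (fun j jS => Om_close Ui (supp_fset jS) Uk).
rewrite -gram_Phi1 // => /(_ _)/= H; have {H} : 0 < \det (Om i k y) * \det (gram (Phi_frame i y) (Phi_frame k y)).
  by apply: H; lra.
case: (orth_det (Om_orth Ui Uk)) => dE; rewrite /frame_sign /sign_bit /det_cochain dE.
  by rewrite mul1r eqxx => /ltW; rewrite ltNge => ->.
by rewrite mulN1r oppr_gt0 neg1_neq1 => ->.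
Qed.

Variable (g0 : B -> mxinf R).
Hypothesis (cl_g0 : is_cl_map phi iota Om g0).

(** [g0 y] is the average of the projections P_j to the spans of the Phi_j(y). These frames are
    orthonormal, so |P_j - P_i|^2 = 2 (d - |Phi_i^t Phi_j|^2), and the norm of the average Phi_i^t
    Phi_j is controlled by [orth_average_norm]. *)
Lemma near_Phi i y : U i y -> near_frame (8 / 25) (g0 y) (Phi_frame i y).
Proof.
move=> Ui; split; first by rewrite gram_Phi_self // unitmx1.
pose n := Phi_bound (pou_supp y).
have bn k : frame_bounded n (Phi_frame k y).
  by move=> a m nm; apply: Phi_finite (nm) => //; exact: pou_supp_finite.
have g0E a b : sval (g0 y) a b = \sum_(j <- fset_set (pou_supp y))
    phi j y * \sum_(k < d) Phi phi iota Om j y a k * Phi phi iota Om j y b k.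
  rewrite cl_g0 (supp_fsum (pou_supp_finite y)) // => j /negP; rewrite negbK => /eqP ->.
  by rewrite mul0r.
have bg : mx_bounded n (g0 y).
  move=> a b ab; rewrite g0E big1 // => j _; rewrite big1 ?mulr0 // => k _.
  by case/orP: ab => H; rewrite (Phi_finite _ _ (pou_supp_finite y) _ H) // ?mul0r ?mulr0.
pose F k := frame_trunc n (Phi_frame k y).
have FF k : U k y -> (F k)^T *m F k = 1%:M by move=> Uk; rewrite -gramE // gram_Phi_self.
have PF k : U k y -> frame_proj (F k) = F k *m (F k)^T.
  by move=> Uk; rewrite /frame_proj FF // invmx1 mulmx1.
have gE : mx_trunc n (g0 y) = \sum_(j <- fset_set (pou_supp y)) phi j y *: frame_proj (F j).
  apply/matrixP => a b; rewrite mxE g0E summxE big_seq [RHS]big_seq.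
  apply: eq_bigr => j /supp_fset Uj; rewrite PF // !mxE; congr (_ * _).
  by apply: eq_bigr => k _; rewrite !mxE.
rewrite (frob_distE bg (frame_mx_bounded (bn i))) mx_trunc_frame // gE -/(F i).
have -> : \sum_(j <- fset_set (pou_supp y)) phi j y *: frame_proj (F j) - frame_proj (F i) =
    \sum_(j <- fset_set (pou_supp y)) phi j y *: (frame_proj (F j) - frame_proj (F i)).
  rewrite -[X in _ - X]scale1r -(pou_sum (pou_supp_finite y) (@subset_refl _ _)) scaler_suml -sumrB.
  by apply: eq_bigr => j _; rewrite scalerBr.
have dist j : U j y -> mxnorm (frame_proj (F j) - frame_proj (F i)) <= 63 / 200.
  move=> Uj; have tr : mxip (frame_proj (F j) - frame_proj (F i)) (frame_proj (F j) - frame_proj (F i)) =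
      2 * (d%:R - mxip (gram (Phi_frame i y) (Phi_frame j y)) (gram (Phi_frame i y) (Phi_frame j y))).
    have pp k : U k y -> mxip (frame_proj (F k)) (frame_proj (F k)) = d%:R.
      move=> Uk; rewrite /mxip frame_proj_sym frame_proj_idem ?FF ?unitmx1 //.
      by rewrite frame_proj_trace ?FF ?unitmx1.
    rewrite !mxipE_lin !pp // (mxipC (frame_proj (F i))) (gramE _ (bn i)) -/(F i) -/(F j).
    have -> : mxip (frame_proj (F j)) (frame_proj (F i)) = mxip ((F i)^T *m F j) ((F i)^T *m F j).
      rewrite /mxip frame_proj_sym !PF // trmx_mul trmxK -!mulmxA mxtrace_mulC.
      by rewrite -!mulmxA.
    by ring.
  have := @orth_average_norm _ _ _ _ (fun j => phi j y)
    (fun k => Om i k y *m Om k j y) (Om i j y) (4 / 81) (pou_ge0^~ y)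
    (pou_sum (pou_supp_finite y) (@subset_refl _ _)) (fun k => Phi_orthO Ui Uj)
    (Om_orth Ui Uj) (fun k kS => Om_close Ui (supp_fset kS) Uj).
  rewrite -gram_Phi1 // => H.
  have c0 : 0 <= 63 / 200 :> R by rewrite divr_ge0.
  (* The squared distance is at most 2 * 4/81, which is below (63/200)^2. *)
  rewrite /mxnorm tr -(ger0_norm c0) -sqrtr_sqr ler_sqrt ?sqr_ge0 //.
  move: H; set x := _ - _ => H; apply: (le_trans (ler_wpM2l _ H)) => //; lra.
apply: (@le_lt_trans _ _ (\sum_(j <- fset_set (pou_supp y)) phi j y * (63 / 200))); last first.
  by rewrite -mulr_suml pou_sum ?mul1r //; [lra|exact: pou_supp_finite].
rewrite big_seq [leRHS]big_seq; elim/big_ind2: _ => [|A a A' a' Aa A'a'|j /supp_fset Uj].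
- by rewrite /mxnorm /mxip mulmx0 mxtrace0 sqrtr0.
- exact: le_trans (mxnormD _ _) (lerD Aa A'a').
rewrite /mxnorm mxipZl mxipZr mulrA -expr2 sqrtrM ?sqr_ge0 // sqrtr_sqr ger0_norm ?pou_ge0 //.
by apply: ler_wpM2l; [exact: pou_ge0|exact: dist].
Qed.

Lemma Om_cvg i j y : U i y -> U j y -> Om i j z @[z --> y] --> Om i j y.
Proof.
case: cOm => cO _ _ _ Ui Uj; apply: (within_open_cvg (cO i j)) => //.
by apply: openI; exact: cset_open.
Qed.

(** Against the frame at the fixed point [y], the blocks of the frame at [z] outside the support of
    [phi] at [y] are multiplied by zero. The Gram matrix is therefore a sum over indices independent
    of [z], continuous at [y], where it equals 1. *)
Lemma Phi_sign_near i y : U i y -> \forall z \near y, frame_sign (Phi_frame i y) (Phi_frame i z) = 0.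
Proof.
move=> Ui; pose D := pou_supp y; have fD : finite_set D by exact: pou_supp_finite.
pose G z := \sum_(j <- fset_set D)
  (Num.sqrt (phi j y) * Num.sqrt (phi j z)) *: (Om i j y *m (Om i j z)^T).
have GE z : gram (Phi_frame i y) (Phi_frame i z) = G z.
  pose D' := D `|` pou_supp z; have fD' : finite_set D'.
    by rewrite finite_setU; split => //; exact: pou_supp_finite.
  rewrite (gram_Phi _ _ fD'); [|by left|by right].
  have v j : ~ D j -> (Num.sqrt (phi j y) * Num.sqrt (phi j z)) *:
      (Om i j y *m (Om i j z)^T) = 0.
    by move=> /negP; rewrite negbK => /eqP ->; rewrite sqrtr0 mul0r scale0r.
  by rewrite /G -!(@supp_fsum 'M[R]_d) // => j nD; apply: v => Dj; apply: nD; left.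
have cG : (\det (G z) : R^o) @[z --> y] --> (\det (G y) : R^o).
  apply: (cvg_det (nbhs_filter y)); apply/(cvg_mxP (nbhs_filter y)) => a b.
  have E z : G z a b = \sum_(j <- fset_set D | j \in fset_set D)
      ((Num.sqrt (phi j y) * Num.sqrt (phi j z)) *: (Om i j y *m (Om i j z)^T)) a b.
    by rewrite summxE big_seq.
  rewrite E; under eq_fun do rewrite E.
  apply: (cvg_sum (nbhs_filter y)) => j jD; have Uj := supp_fset jD.
  rewrite mxE; under eq_fun do rewrite mxE.
  apply: (@cvgM R _ _ (nbhs_filter y)).
    apply: (@cvgM R _ _ (nbhs_filter y)); first exact: cvg_cst.
    apply: (@continuous_comp _ _ _ (phi j) (@Num.sqrt R)); last exact: sqrt_continuous.
    by case: pou => cphi _ _ _ _; exact: cphi.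
  have cM : Om i j y *m (Om i j z)^T @[z --> y] --> Om i j y *m (Om i j y)^T.
    apply: (cvg_mulmx (nbhs_filter y)); first exact: cvg_cst.
    by apply: (cvg_trmx (nbhs_filter y)); exact: Om_cvg.
  by move/(cvg_mxP (nbhs_filter y)) : cM; apply.
have H : nbhs (\det (G y) : R^o) [set x | 0 < x].
  by apply: open_nbhs_nbhs; split; [exact: open_gt|rewrite /= -GE gram_Phi_self // det1].
have cH : nbhs y [set z | 0 < \det (G z)] := cG _ H.
apply: filterS cH => z /= z0; rewrite /frame_sign GE /sign_bit ltNge ltW //.
Qed.

(** The cocycle condition is the triple sign formula for the frames Phi_i, Phi_j, Phi_k, all near
    [g0 y]. *)
Lemma det_cochain_cocycle2 : cocycle2 (det_cochain Om).
Proof.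
have n13 k y : U k y -> near_frame (1 / 3) (g0 y) (Phi_frame k y).
  by move=> Uk; apply: near_frame_le (near_Phi Uk); lra.
split=> [i j|i j y [Ui Uj]|i j k y [[Ui Uj] Uk]].
- case: cOm => cO oO _ _; apply: (det_bit_locally_constant _ (cO i j)) => [|y]; last exact: oO.
  by apply: openI; exact: cset_open.
- by rewrite F2_opp -!Phi_sign // frame_signC.
- rewrite -!Phi_sign //; exact: near_frame_triple1 (n13 i y Ui) (n13 j y Uj) (n13 k y Uk).
Qed.

End PhiFrames.

(** * The projective line as a circle *)

Section Circle.
Context (R : realType).

Lemma sum_ord2 (f : 'I_2 -> R) : \sum_i f i = f 0 + f 1.
Proof. by rewrite !big_ord_recl big_ord0 addr0; congr (f _ + f _); apply/val_inj. Qed.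

Lemma forall_ord2 (P : 'I_2 -> Prop) : P 0 -> P 1 -> forall i, P i.
Proof.
move=> P0 P1 [[|[|//]] i2].
  by rewrite (_ : Ordinal i2 = 0) //; apply/val_inj.
by rewrite (_ : Ordinal i2 = 1) //; apply/val_inj.
Qed.

Lemma mul_row2 (v w : 'rV[R]_2) : v *m w^T = (v 0 0 * w 0 0 + v 0 1 * w 0 1)%:M.
Proof.
by apply/matrixP => i j; rewrite !ord1 !mxE sum_ord2 !mxE eqxx mulr1n.
Qed.

Lemma line_mx_Gr (v : 'rV[R]_2) : v *m v^T = 1%:M -> Gr_fin R 1 2 (v^T *m v).
Proof.
move=> v1; split; first by rewrite trmx_mul trmxK.
  by rewrite mulmxA -(mulmxA v^T) v1 mulmx1.
apply/eqP; rewrite eqn_leq (leq_trans (mxrankM_maxr _ _) (rank_leq_row v)) lt0n mxrank_eq0.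
apply/eqP => z; have : v *m (v^T *m v) *m v^T = 1%:M by rewrite mulmxA v1 mul1mx.
by rewrite z mulmx0 mul0mx => /matrixP/(_ 0 0)/eqP; rewrite !mxE eqxx eq_sym oner_eq0.
Qed.

Lemma Gr_lineE (A : 'M[R]_2) : Gr_fin R 1 2 A ->
  exists2 v : 'rV[R]_2, v *m v^T = 1%:M & A = v^T *m v.
Proof.
move=> /Gr_fin_frame[F uF <-].
pose q := (F^T *m F) 0 0.
have Fq : F^T *m F = q%:M by apply/matrixP => i j; rewrite !ord1 [RHS]mxE eqxx mulr1n.
have q0 : 0 < q by have := gram_gt0 uF; rewrite Fq det_scalar1.
exists ((Num.sqrt q)^-1 *: F^T).
  rewrite linearZ /= -scalemxAl -scalemxAr trmxK Fq scalerA -invfM -expr2 sqr_sqrtr ?ltW //.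
  by rewrite -[q%:M]scalemx1 scalerA mulVf ?scale1r // gt_eqF.
rewrite [(_ *: _)^T]linearZ /= trmxK -[RHS]scalemxAl -[X in _ = _ *: X]scalemxAr scalerA -invfM -expr2 sqr_sqrtr ?ltW //.
rewrite /frame_proj Fq (_ : invmx _ = (q^-1)%:M) ?mul_mx_scalar -?scalemxAl //.
by rewrite invmx_scalar.
Qed.

(** The unit vector at angle pi t: over a period of length 1 the vector changes sign while its line
    returns. *)
Definition circle_vec (t : R) : 'rV[R]_2 :=
  \row_i (if i == 0 then cos (pi * t) else sin (pi * t)).

Lemma circle_vec0 t : circle_vec t 0 0 = cos (pi * t).
Proof. by rewrite mxE. Qed.

Lemma circle_vec1 t : circle_vec t 0 1 = sin (pi * t).
Proof. by rewrite mxE. Qed.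

Lemma circle_vecP t : circle_vec t *m (circle_vec t)^T = 1%:M.
Proof. by rewrite mul_row2 circle_vec0 circle_vec1 -!expr2 cos2Dsin2. Qed.

Definition circle (t : R) : Gr_fin R 1 2 :=
  exist _ ((circle_vec t)^T *m circle_vec t) (mem_set (line_mx_Gr (circle_vecP t))).

Lemma circle_vec_continuous : continuous circle_vec.
Proof.
have cpi : continuous (fun t : R => pi * t : R^o).
  by move=> t; apply: (@cvgM R); [exact: cvg_cst|exact: cvg_id].
apply: continuous_mxP => i j.
have -> : (fun x => circle_vec x i j : R^o) =
    if j == 0 then (fun x => cos (pi * x)) else (fun x => sin (pi * x)).
  by apply/funext => x; rewrite mxE; case: ifP.
case: (j == 0) => t.
  by apply: (@continuous_comp _ _ _ (fun t : R => pi * t) (@cos R)); [exact: cpi|exact: continuous_cos].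
by apply: (@continuous_comp _ _ _ (fun t : R => pi * t) (@sin R)); [exact: cpi|exact: continuous_sin].
Qed.

Lemma circle_continuous : continuous circle.
Proof.
apply: continuous_comp_initial => t; apply: cvg_mulmx; last exact: circle_vec_continuous.
by apply: cvg_trmx; exact: circle_vec_continuous.
Qed.

Lemma circle_vecD1 t : circle_vec (t + 1) = - circle_vec t.
Proof.
apply/rowP; apply: forall_ord2; rewrite [RHS]mxE ?circle_vec0 ?circle_vec1 mulrDr mulr1.
  by rewrite cosDpi.
by rewrite sinDpi.
Qed.

Lemma circleD1 t : circle (t + 1) = circle t.
Proof. by apply/val_inj; rewrite /= circle_vecD1 [(- _)^T]linearN /= mulNmx mulmxN opprK. Qed.

(** Evaluated on the unit vector [w] orthogonal to the line at [t], the projections at [s] and at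
    [t] give sin(pi (s - t))^2 and 0. *)
Lemma circle_eq_sin s t : circle s = circle t -> sin (pi * (s - t)) = 0.
Proof.
move=> /(congr1 val)/= E.
pose w : 'rV[R]_2 := \row_i (if i == 0 then - sin (pi * t) else cos (pi * t)).
have w0 : w 0 0 = - sin (pi * t) by rewrite mxE.
have w1 : w 0 1 = cos (pi * t) by rewrite mxE.
have := congr1 (fun A => (w *m A *m w^T) 0 0) E.
rewrite !mulmxA (mul_row2 w (circle_vec s)) (mul_row2 w (circle_vec t)) -!mulmxA.
rewrite (mul_row2 (circle_vec s)) (mul_row2 (circle_vec t)) !circle_vec0 !circle_vec1 w0 w1.
rewrite !mul_scalar_mx !mxE !eqxx !mulr1n mulrBr sinB.
set a := sin (pi * s); set b := cos (pi * s); set c := sin (pi * t); set d := cos (pi * t) => H.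
by apply/eqP; rewrite -sqrf_eq0; apply/eqP; transitivity ((- c * b + d * a) * (b * - c + a * d)); [ring|rewrite H; ring].
Qed.

Lemma sin_pi_eq0 (x : R) : `|x| < 1 -> sin (pi * x) = 0 -> x = 0.
Proof.
rewrite ltr_norml => /andP[x1 x2] sx; have p := pi_gt0 R.
case: (ltgtP x 0) => // x0.
  have : 0 < sin (pi * - x) by apply: sin_gt0_pi; apply/andP; split; nra.
  by rewrite mulrN sinN sx oppr0 ltxx.
have : 0 < sin (pi * x) by apply: sin_gt0_pi; apply/andP; split; nra.
by rewrite sx ltxx.
Qed.

Lemma circle_inj s t : `|s - t| < 1 -> circle s = circle t -> s = t.
Proof. by move=> st /circle_eq_sin/(sin_pi_eq0 st)/eqP; rewrite subr_eq0 => /eqP. Qed.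

(* For A the projection to the line at angle pi t, these are cos(x) sin(x) and cos(x)^2
   for x = pi (t - t0). *)
Definition chart_num (t0 : R) (A : 'M[R]_2) : R :=
  - (cos (pi * t0) * sin (pi * t0)) * A 0 0
  + (cos (pi * t0) ^+ 2 - sin (pi * t0) ^+ 2) * A 0 1 + cos (pi * t0) * sin (pi * t0) * A 1 1.

Definition chart_den (t0 : R) (A : 'M[R]_2) : R :=
  cos (pi * t0) ^+ 2 * A 0 0 + 2 * (cos (pi * t0) * sin (pi * t0)) * A 0 1
  + sin (pi * t0) ^+ 2 * A 1 1.

(** The quotient is tan(pi (t - t0)), so this inverts [circle] on the lines that are not orthogonal
    to the one at angle pi t0. *)
Definition chart (t0 : R) (A : Gr_fin R 1 2) : R :=
  t0 + atan (chart_num t0 (set_val A) / chart_den t0 (set_val A)) / pi.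

(** In coordinates rotated by pi t0 the line is spanned by a unit vector (a, b), and the chart sees
    the slope b / a. The cosine of the recovered angle is a up to sign, which suffices because the
    projection involves only products of two coordinates. *)
Lemma chartK t0 A : chart_den t0 (set_val A) != 0 -> circle (chart t0 A) = A.
Proof.
move=> den; apply/val_inj => /=; rewrite /chart.
have [v v1 Av] := Gr_lineE (set_mem (valP A)).
have {}Av : set_val A = v^T *m v := Av.
move: v1; rewrite mul_row2 => /matrixP/(_ 0 0); rewrite !mxE eqxx !mulr1n.
set x := v 0 0; set y := v 0 1 => xy.
have vv i j : (v^T *m v) i j = v 0 i * v 0 j by rewrite mxE big_ord1 mxE.
suff : (circle_vec (t0 + atan (chart_num t0 (set_val A) / chart_den t0 (set_val A)) / pi))^T *m
  circle_vec (t0 + atan (chart_num t0 (set_val A) / chart_den t0 (set_val A)) / pi) = set_val A by [].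
rewrite Av in den *; move: den; rewrite /chart_num /chart_den !vv -/x -/y.
have := cos2Dsin2 (pi * t0).
set c := cos (pi * t0); set s := sin (pi * t0) => cs.
set a := c * x + s * y; set b := c * y - s * x.
have -> : - (c * s) * (x * x) + (c ^+ 2 - s ^+ 2) * (x * y) + c * s * (y * y) = a * b.
  by rewrite /a /b; ring.
have -> : c ^+ 2 * (x * x) + 2 * (c * s) * (x * y) + s ^+ 2 * (y * y) = a * a.
  by rewrite /a; ring.
move=> aa; have a0 : a != 0 by apply: contraNneq aa => ->; rewrite mul0r.
have ab1 : a ^+ 2 + b ^+ 2 = 1.
  by transitivity ((c ^+ 2 + s ^+ 2) * (x * x + y * y)); [rewrite /a /b; ring|rewrite cs xy mulr1].
have -> : a * b / (a * a) = b / a by field.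
set q := b / a; have qa : q * a = b by rewrite /q mulfVK.
clearbody q; have pi0 : pi != 0 :> R by rewrite gt_eqF // pi_gt0.
have E : pi * (t0 + atan q / pi) = pi * t0 + atan q.
  by rewrite mulrDr mulrCA mulfV // mulr1.
have k0 : cos (atan q) != 0.
  by rewrite gt_eqF // cos_gt0_pihalf // atan_gtNpi2 atan_ltpi2.
have sk : sin (atan q) = q * cos (atan q) by rewrite -{2}(atanK q) /tan mulfVK.
have k2 : cos (atan q) ^+ 2 = a ^+ 2.
  have := cos2Dsin2 (atan q); rewrite sk; set k := cos (atan q) => H.
  have {}H : k ^+ 2 * (a ^+ 2 + b ^+ 2) = a ^+ 2.
    by rewrite -qa -[RHS]mulr1 -H; ring.
  by rewrite -H ab1 mulr1.
have xE : x = c * a - s * b.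
  by rewrite -[LHS]mul1r -cs /a /b; ring.
have yE : y = s * a + c * b.
  by rewrite -[LHS]mul1r -cs /a /b; ring.
have v0 : circle_vec (t0 + atan q / pi) 0 0 = cos (atan q) * (c - s * q).
  by rewrite circle_vec0 E cosD sk -/c -/s; ring.
have v1 : circle_vec (t0 + atan q / pi) 0 1 = cos (atan q) * (s + c * q).
  by rewrite circle_vec1 E sinD sk -/c -/s; ring.
have uu i j : ((circle_vec (t0 + atan q / pi))^T *m circle_vec (t0 + atan q / pi)) i j =
  circle_vec (t0 + atan q / pi) 0 i * circle_vec (t0 + atan q / pi) 0 j.
  by rewrite mxE big_ord1 mxE.
have P X Y : cos (atan q) * X * (cos (atan q) * Y) = (a * X) * (a * Y).
  by transitivity (cos (atan q) ^+ 2 * (X * Y)); [ring|rewrite k2; ring].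
have X1 : a * (c - s * q) = x by rewrite xE -qa; ring.
have Y1 : a * (s + c * q) = y by rewrite yE -qa; ring.
apply/matrixP => i j; rewrite uu vv; move: i j.
by apply: forall_ord2; apply: forall_ord2; rewrite ?v0 ?v1 P ?X1 ?Y1.
Qed.

Lemma chart_bound t0 A : t0 - 2^-1 < chart t0 A < t0 + 2^-1.
Proof.
rewrite /chart; set x := _ / chart_den _ _; have p := pi_gt0 R.
have := atan_gtNpi2 x; have := atan_ltpi2 x => h1 h2.
have pi0 : pi != 0 :> R by rewrite gt_eqF.
apply/andP; split; [rewrite ltrD2l|rewrite ltrD2l].
  by rewrite ltr_pdivlMr // mulNr mulrC.
by rewrite ltr_pdivrMr // mulrC.
Qed.

Lemma Gr_entry_continuous i j :
  continuous (fun A : Gr_fin R 1 2 => (set_val A : 'M[R]_2) i j : R^o).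
Proof.
move=> A; apply: (@continuous_comp _ _ _ (set_val : Gr_fin R 1 2 -> 'M[R]_2)
  (fun M => M i j : R^o)); [exact: initial_continuous|exact: coord_continuous].
Qed.

Lemma chart_den_continuous t0 :
  continuous (fun A : Gr_fin R 1 2 => chart_den t0 (set_val A) : R^o).
Proof.
move=> A; apply: (@cvgD R R^o _ _ (nbhs_filter A)); [apply: (@cvgD R R^o _ _ (nbhs_filter A))|];
  by apply: (@cvgM R _ _ (nbhs_filter A)); [exact: cvg_cst|exact: Gr_entry_continuous].
Qed.

Lemma chart_num_continuous t0 :
  continuous (fun A : Gr_fin R 1 2 => chart_num t0 (set_val A) : R^o).
Proof.
move=> A; apply: (@cvgD R R^o _ _ (nbhs_filter A)); [apply: (@cvgD R R^o _ _ (nbhs_filter A))|];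
  by apply: (@cvgM R _ _ (nbhs_filter A)); [exact: cvg_cst|exact: Gr_entry_continuous].
Qed.

Lemma chart_den_circle t0 : chart_den t0 (set_val (circle t0)) = 1.
Proof.
have vv i j : (set_val (circle t0) : 'M[R]_2) i j = circle_vec t0 0 i * circle_vec t0 0 j.
  by rewrite mxE big_ord1 mxE.
rewrite /chart_den !vv !circle_vec0 !circle_vec1.
transitivity ((cos (pi * t0) ^+ 2 + sin (pi * t0) ^+ 2) ^+ 2); first by ring.
by rewrite cos2Dsin2 expr1n.
Qed.

Lemma chart_circle t0 : chart t0 (circle t0) = t0.
Proof.
apply: circle_inj; last by rewrite chartK // chart_den_circle oner_eq0.
have /andP[h1 h2] := chart_bound t0 (circle t0); rewrite ltr_norml; apply/andP.
have : (2^-1 : R) < 1 by rewrite invf_lt1 ?ltr1n.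
by split; lra.
Qed.

Lemma chart_continuous t0 A : chart_den t0 (set_val A) != 0 -> chart t0 X @[X --> A] --> chart t0 A.
Proof.
move=> den; apply: (@cvgD R R^o _ _ (nbhs_filter A)); first exact: cvg_cst.
apply: (@cvgM R _ _ (nbhs_filter A)); last exact: cvg_cst.
apply: (@continuous_comp _ _ _ (fun X : Gr_fin R 1 2 =>
  chart_num t0 (set_val X) / chart_den t0 (set_val X) : R^o) (@atan R)); last exact: continuous_atan.
apply: (@cvgM R _ _ (nbhs_filter A)); first exact: chart_num_continuous.
by apply: (@cvgV R _ _ (nbhs_filter A)) => //; exact: chart_den_continuous.
Qed.

Lemma chart_den_near t0 : \forall A \near circle t0, chart_den t0 (set_val A) != 0.
Proof.
have H : nbhs (chart_den t0 (set_val (circle t0)) : R^o) [set x | x != 0].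
  by apply: open_nbhs_nbhs; split; [exact: open_neq|rewrite /= chart_den_circle oner_eq0].
exact: (@chart_den_continuous t0 (circle t0) _ H).
Qed.

(** The charts at 0 and 1/2 cover the projective line: a line orthogonal to the first axis is the
    second axis. *)
Lemma circle_surj A : exists t, [/\ 0 <= t, t < 1 & circle t = A].
Proof.
have [t tb tA] : exists2 t, - 1 < t < 1 & circle t = A.
  have h1 : (2^-1 : R) < 1 by rewrite invf_lt1 ?ltr1n.
  have [d0|d0] := eqVneq (chart_den 0 (set_val A)) 0; last first.
    exists (chart 0 A); last exact: chartK.
    by have /andP[? ?] := chart_bound 0 A; apply/andP; split; lra.
  have d1 : chart_den (2^-1) (set_val A) != 0.
    have [v v1 Av] := Gr_lineE (set_mem (valP A)).
    have {}Av : set_val A = v^T *m v := Av.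
    have vv i j : (v^T *m v) i j = v 0 i * v 0 j by rewrite mxE big_ord1 mxE.
    move: v1; rewrite mul_row2 => /matrixP/(_ 0 0); rewrite !mxE eqxx !mulr1n => v1.
    have d0' : v 0 0 * v 0 0 = 0.
      by move: d0; rewrite /chart_den Av !vv mulr0 cos0 sin0; lra.
    apply/eqP; rewrite /chart_den Av !vv sin_pihalf cos_pihalf; lra.
  exists (chart (2^-1) A); last exact: chartK.
  have /andP[] := chart_bound 2^-1 A; rewrite subrr => ? ?; apply/andP; split; first lra.
  by apply: lt_le_trans (_ : 2^-1 + 2^-1 <= _) => //; lra.
have /andP[t1 t2] := tb; have [t0|t0] := leP 0 t; first by exists t.
by exists (t + 1); rewrite circleD1; split=> //; lra.
Qed.

(** The parameter in [0, 1). It jumps at [circle 0], so continuity near that line is always argued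
    through charts. *)
Definition angle (A : Gr_fin R 1 2) : R := sval (cid (circle_surj A)).

Lemma angleP A : [/\ 0 <= angle A, angle A < 1 & circle (angle A) = A].
Proof. exact: (svalP (cid (circle_surj A))). Qed.

Lemma angle_circle t : 0 <= t < 1 -> angle (circle t) = t.
Proof.
move=> /andP[t0 t1]; have [a0 a1 at_] := angleP (circle t).
by apply: circle_inj => //; rewrite ltr_norml; apply/andP; split; lra.
Qed.

Lemma angle_circleN t : -1 <= t < 0 -> angle (circle t) = t + 1.
Proof. by move=> /andP[t0 t1]; rewrite -circleD1 angle_circle //; apply/andP; split; lra. Qed.

Lemma angle_circleD t : 1 <= t < 2 -> angle (circle t) = t - 1.
Proof.
by move=> /andP[t0 t1]; rewrite -{1}(subrK 1 t) circleD1 angle_circle //; apply/andP; split; lra.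
Qed.

End Circle.

(** * Singular cocycles on the projective line *)

Section CircleCocycle.
Context (R : realType) (l : sing R (Gr_fin R 1 2) 1 -> 'F_2) (cl : cobound l = 0).
Hypothesis (l0 : l (path_sing (@circle_continuous R) 0 1) = 0).

Definition circle_potential (t : R) : 'F_2 := l (path_sing (@circle_continuous R) 0 t).

Lemma circle_potentialD1 t : circle_potential (t + 1) = circle_potential t.
Proof.
rewrite /circle_potential -(path_add cl _ 0 1 (t + 1)) l0 add0r; congr l.
apply: path_sing_ext => x y _ _ xy.
have -> : x * 1 + y * (t + 1) = x * 0 + y * t + 1 by rewrite -[X in _ = _ + X]xy; ring.
exact: circleD1.
Qed.

Lemma circle_potential_angle t : -1 <= t < 2 ->
  circle_potential (angle (circle t)) = circle_potential t.
Proof.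
move=> /andP[t1 t2]; have [t0|t0] := ltP t 0.
  by rewrite angle_circleN ?circle_potentialD1 // t1.
have [t3|t3] := ltP t 1; first by rewrite angle_circle // t0.
by rewrite angle_circleD ?t3 // -[in RHS](subrK 1 t) circle_potentialD1.
Qed.

(** As the integral over a period vanishes, the integral along [circle] from 0 is a function on the
    projective line. A short piece of any path lifts through a chart to the line, where
    [path_reparam] replaces it by a straight piece of [circle]. *)
Lemma circle_cocycle_trivial :
  l = cobound (point_cochain (fun A => circle_potential (angle A))).
Proof.
apply: cobound_of_paths => p cp; rewrite /point_cochain /=.
apply: (path_local cl (m := fun t => circle_potential (angle (p t)))) => t t01.
pose t0 := angle (p t); have [a0 a1 pt] := angleP (p t); rewrite -/t0 in a0 a1 pt.
have H : \forall x \near t, chart_den t0 (set_val (p x)) != 0.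
  have := chart_den_near t0; rewrite pt => N.
  exact: (cp t _ N).
have [e e0 pe] := near_closed_ball H.
exists e => // x y x0 xy y1 xt yt.
pose k z := p (clamp_at t e z).
have ck : continuous k.
  by move=> z; apply: (@continuous_comp _ _ _ (clamp_at t e) p); [exact: clamp_at_continuous|exact: cp].
have dk z : chart_den t0 (set_val (k z)) != 0 by apply: pe; exact: clamp_at_near.
pose f z := chart t0 (k z).
have cf : continuous (f : R -> R).
  by move=> z; apply: (@continuous_comp _ _ _ k (chart t0)); [exact: ck|exact: chart_continuous].
have fk z : k z = circle (f z) by rewrite chartK.
have kp z : x <= z <= y -> k z = p z.
  move=> /andP[xz zy]; rewrite /k clamp_at_id // ler_norml.
  by move: xt yt; rewrite !ltr_norml => /andP[? ?] /andP[? ?]; apply/andP; split; lra.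
have -> : path_sing cp x y = path_sing ck x y.
  apply: path_sing_ext => a b ha hb hab; rewrite kp //.
  have -> : a = 1 - b by lra.
  by apply/andP; split; nra.
rewrite (path_reparam cl (@circle_continuous R) ck _ _ cf fk).
rewrite -(kp x) ?lexx // -(kp y) ?lexx ?xy // !fk.
(* The chart stays within 1/2 of [t0], which lies in [0, 1). *)
have fb z : -1 <= f z < 2.
  have /andP[h1 h2] := chart_bound t0 (k z).
  have h3 : (2^-1 : R) < 1 by rewrite invf_lt1 ?ltr1n.
  by rewrite /f; apply/andP; split; lra.
rewrite !circle_potential_angle // /circle_potential.
by rewrite -(path_add cl _ 0 (f x) (f y)) addrA F2_addxx add0r.
Qed.

End CircleCocycle.

(** * The bundle of images of a family of projections *)

Lemma cvg_set_type (S : Type) (F : set_system S) (FF : Filter F) (T : topologicalType)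
    (A : set T) (f : S -> A) (a : A) :
  set_val (f x) @[x --> F] --> set_val a -> f x @[x --> F] --> a.
Proof.
move=> cf W [_ [[D oD <-] Da VW]].
have DF : F [set x | D (set_val (f x))] by apply: (cf D); exact: open_nbhs_nbhs.
suff : F [set x | W (f x)] by [].
by apply: filterS DF => x Dx; exact: VW.
Qed.

Section ProjectionBundle.
Context (R : realType) (X : topologicalType) (N n : nat) (P : X -> 'M[R]_N).
Hypotheses (cP : continuous P) (PP : forall x, P x *m P x = P x)
  (rP : forall x, \rank (P x) = n).

(** In a rank factorization P = C S of an idempotent, cancelling the full-rank factors in C S C S =
    C S leaves S C = 1. Thus c |-> c S and v |-> v C are inverse coordinates on the row image. *)
Lemma proj_factor x : exists CS : 'M[R]_(N, n) * 'M[R]_(n, N),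
  P x = CS.1 *m CS.2 /\ CS.2 *m CS.1 = 1%:M.
Proof.
have [C [S E]] : exists (C : 'M[R]_(N, n)) (S : 'M[R]_(n, N)), P x = C *m S.
  by rewrite -(rP x); exists (col_base (P x)), (row_base (P x)); rewrite mulmx_base.
exists (C, S); split=> //=.
have rS : row_free S.
  by rewrite /row_free eqn_leq rank_leq_row /= -{1}(rP x) E mxrankM_maxr.
have rC : row_free C^T.
  by rewrite /row_free mxrank_tr eqn_leq rank_leq_col /= -{1}(rP x) E mxrankM_maxl.
have H : C *m (S *m C) = C.
  by apply: (row_free_inj rS); rewrite -!mulmxA (mulmxA C S) -E PP.
apply: trmx_inj; apply: (row_free_inj rC); rewrite -trmx_mul H trmx1 mul1mx //.
Qed.

(** The factors are chosen separately at each point; only their product [P x] varies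
    continuously. *)
Definition proj_coef x := (sval (cid (proj_factor x))).1.
Definition proj_frame x := (sval (cid (proj_factor x))).2.
Local Notation C := proj_coef.
Local Notation S := proj_frame.

Let PE x : P x = C x *m S x.
Proof. by case: (svalP (cid (proj_factor x))). Qed.

Lemma proj_frame_coef x : S x *m C x = 1%:M.
Proof. by case: (svalP (cid (proj_factor x))). Qed.
Let SC := proj_frame_coef.

Let SP x : S x *m P x = S x.
Proof. by rewrite PE mulmxA SC mul1mx. Qed.

Definition proj_total : set (X * 'rV[R]_N) := [set p | p.2 *m P p.1 = p.2].

Definition proj_base (p : proj_total) : X := (set_val p).1.

Lemma proj_vincl_subproof x (c : 'rV[R]_n) : proj_total (x, c *m S x).
Proof. by rewrite /proj_total /= -mulmxA SP. Qed.

Definition proj_vincl x (c : 'rV[R]_n) : proj_total :=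
  exist _ (x, c *m S x) (mem_set (proj_vincl_subproof x c)).

Lemma proj_base_continuous : continuous proj_base.
Proof.
move=> p; apply: (@continuous_comp _ _ _ (set_val : proj_total -> X * 'rV[R]_N) fst).
  exact: initial_continuous.
exact: cvg_fst.
Qed.

Lemma proj_vincl_inj x : injective (@proj_vincl x).
Proof.
move=> c c' /(congr1 (fun p : proj_total => (set_val p).2 *m C x)) /=.
by rewrite -!mulmxA SC !mulmx1.
Qed.

Lemma proj_coefK x (v : 'rV[R]_N) : v *m P x = v -> v *m C x *m S x = v.
Proof. by rewrite -mulmxA -PE. Qed.

Lemma proj_vinclP x (c : 'rV[R]_n) : c *m S x *m P x = c *m S x.
Proof. by rewrite -mulmxA SP. Qed.

Lemma proj_vincl_range x : range (@proj_vincl x) = proj_base @^-1` [set x].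
Proof.
apply/seteqP; split=> [_ [c _ <-] //|p /= px].
exists ((set_val p).2 *m C x) => //; apply/val_inj => /=.
case: p px => -[y v] vP /= px; have {}px : y = x := px.
by have := set_mem vP; rewrite /proj_total /= px -mulmxA -PE => ->.
Qed.

(** Near [x0] the coordinates are v |-> v C(x0), with inverse c |-> c M(y)^-1 S(x0) P(y) where M(y)
    = S(x0) P(y) C(x0) is 1 at [x0]. The arbitrary factors at y enter only through their product. *)
Lemma proj_trivial x0 : exists (U : set X)
    (h : X -> {linear 'rV[R]_n -> 'rV[R]_n}) (k : proj_total -> 'rV[R]_n),
  [/\ open U, U x0,
      forall y, U y -> cancel (h y) (k \o @proj_vincl y) /\ cancel (k \o @proj_vincl y) (h y),
      {within U `*` [set: 'rV[R]_n], continuous (fun p => proj_vincl p.1 (h p.1 p.2))} &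
      {within proj_base @^-1` U, continuous k}].
Proof.
pose M y := S x0 *m P y *m C x0.
have cM : continuous M.
  move=> y; apply: (cvg_mulmx (nbhs_filter y)); last exact: cvg_cst.
  by apply: (cvg_mulmx (nbhs_filter y)); [exact: cvg_cst|exact: cP].
pose A y := invmx (M y) *m S x0 *m P y *m C y.
have AS y : A y *m S y = invmx (M y) *m S x0 *m P y.
  by rewrite /A -mulmxA -PE -mulmxA PP.
clearbody A.
exists [set y | M y \in unitmx], (fun y => mulmxr (A y)), (fun p => (set_val p).2 *m C x0).
split.
- rewrite (_ : [set y | _] = (fun y => \det (M y) : R^o) @^-1` [set x | x != 0]).
    apply: open_comp; last exact: open_neq.
    by move=> y _; apply: (cvg_det (nbhs_filter y)); exact: cM.
  by apply/seteqP; split=> y /=; rewrite unitmxE unitfE.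
- by rewrite /= /M SP SC unitmx1.
- move=> y /= uM.
  have H : A y *m (S y *m C x0) = 1%:M.
    by rewrite mulmxA AS -(mulmxA (invmx (M y)) (S x0) (P y)) -mulmxA -/(M y) mulVmx.
  split=> c /=; first by rewrite -!mulmxA H mulmx1.
  by rewrite -!mulmxA (mulmxA (S y)) (mulmx1C H) mulmx1.
- apply/subspace_continuousP => -[y c] [/= uM _].
  suff : proj_vincl q.1 (mulmxr (A q.1) q.2) @[q --> (y, c)] --> proj_vincl y (mulmxr (A y) c).
    exact: (@cvg_within_filter _ _ _ (nbhs (y, c)) (nbhs_filter _)).
  apply: (@cvg_set_type _ _ (nbhs_filter (y, c)) _ proj_total
    (fun q : X * 'rV[R]_n => proj_vincl q.1 (mulmxr (A q.1) q.2))) => /=.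
  have H1 : (q : X * 'rV[R]_n).1 @[q --> (y, c)] --> y by exact: cvg_fst.
  suff H2 : (q : X * 'rV[R]_n).2 *m A q.1 *m S q.1 @[q --> (y, c)] --> c *m A y *m S y.
    exact: (cvg_pair H1 H2).
  rewrite -mulmxA AS; under eq_fun do rewrite -mulmxA AS.
  have c1 : P (q : X * 'rV[R]_n).1 @[q --> (y, c)] --> P y.
    by apply: (@continuous_comp _ _ _ fst P (y, c)); [exact: cvg_fst|exact: cP].
  have c2 : M (q : X * 'rV[R]_n).1 @[q --> (y, c)] --> M y.
    by apply: (@continuous_comp _ _ _ fst M (y, c)); [exact: cvg_fst|exact: cM].
  apply: (cvg_mulmx (nbhs_filter (y, c))); first exact: cvg_snd.
  apply: (cvg_mulmx (nbhs_filter (y, c))); last exact: c1.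
  apply: (cvg_mulmx (nbhs_filter (y, c))); last exact: cvg_cst.
  exact: (cvg_invmx (nbhs_filter (y, c))).
- apply: continuous_subspaceT => p; apply: (cvg_mulmx (nbhs_filter p)); last exact: cvg_cst.
  apply: (@continuous_comp _ _ _ (set_val : proj_total -> X * 'rV[R]_N) snd).
    exact: initial_continuous.
  exact: cvg_snd.
Qed.

Definition proj_bundle : vbundle R X n :=
  @VBundle R X n proj_total proj_base (fun=> 'rV[R]_n) proj_vincl proj_base_continuous
    proj_vincl_inj proj_vincl_range proj_trivial.

(** The rows of [T] are an orthonormal basis of the fibre, so v |-> v T^t is a coordinate on it; T
    C(x) inverts the change of coordinates S(x) T^t. *)
Lemma proj_vincl_frame x (T : 'M[R]_(n, N)) : T *m P x = T -> T *m T^T = 1%:M -> (P x)^T = P x ->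
  exists2 Q : 'M[R]_n, Q \in unitmx & forall c, (set_val (proj_vincl x c)).2 *m T^T = c *m Q.
Proof.
move=> TP TT Ps; exists (S x *m T^T); last by move=> c; rewrite /= mulmxA.
have H : (T *m C x) *m (S x *m T^T) = 1%:M by rewrite mulmxA -(mulmxA T) -PE TP.
by case/mulmx1_unit : H.
Qed.

End ProjectionBundle.

(** * Frames of a vector bundle along paths and loops *)

Section BundleFrames.
Context (R : realType) (X : topologicalType) (n : nat) (E : vbundle R X n).

Definition bundle_frame (x : X) (f : 'rV[R]_n -> vtotal E) :=
  exists l : {linear 'rV[R]_n -> vfib E x}, bijective l /\ forall c, f c = vincl (l c).

Lemma bundle_frame_mul x f (A : 'M[R]_n) : A \in unitmx -> bundle_frame x f ->
  bundle_frame x (fun c => f (c *m A)).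
Proof.
move=> uA [l [bl fl]]; exists (l \o mulmxr A); split; last by move=> c; rewrite fl.
apply: bij_comp => //; exists (mulmxr (invmx A)) => c /=; first by rewrite mulmxK.
by rewrite mulmxKV.
Qed.

Lemma bundle_frame_change x f g : bundle_frame x f -> bundle_frame x g ->
  exists2 A : 'M[R]_n, A \in unitmx & forall c, g c = f (c *m A).
Proof.
move=> [l [[l' lK l'K] fl]] [k [bk gk]].
pose A : 'M[R]_n := \matrix_(i, j) l' (k (delta_mx 0 i)) 0 j.
have lA c : l (c *m A) = k c.
  rewrite mulmx_sum_row linear_sum [in RHS](row_sum_delta c) linear_sum; apply: eq_bigr => i _.
  rewrite !linearZ; congr (_ *: _); rewrite -[RHS]l'K; congr (l _).
  by apply/rowP => j; rewrite !mxE.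
exists A; last by move=> c; rewrite gk fl lA.
rewrite -row_free_unit -kermx_eq0; apply: contraT => /rowV0Pn[v /sub_kermxP vA].
apply: contraNT => _; apply/eqP/(bij_inj bk).
by rewrite -lA vA !linear0.
Qed.

(** Interval induction on the existence of a frame. Locally a trivialization is composed with the
    clamped path; two frames are glued at [y] after correcting the second by the constant change of
    frame there. *)
Lemma path_frame (h : R -> X) : continuous h ->
  exists2 G : R * 'rV[R]_n -> vtotal E, continuous G &
    forall t, 0 <= t <= 1 -> bundle_frame (h t) (fun c => G (t, c)).
Proof.
move=> ch; apply: (interval_ind (P := fun a b => exists2 G : R * 'rV[R]_n -> vtotal E,
  continuous G & forall t, a <= t <= b -> bundle_frame (h t) (fun c => G (t, c)))) => //.
- move=> t t01; have [U [k [k' [oU Uh kK ck ck']]]] := vbundle_trivial E (h t).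
  have H : \forall x \near t, U (h x) by apply: (ch t U); exact: open_nbhs_nbhs.
  have [e e0 Ue] := near_closed_ball H.
  exists e => // x y x0 xy y1 xt yt.
  exists (fun p => vincl (k (h (clamp_at t e p.1)) p.2)).
    move=> [z c]; have Uz : U (h (clamp_at t e z)) by apply: Ue; exact: clamp_at_near.
    have oUT : open (U `*` [set: 'rV[R]_n]).
      rewrite (_ : _ `*` _ = fst @^-1` U); first by apply: open_comp => // p _; exact: cvg_fst.
      by apply/seteqP; split=> p /= => [[]|].
    move: ck; rewrite continuous_open_subspace // => /(_ (h (clamp_at t e z), c)).
    move=> /(_ (mem_set (conj Uz I))) cc.
    apply: (@continuous_comp _ _ _ (fun p : R * 'rV[R]_n => (h (clamp_at t e p.1), p.2))
      (fun p : X * 'rV[R]_n => vincl (k p.1 p.2)) (z, c)); last exact: cc.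
    have H1 : h (clamp_at t e (p : R * 'rV[R]_n).1) @[p --> (z, c)] --> h (clamp_at t e z).
      apply: (@continuous_comp _ _ _ fst (h \o clamp_at t e) (z, c)); first exact: cvg_fst.
      by apply: (@continuous_comp _ _ _ (clamp_at t e) h); [exact: clamp_at_continuous|exact: ch].
    have H2 : (p : R * 'rV[R]_n).2 @[p --> (z, c)] --> c by exact: cvg_snd.
    exact: (cvg_pair H1 H2).
  move=> z /andP[xz zy].
  have ze : `|z - t| <= e.
    rewrite ler_norml; move: xt yt; rewrite !ltr_norml => /andP[? ?] /andP[? ?].
    by apply/andP; split; lra.
  exists (k (h z)); split; last by move=> c; rewrite /= clamp_at_id.
  by have [k1 k2] := kK _ (Ue z ze); exists (k' \o vincl (x := h z)).
- move=> x y z /andP[xy yz] [G1 cG1 fG1] [G2 cG2 fG2].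
  have [||A uA GA] := @bundle_frame_change (h y) (fun c => G2 (y, c)) (fun c => G1 (y, c)).
  + by apply: fG2; rewrite lexx.
  + by apply: fG1; rewrite lexx xy.
  exists (fun p => if p.1 <= y then G1 p else G2 (p.1, p.2 *m A)).
    apply: (@glue_continuous R) => //.
    + by move=> p; exact: cvg_fst.
    + move=> [t c]; apply: (@continuous_comp _ _ _ (fun p : R * 'rV[R]_n => (p.1, p.2 *m A)) G2 (t, c)); last exact: cG2.
      have H1 : (p : R * 'rV[R]_n).1 @[p --> (t, c)] --> t by exact: cvg_fst.
      have H2 : (p : R * 'rV[R]_n).2 *m A @[p --> (t, c)] --> c *m A.
        by apply: (cvg_mulmx (nbhs_filter (t, c))); [exact: cvg_snd|exact: cvg_cst].
      exact: (cvg_pair H1 H2).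
    + by move=> [t c] /= ->; exact: GA.
  move=> t /andP[xt tz] /=; case: (boolP (t <= y)) => ty; first by apply: fG1; rewrite xt.
  by apply: (@bundle_frame_mul (h t) (fun c => G2 (t, c)) A uA); apply: fG2; rewrite tz ltW // ltNge.
Qed.

End BundleFrames.

Section LoopFrames.
Context (R : realType) (X : topologicalType) (m : nat) (E : vbundle R X m.+1)
  (h : R -> X) (ch : continuous h) (h01 : h 0 = h 1).

Lemma flip0K b : flip0 R m b *m flip0 R m b = 1%:M.
Proof.
apply/matrixP => i j; rewrite !mxE (bigD1 i) //= big1 ?addr0; last first.
  by move=> k ki; rewrite !mxE eq_sym (negbTE ki) !mul0r.
rewrite !mxE eqxx mul1r mulrCA; case: ifP => _; rewrite ?mulrNN !mulr1 //.
Qed.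

(** If the path frame closes up with the matrix [A], multiplying it by p(t) A^-1, where [p] joins
    [A] to the reflection or to 1, leaves it unchanged at 0 and replaces [A] by the end of [p]. *)
Lemma loop_frame : exists b (G : R * 'rV[R]_m.+1 -> vtotal E),
  [/\ continuous G, forall t, 0 <= t <= 1 -> bundle_frame (h t) (fun c => G (t, c)) &
      forall c, G (1, c) = G (0, c *m flip0 R m b)].
Proof.
have [G cG fG] := path_frame E ch.
have f0 : bundle_frame (h 0) (fun c => G (0, c)) by apply: fG; rewrite lexx ler01.
have f1 : bundle_frame (h 0) (fun c => G (1, c)) by rewrite h01; apply: fG; rewrite lexx ler01.
have [A uA GA] := bundle_frame_change f0 f1.
have [b [p [cp p0 p1 up]]] := GL_path_to_flip uA.
exists b, (fun q => G (q.1, q.2 *m (p q.1 *m invmx A))); split.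
- move=> [t c]; apply: (@continuous_comp _ _ _
    (fun q : R * 'rV[R]_m.+1 => (q.1, q.2 *m (p q.1 *m invmx A))) G (t, c)); last exact: cG.
  have H1 : (q : R * 'rV[R]_m.+1).1 @[q --> (t, c)] --> t by exact: cvg_fst.
  have H2 : (q : R * 'rV[R]_m.+1).2 *m (p q.1 *m invmx A) @[q --> (t, c)] --> c *m (p t *m invmx A).
    apply: (cvg_mulmx (nbhs_filter (t, c))); first exact: cvg_snd.
    apply: (cvg_mulmx (nbhs_filter (t, c))); last exact: cvg_cst.
    by apply: (@continuous_comp _ _ _ fst p (t, c)); [exact: cvg_fst|exact: cp].
  exact: (cvg_pair H1 H2).
- move=> t t01 /=; apply: (@bundle_frame_mul _ _ _ _ (h t) (fun c => G (t, c)) (p t *m invmx A)).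
    by rewrite unitmx_mul up unitmx_inv.
  exact: fG.
- by move=> c /=; rewrite p0 p1 mulmxV // mulmx1 GA -!mulmxA mulVmx // mulmx1.
Qed.

End LoopFrames.

(** * Model bundles over the projective line *)

Section TwistedBundle.
Context (R : realType) (m : nat) (b : bool).
Local Notation C := (Gr_fin R 1 2).

(** The tautological line or a constant line, so that the orientable and the nonorientable model
    share one construction. *)
Definition twisted_line (A : C) : 'M[R]_2 := set_val (if b then A else circle (0 : R)).

Definition twisted_proj (A : C) : 'M[R]_(2 + m) := block_mx (twisted_line A) 0 0 1%:M.

Lemma cvg_block (T : Type) (F : set_system T) (FF : Filter F) (f : T -> 'M[R]_2) A :
  f x @[x --> F] --> A ->
  (block_mx (f x) 0 0 1%:M : 'M[R]_(2 + m)) @[x --> F] --> block_mx A 0 0 1%:M.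
Proof.
move=> /cvg_mxP fA; apply/cvg_mxP => i j.
case: (split_ordP i) => i' ->; case: (split_ordP j) => j' ->;
  rewrite ?block_mxEul ?block_mxEur ?block_mxEdl ?block_mxEdr;
  under eq_fun do rewrite ?block_mxEul ?block_mxEur ?block_mxEdl ?block_mxEdr;
  by [exact: fA|exact: cvg_cst].
Qed.

Lemma twisted_line_continuous : continuous twisted_line.
Proof.
rewrite /twisted_line; case: b; first exact: initial_continuous.
exact: (@cst_continuous C 'M[R]_2 (set_val (circle 0))).
Qed.

Lemma twisted_proj_continuous : continuous twisted_proj.
Proof. by move=> A; apply: (cvg_block (nbhs_filter A)); exact: twisted_line_continuous. Qed.

Lemma twisted_lineP A : Gr_fin R 1 2 (twisted_line A).
Proof. exact: (set_mem (valP (if b then A else circle (0 : R)))). Qed.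

Lemma twisted_proj_idem A : twisted_proj A *m twisted_proj A = twisted_proj A.
Proof.
have [_ PP _] := twisted_lineP A.
by rewrite /twisted_proj mulmx_block !mulmx0 !mul0mx !mulmx1 !addr0 !add0r -PP.
Qed.

Lemma twisted_proj_rank A : \rank (twisted_proj A) = m.+1.
Proof. by have [_ _ rP] := twisted_lineP A; rewrite /twisted_proj rank_diag_block_mx rP mxrank1. Qed.

Lemma twisted_proj_tr A : (twisted_proj A)^T = twisted_proj A.
Proof.
have [Ps _ _] := twisted_lineP A.
by rewrite /twisted_proj tr_block_mx !trmx0 trmx1 -Ps.
Qed.

Definition twisted_bundle : vbundle R C m.+1 :=
  proj_bundle twisted_proj_continuous twisted_proj_idem twisted_proj_rank.

Definition twisted_frame (t : R) : 'M[R]_(1 + m, 2 + m) :=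
  block_mx (circle_vec (if b then t else 0)) 0 0 1%:M.

(** After a period the frame closes up with the same matrix as the frame of [loop_frame]; this is
    what allows the two to be matched. *)
Lemma twisted_frameD1 t : twisted_frame (t + 1) = (flip0 R m b : 'M[R]_(1 + m)) *m twisted_frame t.
Proof.
have -> : (flip0 R m b : 'M[R]_(1 + m)) = block_mx (if b then -1 else 1)%:M 0 0 1%:M.
  apply/matrixP => i j; case: (split_ordP i) => i' ->; case: (split_ordP j) => j' ->;
    rewrite ?block_mxEul ?block_mxEur ?block_mxEdl ?block_mxEdr !mxE.
  - by rewrite !ord1 !eqxx mul1r andbT mulr1n.
  - by rewrite (_ : (_ == _) = false) ?mul0r //; apply/eqP => /(congr1 val); rewrite /= ord1.
  - by rewrite (_ : (_ == _) = false) ?mul0r //; apply/eqP => /(congr1 val); rewrite /= ord1.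
  - rewrite (_ : (rshift 1 i' == ord0) = false) ?andbF ?mulr1.
      by congr ((nat_of_bool _)%:R); apply/eqP/eqP => [/rshift_inj|->].
    by apply/eqP => /(congr1 val).
rewrite /twisted_frame mulmx_block !mulmx0 !mul0mx !mulmx1 !addr0 !add0r mul_scalar_mx.
by case: b; rewrite ?circle_vecD1 ?scaleN1r ?scale1r.
Qed.

Lemma twisted_frame_orth t : twisted_frame t *m (twisted_frame t)^T = 1%:M.
Proof.
rewrite /twisted_frame tr_block_mx !trmx0 trmx1 mulmx_block !mulmx0 !mul0mx !mulmx1 !addr0 !add0r.
by rewrite circle_vecP -scalar_mx_block.
Qed.

Lemma twisted_frame_proj t : twisted_frame t *m twisted_proj (circle t) = twisted_frame t.
Proof.
rewrite /twisted_frame /twisted_proj mulmx_block !mulmx0 !mul0mx !mulmx1 !addr0 !add0r.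
congr (block_mx _ _ _ _); rewrite /twisted_line.
by case: b; rewrite /= mulmxA circle_vecP mul1mx.
Qed.

Lemma twisted_frame_continuous : continuous twisted_frame.
Proof.
have cl : continuous (fun t => circle_vec (if b then t else 0) : 'rV[R]_2).
  by case: b => t; [exact: circle_vec_continuous|exact: cvg_cst].
move=> t; apply/cvg_mxP => i j; move/cvg_mxP : (cl t) => clt.
case: (split_ordP i) => i' ->; case: (split_ordP j) => j' ->;
  rewrite ?block_mxEul ?block_mxEur ?block_mxEdl ?block_mxEdr;
  under eq_fun do rewrite ?block_mxEul ?block_mxEur ?block_mxEdl ?block_mxEdr;
  by [exact: clt|exact: cvg_cst].
Qed.

End TwistedBundle.

(** * Representatives of singular cohomology classes *)

Section CohomologyClasses.
Context (R : realType) (X : topologicalType).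

Lemma restr_comp k m n (th : 'I_k.+1 -> 'I_m.+1) (th' : 'I_m.+1 -> 'I_n.+1) (s : sing R X n) :
  restr th (restr th' s) = restr (th' \o th) s.
Proof.
apply/continuousEP => t.
change (s (vertex_map th' (vertex_map th t)) = s (vertex_map (th' \o th) t)).
congr (s _); apply/val_inj/rowP => i /=; rewrite !mxE.
rewrite [RHS](partition_big th (fun j => th' j == i)) //=.
apply: eq_bigr => j /eqP <-; rewrite mxE; apply: eq_bigl => a.
by case: eqP => [->|_]; rewrite ?eqxx ?andbF.
Qed.

(** Each vertex of the triangle lies on two of its edges. *)
Lemma cobound_cobound0 (m : sing R X 0 -> 'F_2) : cobound (cobound m) = 0.
Proof.
apply/funext => t; rewrite /cobound !big_ord_recl !big_ord0 !addr0 !restr_comp.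
pose v k := m (restr (fun _ : 'I_1 => k : 'I_3) t).
have e (th : 'I_1 -> 'I_3) k : th ord0 = k -> m (restr th t) = v k.
  by move=> <-; congr (m (restr _ t)); apply/funext => i; rewrite ord1.
rewrite (e _ (@Ordinal 3 2 isT)); last exact/val_inj.
rewrite (e _ (@Ordinal 3 1 isT)); last exact/val_inj.
rewrite (e _ (@Ordinal 3 2 isT)); last exact/val_inj.
rewrite (e _ (@Ordinal 3 0 isT)); last exact/val_inj.
rewrite (e _ (@Ordinal 3 1 isT)); last exact/val_inj.
rewrite (e _ (@Ordinal 3 0 isT)); last exact/val_inj.
set a := v _; set b := v _; set c := v _.
by rewrite [a + c + _]addrACA F2_addxx addr0 F2_addxx.
Qed.

Implicit Types (K : cohomology R X 1) (c : sing R X 1 -> 'F_2).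

Lemma cobound_add (m m' : sing R X 0 -> 'F_2) : cobound (m + m') = cobound m + cobound m'.
Proof. by apply/funext => t; rewrite /cobound big_split. Qed.

Lemma class_exists n (A : cohomology R X n) : exists a, sval A a.
Proof.
have [a [_ ->]] := svalP A; exists a; rewrite /= subrr.
case: n a {A} => [//|n] a; exists 0 => //.
by apply/funext => t; rewrite /cobound big1.
Qed.

Lemma class_cocycle K c : sval K c -> cobound c = 0.
Proof.
have [c0 [cc0 ->]] := svalP K => -[m _ mE].
have -> : c = cobound m + c0 by rewrite mE subrK.
apply/funext => t; rewrite /cobound /= big_split /=.
have := congr1 (fun f => f t) (cobound_cobound0 m); have := congr1 (fun f => f t) cc0.
by rewrite /cobound /= => -> ->; rewrite addr0.
Qed.

Lemma class_diff K c c' : sval K c -> sval K c' -> exists m, c' = c + cobound m.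
Proof.
have [c0 [cc0 ->]] := svalP K => -[m _ mE] [m' _ mE'].
exists (m + m'); rewrite cobound_add mE mE'; apply/funext => t /=.
have e (x y z : 'F_2) : z = x + ((x - y) + (z - y)).
  by rewrite !F2_opp addrACA F2_addxx addr0 addrA F2_addxx add0r.
exact: e.
Qed.

Lemma class_add K c m : sval K c -> sval K (c + cobound m).
Proof.
have [c0 [cc0 ->]] := svalP K => -[m' _ mE].
by exists (m' + m) => //; rewrite cobound_add mE addrAC.
Qed.

Lemma class_loop K c c' (h : R -> X) (ch : continuous h) : h 0 = h 1 -> sval K c -> sval K c' ->
  c (path_sing ch 0 1) = c' (path_sing ch 0 1).
Proof.
move=> h01 Kc /(class_diff Kc)[m ->].
have -> : (c + cobound m) (path_sing ch 0 1) = c (path_sing ch 0 1) + cobound m (path_sing ch 0 1) by [].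
by rewrite cobound_path h01 F2_addxx addr0.
Qed.

End CohomologyClasses.

(** * The first Stiefel-Whitney class of the model bundles *)

Section TwistedClass.
Context (R : realType) (w : stiefel_whitney R).
Local Notation C := (Gr_fin R 1 2).
Local Notation loop := (path_sing (@circle_continuous R) 0 1).

Lemma circle01 : circle 0 = circle (1 : R).
Proof. by rewrite -[in RHS](add0r 1) circleD1. Qed.

(** A bundle map from [E] to itself over a constant map makes the class, by naturality, a pullback
    along that map, and the image of the loop is a constant edge. *)
Lemma constant_bundle_class n (E : vbundle R C n) (g : vtotal E -> vtotal E) (c : sing R C 1 -> 'F_2) :
  bundle_map (fun=> circle 0) g -> sval (sw w E 1) c -> c loop = 0.
Proof.
move=> bg Ec; pose f : continuousType C C := mkcts (@cst_continuous C C (circle 0)).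
have bg' : bundle_map f g by [].
have Ec' := sw_natural bg' Ec.
rewrite (class_loop (@circle_continuous R) circle01 Ec Ec').
have -> : pullback f c loop = c (cst (circle 0) : sing R C 1).
  by congr c; apply/continuousEP.
exact: (cst_sing0 (class_cocycle Ec)).
Qed.

Section ConstantProjection.
Context (N n : nat) (P : C -> 'M[R]_N) (cP : continuous P)
  (PP : forall x, P x *m P x = P x) (rP : forall x, \rank (P x) = n)
  (Pc : forall x, P x = P (circle 0)).

Lemma constant_proj_bundle_map : exists g : vtotal (proj_bundle cP PP rP) -> vtotal (proj_bundle cP PP rP),
  bundle_map (fun=> circle 0) g.
Proof.
have tot (p : proj_total P) : proj_total P (circle 0, (set_val p).2).
  by have := set_mem (valP p); rewrite /proj_total /= (Pc (sval p).1).
exists (fun p : proj_total P => exist _ (circle 0, (set_val p).2) (mem_set (tot p))); split.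
  apply: continuous_comp_initial => p.
  have H2 : (set_val (q : proj_total P)).2 @[q --> p] --> (set_val p).2.
    apply: (@continuous_comp _ _ _ (set_val : proj_total P -> C * 'rV[R]_N) snd).
      exact: initial_continuous.
    exact: cvg_snd.
  exact: (cvg_pair (@cst_continuous (proj_total P) C (circle 0) p) H2).
have H x y (c : 'rV[R]_n) : c *m proj_frame PP rP x *m P y = c *m proj_frame PP rP x.
  by rewrite (Pc y) -(Pc x) proj_vinclP.
move=> x; exists (mulmxr (proj_frame PP rP x *m proj_coef PP rP (circle 0))); split.
  exists (mulmxr (proj_frame PP rP (circle 0) *m proj_coef PP rP x)) => c /=.
    by rewrite !mulmxA (proj_coefK PP rP (H _ _ _)) -mulmxA proj_frame_coef mulmx1.
  by rewrite !mulmxA (proj_coefK PP rP (H _ _ _)) -mulmxA proj_frame_coef mulmx1.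
move=> c; apply/val_inj => /=; congr (_, _).
by rewrite !mulmxA (proj_coefK PP rP (H _ _ _)).
Qed.

Lemma constant_proj_class c : sval (sw w (proj_bundle cP PP rP) 1) c -> c loop = 0.
Proof. by have [g bg] := constant_proj_bundle_map; exact: constant_bundle_class bg. Qed.

End ConstantProjection.
End TwistedClass.

Section TautologicalClass.
Context (R : realType) (w : stiefel_whitney R).
Local Notation C := (Gr_fin R 1 2).
Local Notation loop := (path_sing (@circle_continuous R) 0 1).

Definition taut_proj (A : C) : 'M[R]_2 := set_val A.

Lemma taut_projP A : Gr_fin R 1 2 (taut_proj A).
Proof. exact: (set_mem (valP A)). Qed.

Lemma taut_proj_continuous : continuous taut_proj.
Proof. exact: initial_continuous. Qed.

Lemma taut_proj_idem A : taut_proj A *m taut_proj A = taut_proj A.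
Proof. by have [_ <- _] := taut_projP A. Qed.

Lemma taut_proj_rank A : \rank (taut_proj A) = 1%N.
Proof. by have [_ _ ->] := taut_projP A. Qed.

Lemma taut_proj_tr A : (taut_proj A)^T = taut_proj A.
Proof. by have [<- _ _] := taut_projP A. Qed.

Definition taut_bundle : vbundle R C 1 :=
  proj_bundle taut_proj_continuous taut_proj_idem taut_proj_rank.

Lemma taut_bundleP : tautological_line taut_bundle.
Proof.
exists (fun p : proj_total taut_proj => (set_val p).2^T); split.
  move=> p; apply: (cvg_trmx (nbhs_filter p)).
  apply: (@continuous_comp _ _ _ (set_val : proj_total taut_proj -> C * 'rV[R]_2) snd).
    exact: initial_continuous.
  exact: cvg_snd.
move=> A; pose S := proj_frame taut_proj_idem taut_proj_rank A.
pose D := proj_coef taut_proj_idem taut_proj_rank A.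
exists (trmx \o mulmxr S); split=> //.
  move=> c c' /= /trmx_inj/(congr1 (mulmx^~ D)).
  by rewrite -!mulmxA proj_frame_coef !mulmx1.
apply/seteqP; split=> [_ [c _ <-]|_ [v _ <-]] /=.
  exists (c *m S)^T => //.
  by rewrite -[set_val A]taut_proj_tr -trmx_mul proj_vinclP.
exists (v^T *m taut_proj A *m D) => //=.
rewrite (proj_coefK taut_proj_idem taut_proj_rank) ?trmx_mul ?trmxK ?taut_proj_tr //.
by rewrite -mulmxA taut_proj_idem.
Qed.

(* A class that vanishes on [loop] is the coboundary of its integral along the circle, which
   the axiom on the tautological line excludes. *)
Lemma taut_class l : sval (sw w taut_bundle 1) l -> l loop = 1.
Proof.
move=> Kl; have [l0|l1] := eqVneq (l loop) 0; last first.
  by case: (l loop) l1 => [[|[|//]] i] // _; exact/val_inj.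
have /(circle_cocycle_trivial (class_cocycle Kl)) E := l0.
case: (@sw_tautological _ w taut_bundle taut_bundleP).
have -> : (0 : sing R C 1 -> 'F_2) = l + l by apply/funext => t; exact/esym/F2_addxx.
by rewrite {2}E; exact: class_add.
Qed.

Context (m : nat).

Lemma unit_proj_rank (A : C) : \rank (1%:M : 'M[R]_m) = m.
Proof. exact: mxrank1. Qed.

Lemma unit_proj_idem (A : C) : (1%:M : 'M[R]_m) *m 1%:M = 1%:M.
Proof. exact: mulmx1. Qed.

Definition trivial_bundle : vbundle R C m :=
  proj_bundle (P := fun=> 1%:M) (@cst_continuous C 'M[R]_m 1%:M) unit_proj_idem unit_proj_rank.

Lemma twisted_whitney : whitney_sum taut_bundle trivial_bundle (twisted_bundle R m true).
Proof.
have tot (p : proj_total taut_proj * proj_total (fun _ : C => 1%:M : 'M[R]_m)) :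
    proj_total (twisted_proj m true) ((set_val p.1).1, row_mx (set_val p.1).2 (set_val p.2).2).
  have := set_mem (valP p.1); rewrite /proj_total /= /twisted_proj => E.
  by rewrite mul_row_block !mulmx0 mulmx1 addr0 add0r E.
(* The base point is taken from the first summand; [whitney_sum] only tests pairs over a common
   point. *)
exists (fun p => exist _ ((set_val p.1).1, row_mx (set_val p.1).2 (set_val p.2).2) (mem_set (tot p))).
split.
  apply: continuous_subspaceT; apply: continuous_comp_initial => p.
  have c1 : continuous (fun q : proj_total taut_proj * proj_total (fun _ : C => 1%:M : 'M[R]_m) => set_val q.1).
    move=> q; apply: (@continuous_comp _ _ _ fst (set_val : proj_total taut_proj -> C * 'rV[R]_2) q).
      exact: cvg_fst.
    exact: initial_continuous.
  have c2 : continuous (fun q : proj_total taut_proj * proj_total (fun _ : C => 1%:M : 'M[R]_m) => set_val q.2).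
    move=> q; apply: (@continuous_comp _ _ _ snd (set_val : proj_total _ -> C * 'rV[R]_m) q).
      exact: cvg_snd.
    exact: initial_continuous.
  have H1 : (set_val (q : proj_total taut_proj * proj_total (fun _ : C => 1%:M : 'M[R]_m)).1).1 @[q --> p]
      --> (set_val p.1).1.
    by apply: (@continuous_comp _ _ _ _ fst p); [exact: c1|exact: cvg_fst].
  suff H2 : row_mx (set_val (q : proj_total taut_proj * proj_total (fun _ : C => 1%:M : 'M[R]_m)).1).2
      (set_val q.2).2 @[q --> p] --> row_mx (set_val p.1).2 (set_val p.2).2.
    exact: (cvg_pair H1 H2).
  have d1 : (set_val (q : proj_total taut_proj * proj_total (fun _ : C => 1%:M : 'M[R]_m)).1).2 @[q --> p]
      --> (set_val p.1).2.
    by apply: (@continuous_comp _ _ _ _ snd p); [exact: c1|exact: cvg_snd].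
  have d2 : (set_val (q : proj_total taut_proj * proj_total (fun _ : C => 1%:M : 'M[R]_m)).2).2 @[q --> p]
      --> (set_val p.2).2.
    by apply: (@continuous_comp _ _ _ _ snd p); [exact: c2|exact: cvg_snd].
  apply/(cvg_mxP (nbhs_filter p)) => i j; case: (split_ordP j) => j' ->.
    rewrite row_mxEl; under eq_fun do rewrite row_mxEl.
    by move/(cvg_mxP (nbhs_filter p)) : d1; apply.
  rewrite row_mxEr; under eq_fun do rewrite row_mxEr.
  by move/(cvg_mxP (nbhs_filter p)) : d2; apply.
move=> A.
pose S1 := proj_frame taut_proj_idem taut_proj_rank A.
pose D1 := proj_coef taut_proj_idem taut_proj_rank A.
pose S2 := proj_frame unit_proj_idem unit_proj_rank A.
pose D2 := proj_coef unit_proj_idem unit_proj_rank A.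
pose S := proj_frame (@twisted_proj_idem R m true) (@twisted_proj_rank R m true) A.
pose D := proj_coef (@twisted_proj_idem R m true) (@twisted_proj_rank R m true) A.
pose l (uv : 'rV[R]_1 * 'rV[R]_m) : 'rV[R]_m.+1 := row_mx (uv.1 *m S1) (uv.2 *m S2) *m D.
have ll : linear l.
  move=> a [u v] [u' v']; rewrite /l /= !mulmxDl -!scalemxAl.
  by rewrite -add_row_mx -scale_row_mx mulmxDl scalemxAl.
pose L : {linear ('rV[R]_1 * 'rV[R]_m)%type -> 'rV[R]_m.+1} :=
  HB.pack l (GRing.isLinear.Build R _ _ _ l ll).
have row_total (u : 'rV[R]_1) (v : 'rV[R]_m) : row_mx (u *m S1) (v *m S2) *m twisted_proj m true A = row_mx (u *m S1) (v *m S2).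
  rewrite /twisted_proj mul_row_block !mulmx0 mulmx1 addr0 add0r; congr (row_mx _ _).
  exact: (proj_vinclP taut_proj_idem taut_proj_rank A u).
exists L; split; last first.
  move=> u v; apply/val_inj => /=; congr (_, _).
  by rewrite /l proj_coefK.
exists (fun z => (lsubmx (z *m S : 'rV_(2 + m)) *m D1, rsubmx (z *m S : 'rV_(2 + m)) *m D2)).
  move=> [u v] /=; rewrite /l proj_coefK // row_mxKl row_mxKr.
  by rewrite -!mulmxA !proj_frame_coef !mulmx1.
move=> z /=; rewrite /l /=.
have E1 : lsubmx (z *m S : 'rV_(2 + m)) *m taut_proj A = lsubmx (z *m S : 'rV_(2 + m)).
  have H : (z *m S) *m twisted_proj m true A = z *m S.
    exact: (proj_vinclP (@twisted_proj_idem R m true) (@twisted_proj_rank R m true)).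
  rewrite -[in RHS]H -[in RHS](hsubmxK (z *m S : 'rV_(2 + m))) /twisted_proj.
  by rewrite mul_row_block !mulmx0 addr0 row_mxKl.
have e1 : lsubmx (z *m S : 'rV_(2 + m)) *m D1 *m S1 = lsubmx (z *m S : 'rV_(2 + m)).
  exact: proj_coefK.
have e2 : rsubmx (z *m S : 'rV_(2 + m)) *m D2 *m S2 = rsubmx (z *m S : 'rV_(2 + m)).
  by apply: (@proj_coefK _ _ _ _ (fun=> 1%:M)); rewrite mulmx1.
rewrite e1 e2 hsubmxK.
by rewrite -mulmxA proj_frame_coef mulmx1.
Qed.

(* By the Whitney formula, since [twisted_bundle true] is the sum of the tautological line
   and a trivial bundle. *)
Lemma twisted_class b c : sval (sw w (twisted_bundle R m b) 1) c -> c loop = b%:R.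
Proof.
case: b => Kc; last first.
  by apply: constant_proj_class Kc => x.
have [l Kl] := class_exists (sw w taut_bundle 1).
have [e Ke] := class_exists (sw w trivial_bundle 1).
(* The formula in degree 1 involves the classes of degree 0 and 1 only; in other degrees any
   representative will do. *)
pose rep n (K : cohomology R C n) := sval (cid (class_exists K)).
have repP n (K : cohomology R C n) : sval K (rep n K) := svalP (cid (class_exists K)).
pose a i : sing R C i -> 'F_2 := match i with
  0 => fun=> 1 | 1 => l | i' => rep i' (sw w taut_bundle i') end.
pose a' i : sing R C i -> 'F_2 := match i with
  0 => fun=> 1 | 1 => e | i' => rep i' (sw w trivial_bundle i') end.
have Ka i : sval (sw w taut_bundle i) (a i).
  by case: i => [|[|i]]; [exact: sw_deg0|exact: Kl|exact: repP].
have Ka' i : sval (sw w trivial_bundle i) (a' i).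
  by case: i => [|[|i]]; [exact: sw_deg0|exact: Ke|exact: repP].
have K := @sw_whitney R w C 1 m taut_bundle trivial_bundle (twisted_bundle R m true) 1 a a'
  twisted_whitney Ka Ka'.
rewrite (class_loop (@circle_continuous R) (@circle01 R) Kc K).
have rid (th : 'I_2 -> 'I_2) : (forall i, th i = i :> nat) -> restr th loop = loop.
  move=> thi; rewrite /path_sing /edge_sing restr_affine_sing; congr affine_sing.
  by apply/funext => i /=; rewrite thi.
rewrite !big_ord_recl big_ord0 /= /cup.
change (1 * e (restr (fun k : 'I_2 => inord k : 'I_2) loop) +
  (l (restr (fun k : 'I_2 => inord k : 'I_2) loop) * 1 + 0) = 1).
rewrite !rid => [|i]; last by rewrite inordK.
by rewrite addr0 mul1r mulr1 (taut_class Kl) (constant_proj_class _ Ke) ?add0r.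
Qed.

End TautologicalClass.

(** * The first Stiefel-Whitney class on a loop *)

Section LoopClass.
Context (R : realType) (X : topologicalType) (m : nat) (E : vbundle R X m.+1)
  (w : stiefel_whitney R) (h : R -> X) (ch : continuous h) (h01 : h 0 = h 1).
Local Notation C := (Gr_fin R 1 2).
Variables (b : bool) (G : R * 'rV[R]_m.+1 -> vtotal E).
Hypotheses (cG : continuous G)
  (fG : forall t, 0 <= t <= 1 -> bundle_frame (h t) (fun c => G (t, c)))
  (G1 : forall c, G (1, c) = G (0, c *m flip0 R m b)).

(** Continues the frame to parameters below 0 by one period, so that it remains continuous across
    the parameter at which [angle] jumps. *)
Definition loop_extension (p : R * 'rV[R]_m.+1) : vtotal E :=
  if p.1 <= 0 then G (p.1 + 1, p.2 *m flip0 R m b) else G p.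

Lemma loop_extension_continuous : continuous loop_extension.
Proof.
apply: (@glue_continuous R) => //.
- by move=> p; exact: cvg_fst.
- move=> [t c]; apply: (@continuous_comp _ _ _
    (fun p : R * 'rV[R]_m.+1 => (p.1 + 1, p.2 *m flip0 R m b)) G (t, c)); last exact: cG.
  have H1 : (p : R * 'rV[R]_m.+1).1 + 1 @[p --> (t, c)] --> t + 1.
    apply: (@cvgD R R^o _ _ (nbhs_filter (t, c))); last exact: cvg_cst.
    exact: cvg_fst.
  have H2 : (p : R * 'rV[R]_m.+1).2 *m flip0 R m b @[p --> (t, c)] --> c *m flip0 R m b.
    by apply: (cvg_mulmx (nbhs_filter (t, c))); [exact: cvg_snd|exact: cvg_cst].
  exact: (cvg_pair H1 H2).
- by move=> [t c] /= ->; rewrite add0r G1 -mulmxA flip0K mulmx1.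
Qed.

Definition loop_coord (t : R) (v : 'rV[R]_(2 + m)) : 'rV[R]_m.+1 :=
  v *m (twisted_frame m b t)^T.

Lemma flip0_tr : (flip0 R m b)^T = flip0 R m b.
Proof.
apply/matrixP => i j; rewrite !mxE eq_sym.
by have [->|] := eqVneq i j; rewrite ?mul0r.
Qed.

(** The reflection acquired by the model frame when [angle] jumps by 1 cancels against the one with
    which [G] closes up. *)
Lemma loop_extensionE t v : -1 <= t < 1 ->
  G (angle (circle t), loop_coord (angle (circle t)) v) = loop_extension (t, loop_coord t v).
Proof.
move=> /andP[t1 t2]; rewrite /loop_extension /=; have [t0|t0] := ltP t 0.
  rewrite angle_circleN ?t1 // (ltW t0) /loop_coord twisted_frameD1 trmx_mul flip0_tr.
  by rewrite mulmxA.
rewrite angle_circle ?t0 //; case: ifP => // t3.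
have -> : t = 0 by apply/eqP; rewrite eq_le t3 t0.
by rewrite add0r G1 -mulmxA flip0K mulmx1.
Qed.

Definition loop_bundle_map (p : proj_total (twisted_proj (R := R) m b)) : vtotal E :=
  G (angle (set_val p).1, loop_coord (angle (set_val p).1) (set_val p).2).

(** Near [p] the angle is replaced by the chart centred at its value [t0], which is continuous;
    [loop_extensionE] shows that the value is the same. *)
Lemma loop_bundle_map_continuous : continuous loop_bundle_map.
Proof.
move=> p; pose t0 := angle (set_val p).1.
have [a0 a1 aP] := angleP (set_val p).1; rewrite -/t0 in a0 a1 aP.
have cv : set_val (q : proj_total (twisted_proj (R := R) m b)) @[q --> p] --> set_val p.
  exact: initial_continuous.
have cA : (set_val (q : proj_total (twisted_proj (R := R) m b))).1 @[q --> p] --> (set_val p).1.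
  by apply: (@continuous_comp _ _ _ _ fst p); [exact: cv|exact: cvg_fst].
have cV : (set_val (q : proj_total (twisted_proj (R := R) m b))).2 @[q --> p] --> (set_val p).2.
  by apply: (@continuous_comp _ _ _ _ snd p); [exact: cv|exact: cvg_snd].
pose f (q : proj_total (twisted_proj (R := R) m b)) := chart t0 (set_val q).1.
have den0 : chart_den t0 (set_val (set_val p).1) != 0.
  by rewrite -aP chart_den_circle oner_eq0.
have cf : f q @[q --> p] --> t0.
  rewrite -[X in _ --> X](chart_circle t0) aP.
  apply: (@continuous_comp _ _ _ (fun q : proj_total (twisted_proj (R := R) m b) => (set_val q).1)
    (chart t0) p); first exact: cA.
  exact: chart_continuous.
have N1 : \forall q \near p, chart_den t0 (set_val (set_val (q : proj_total (twisted_proj (R := R) m b))).1) != 0.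
  apply: (cA [set A : C | chart_den t0 (set_val A) != 0]).
  by rewrite -aP; exact: chart_den_near.
have N2 : \forall q \near p, -1 <= f q < 1.
  (* Since t0 is in [0, 1), a distance below 1 keeps x above -1 and a distance below 1 - t0 keeps it
     below 1. *)
  apply: (cf [set x | -1 <= x < 1]); apply: (ball_near (e := Num.min 1 (1 - t0))).
    by rewrite lt_min ltr01 subr_gt0.
  move=> x; rewrite lt_min !ltr_norml => /andP[/andP[? ?] /andP[? ?]].
  by apply/andP; split; lra.
have E0 : loop_bundle_map p = loop_extension (t0, loop_coord t0 (set_val p).2).
  rewrite -loop_extensionE ?aP //; apply/andP; split => //; lra.
rewrite /continuous_at E0.
have cc : loop_extension (f q, loop_coord (f q) (set_val (q : proj_total (twisted_proj (R := R) m b))).2)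
    @[q --> p] --> loop_extension (t0, loop_coord t0 (set_val p).2).
  have cL : loop_coord (f q) (set_val (q : proj_total (twisted_proj (R := R) m b))).2 @[q --> p]
      --> loop_coord t0 (set_val p).2.
    apply: (cvg_mulmx (nbhs_filter p)); first exact: cV.
    apply: (cvg_trmx (nbhs_filter p)).
    apply: (@cvg_comp _ _ _ f (@twisted_frame R m b)); first exact: cf.
    exact: twisted_frame_continuous.
  apply: (@cvg_comp _ _ _ (fun q => (f q, loop_coord (f q) (set_val q).2)) loop_extension).
    exact: (cvg_pair cf cL).
  exact: loop_extension_continuous.
have N : \forall q \near p, loop_extension (f q, loop_coord (f q) (set_val q).2) = loop_bundle_map q.
  apply: (@filterS2 _ (nbhs p) (nbhs_filter p) _ _ _ _ N1 N2) => q q1 q2.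
  by rewrite -loop_extensionE // /f chartK.
exact: cvg_trans (near_eq_cvg N) cc.
Qed.

Definition loop_base (A : C) : X := h (angle A).

(** The base map is the zero section, followed by the continuous map of total spaces and the
    projection of [E]. *)
Lemma loop_base_continuous : continuous loop_base.
Proof.
have tot (A : C) : proj_total (twisted_proj (R := R) m b) (A, 0) by rewrite /proj_total /= mul0mx.
have cz : continuous (fun A : C => exist _ (A, 0) (mem_set (tot A)) : proj_total (twisted_proj (R := R) m b)).
  apply: continuous_comp_initial => A.
  exact: (cvg_pair (F := nbhs A) cvg_id (@cst_continuous C 'rV[R]_(2 + m) 0 A)).
have -> : loop_base = @vproj _ _ _ E \o loop_bundle_map \o
    (fun A : C => exist _ (A, 0) (mem_set (tot A)) : proj_total (twisted_proj (R := R) m b)).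
  apply/funext => A /=; rewrite /loop_bundle_map /loop_base /=.
  have [a0 a1 _] := angleP A.
  have [|l [_ ->]] := @fG (angle A); first by rewrite a0 ltW.
  have : range (@vincl _ _ _ E (h (angle A))) (vincl (l (loop_coord (angle A) 0))) by exists (l (loop_coord (angle A) 0)).
  by rewrite vincl_range => /= ->.
move=> A; apply: continuous_comp; first exact: cz.
apply: continuous_comp; first exact: loop_bundle_map_continuous.
exact: vproj_continuous.
Qed.

Lemma loop_bundle_mapP : bundle_map (mkcts loop_base_continuous) (loop_bundle_map : vtotal (twisted_bundle R m b) -> vtotal E).
Proof.
split; first exact: loop_bundle_map_continuous.
move=> A; have [a0 a1 aP] := angleP A.
have fA := fG (_ : 0 <= angle A <= 1).
have {}fA : bundle_frame (h (angle A)) (fun c => G (angle A, c)) by apply: fA; rewrite a0 ltW.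
have TP : twisted_frame m b (angle A) *m twisted_proj m b A = twisted_frame m b (angle A).
  by rewrite -{2}aP twisted_frame_proj.
have [Q uQ QE] := proj_vincl_frame (@twisted_proj_idem R m b) (@twisted_proj_rank R m b)
  TP (twisted_frame_orth _ _ _) (twisted_proj_tr _ _ _).
have [l [bl lE]] := bundle_frame_mul uQ fA.
exists l; split=> // v; rewrite -lE /loop_bundle_map /=; congr (G (_, _)).
exact: QE.
Qed.

(** The bundle map covers a map of the projective line to [X] that sends the loop [circle] to [h],
    so naturality reduces the value to [twisted_class]. *)
Lemma loop_class s : sval (sw w E 1) s -> s (path_sing ch 0 1) = b%:R.
Proof.
move=> Ks; have := sw_natural loop_bundle_mapP Ks => /twisted_class <-.
rewrite /pullback; congr s; apply/continuousEP => t.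
pose c := (affine_simplex (fun i : 'I_2 => if i == 0 :> nat then (0, 0) else (1, 0)) t).1.
change (h c = h (angle (circle c))).
have [c0 c1] : 0 <= c /\ c <= 1.
  case: (set_mem (valP t)) => t0; rewrite /c /affine_simplex /= !big_ord_recl !big_ord0 !addr0 => t1.
  rewrite mulr0 add0r mulr1; split; first exact: t0.
  by rewrite -t1 lerDr.
have [c1'|c1'] := ltP c 1; first by rewrite angle_circle // c0.
have -> : c = 1 by apply/eqP; rewrite eq_le c1.
by rewrite -circle01 angle_circle ?lexx ?ltr01.
Qed.

End LoopClass.

(** * Holonomy of the classified projections *)

Section LoopHolonomy.
Context (R : realType) (B : topologicalType) (m : nat) (E : vbundle R B m.+1)
  (w : stiefel_whitney R) (f : B -> mxinf R).

Lemma row_functional n (u : 'rV[R]_n -> R) c :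
  (forall a x y, u (a *: x + y) = a * u x + u y) ->
  u c = \sum_a c 0 a * u (delta_mx 0 a).
Proof.
move=> ul; have u0 : u 0 = 0.
  by have := ul 1 0 0; rewrite scale1r addr0 mul1r => /eqP; rewrite -subr_eq0 opprD addrA subrr sub0r oppr_eq0 => /eqP.
rewrite [in LHS](row_sum_delta c).
apply: (big_ind2 (fun v x => u v = x)) => // [v x v' x' <- <-|a _].
  by rewrite -[v in LHS]scale1r ul mul1r.
by rewrite -[X in u X]addr0 ul u0 addr0.
Qed.

Lemma det_flip0 b : \det (flip0 R m b) = if b then -1 else 1.
Proof.
have -> : flip0 R m b = diag_mx (\row_i (if b && (i == ord0) then -1 else 1)).
  by apply/matrixP => i j; rewrite !mxE; case: eqP => [->|_]; rewrite ?mul1r ?mul0r ?mulr1n.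
rewrite det_diag (bigD1 ord0) //= mxE eqxx andbT big1 ?mulr1 // => i i0.
by rewrite mxE (negbTE i0) andbF.
Qed.

Hypotheses (Gf : forall y, Gr m.+1 (f y)) (cE : classified_by E f).

(** The frame of [E] along the loop, mapped to vectors, is a continuous frame of the projections, so
    the zero function is coherent. Its ends differ by the reflection or by 1, whose determinant
    gives the closing sign. *)
Lemma loop_holonomy (h : R -> B) (ch : continuous h) s : h 0 = h 1 -> sval (sw w E 1) s ->
  holonomy m.+1 (f \o h) (s (path_sing ch 0 1)).
Proof.
move=> h01 Ks; have [b [G [cG fG G1]]] := loop_frame E ch h01.
rewrite (loop_class ch h01 cG fG G1 Ks).
have [g [cg gP]] := cE.
pose K (t : R) : frame R m.+1 := fun a => g (G (t, delta_mx 0 a)).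
have lin t i : 0 <= t <= 1 -> forall c, sval (g (G (t, c))) i = \sum_a c 0 a * sval (K t a) i.
  move=> t01 c; have [l [bl lE]] := fG t t01; have [gl _ _] := gP (h t).
  apply: (row_functional (u := fun c => sval (g (G (t, c))) i)) => a x y.
  by rewrite !lE linearP gl.
have KK t : 0 <= t <= 1 -> gram (K t) (K t) \in unitmx /\ frob_dist (f (h t)) (frame_mx (K t)) = 0.
  move=> t01; have [l [bl lE]] := fG t t01; have [gl _ gr] := gP (h t).
  apply: image_frame; first exact: Gf.
    by move=> a; rewrite -gr; exists (l (delta_mx 0 a)); rewrite // /K lE.
  rewrite -gr => v [u _ <-]; have [l' lK l'K] := bl.
  exists (fun a => l' u 0 a) => i; rewrite -lin //.
  by rewrite lE l'K.
exists K, (fun=> 0); split.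
- by move=> t t01; have [uK dK] := KK t t01; split=> //; rewrite dK divr_gt0.
- move=> t t01; have [uK _] := KK t t01.
  have cK a : K t' a @[t' --> t] --> K t a.
    apply: (@continuous_comp _ _ _ (fun t' : R => G (t', delta_mx 0 a)) g t); last exact: cg.
    apply: (@continuous_comp _ _ _ (fun t' : R => (t', delta_mx 0 a : 'rV[R]_m.+1)) G t); last exact: cG.
    exact: (cvg_pair (F := nbhs t) cvg_id (@cst_continuous R 'rV[R]_m.+1 (delta_mx 0 a) t)).
  by apply: filterS (frame_sign_near (nbhs_filter t) uK cK) => t' -> _; rewrite addr0.
- have i01 : 0 <= (0 : R) <= 1 by rewrite lexx ler01.
  have [uK _] := KK 0 i01; rewrite addr0 add0r.
  have gE : gram (K 0) (K 1) = gram (K 0) (K 0) *m flip0 R m b.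
    apply/matrixP => a c; rewrite !mxE; under [RHS]eq_bigr do rewrite !mxE.
    rewrite (bigD1 c) //= big1 ?addr0 => [|k kc]; last by rewrite (negbTE kc) mul0r mulr0.
    rewrite eqxx mul1r /vec_ip !(@nat_fsum _ (vec_size (K 0 a))); try by move=> i ui; rewrite vec_sizeP ?mul0r.
    rewrite mulr_suml; apply: eq_bigr => i _; rewrite -mulrA; congr (_ * _).
    rewrite {1}/K G1 lin // (bigD1 c) //= big1 ?addr0 => [|k kc].
      by rewrite -rowE !mxE eqxx mul1r mulrC.
    by rewrite -rowE !mxE eq_sym (negbTE kc) !mul0r.
  rewrite /frame_sign gE det_mulmx det_flip0 /sign_bit.
  have := gram_unit_gt0 uK; case: b {cG fG G1 gE} => K0.
    by rewrite mulrN1 oppr_lt0 K0.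
  by rewrite mulr1 ltNge ltW.
Qed.

End LoopHolonomy.

(** * From values on loops to a potential *)

Section Potential.
Context (R : realType) (B : topologicalType) (d : nat) (F : B -> frame R d)
  (s : sing R B 1 -> 'F_2) (cs : cobound s = 0).

Lemma coherent_comp (K L : R -> frame R d) b (phi : R -> R) : continuous phi ->
  (forall t, 0 <= t <= 1 -> 0 <= phi t <= 1) -> (forall t, 0 <= t <= 1 -> L t = K (phi t)) ->
  coherent K b -> coherent L (b \o phi).
Proof.
move=> cphi phi01 LK cK t t01.
have H : \forall t' \near t, 0 <= phi t' <= 1 ->
  b (phi t') = b (phi t) + frame_sign (K (phi t)) (K (phi t')) := cphi t _ (cK _ (phi01 t t01)).
by apply: filterS H => t' H t'01; rewrite /= !LK // H ?phi01.
Qed.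

Hypothesis loops : forall (h : R -> B) (ch : continuous h), h 0 = h 1 ->
  exists2 b, coherent (F \o h) b & s (path_sing ch 0 1) = b 0 + b 1.

(* The discrepancy between [s] and the transport of orientations of [F] along [h]; it
   vanishes on loops, so it is a difference of potentials. *)
Definition path_defect (h : R -> B) (ch : continuous h) (q : 'F_2) :=
  exists2 b, coherent (F \o h) b & q = s (path_sing ch 0 1) + (b 0 + b 1).

Lemma path_defect_unique (h : R -> B) (ch : continuous h) q q' :
  path_defect ch q -> path_defect ch q' -> q = q'.
Proof. by move=> [b cb ->] [b' cb' ->]; rewrite (coherent_unique cb cb'). Qed.

Lemma path_defect_loop (h : R -> B) (ch : continuous h) q : h 0 = h 1 -> path_defect ch q -> q = 0.
Proof.
move=> h01 hq; apply: (path_defect_unique hq).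
by have [b cb E] := loops ch h01; exists b => //; rewrite E F2_addxx.
Qed.

Lemma path_defect_cat (h k : R -> B) (ch : continuous h) (ck : continuous k)
    (cc : continuous (cat_path h k)) q : h 1 = k 0 -> path_defect cc q ->
  exists q1 q2, [/\ path_defect ch q1, path_defect ck q2 & q = q1 + q2].
Proof.
move=> hk [b cb ->].
exists (s (path_sing ch 0 1) + (b 0 + b 2^-1)), (s (path_sing ck 0 1) + (b 2^-1 + b 1)); split.
- exists (b \o (fun t : R => t / 2)); last by rewrite /= mul0r mul1r.
  apply: coherent_comp cb => [t|t /andP[t0 t1]|t t01].
  + by apply: (@cvgM R); [exact: cvg_id|exact: cvg_cst].
  + by apply/andP; split; lra.
  + by rewrite /= cat_path_left.
- exists (b \o (fun t : R => (t + 1) / 2)); last first.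
    by rewrite /= add0r mul1r -[1 + 1]/(2 : R) mulfV // pnatr_eq0.
  apply: coherent_comp cb => [t|t /andP[t0 t1]|t t01].
  + by apply: (@cvgM R); [apply: (@cvgD R R^o); [exact: cvg_id|exact: cvg_cst]|exact: cvg_cst].
  + by apply/andP; split; lra.
  + by rewrite /= cat_path_right.
- rewrite (path_cat cs ch ck hk) [RHS]addrACA; congr (_ + _).
  by rewrite [RHS]addrA F2_addK.
Qed.

Lemma rev_path_continuous (h : R -> B) : continuous h -> continuous (fun t : R => h (1 - t)).
Proof.
move=> ch t; apply: (@continuous_comp _ _ _ (fun t : R => 1 - t) h); last exact: ch.
by apply: (@cvgB R R^o); [exact: cvg_cst|exact: cvg_id].
Qed.

Lemma path_defect_rev (h : R -> B) (ch : continuous h) q :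
  path_defect ch q -> path_defect (rev_path_continuous ch) q.
Proof.
move=> [b cb ->]; exists (b \o (fun t : R => 1 - t)).
  apply: coherent_comp cb => [t|t /andP[t0 t1]|//].
    by apply: (@cvgB R R^o); [exact: cvg_cst|exact: cvg_id].
  by apply/andP; split; lra.
by rewrite /= subr0 subrr (path_rev cs ch) // [b 0 + _]addrC.
Qed.

(** Coherent functions are supplied along loops only, so the path is followed by its reverse and the
    result restricted to the first half. *)
Lemma path_defect_exists (h : R -> B) (ch : continuous h) : exists q, path_defect ch q.
Proof.
have hk : h 1 = h (1 - 0) by rewrite subr0.
have cc := cat_path_continuous ch (rev_path_continuous ch) hk.
have [|b cb E] := loops cc; first by rewrite cat_path0 cat_path1 subrr.
have Q : path_defect cc 0 by exists b; rewrite // E F2_addxx.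
by have [q [_ [Hq _ _]]] := path_defect_cat ch (rev_path_continuous ch) hk Q; exists q.
Qed.

Definition joined (x y : B) := exists h : R -> B, [/\ continuous h, h 0 = x & h 1 = y].

Lemma joined_refl x : joined x x.
Proof. by exists (fun=> x); split=> //; exact: cst_continuous. Qed.

Lemma joined_sym x y : joined x y -> joined y x.
Proof.
move=> [h [ch h0 h1]]; exists (fun t : R => h (1 - t)); split; rewrite ?subr0 ?subrr //.
exact: rev_path_continuous.
Qed.

Lemma joined_trans x y z : joined x y -> joined y z -> joined x z.
Proof.
move=> [h [ch h0 h1]] [k [ck k0 k1]]; exists (cat_path h k).
by split; rewrite ?cat_path0 ?cat_path1 //; apply: cat_path_continuous; rewrite ?h1.
Qed.

(* An option only to give [xget] a default value. *)
Definition base_point (z : B) : option B :=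
  xget None [set o | exists2 x, o = Some x & joined x z].

Lemma base_pointP z : exists2 x, base_point z = Some x & joined x z.
Proof.
by apply: (@xgetPex _ None [set o | exists2 x, o = Some x & joined x z]); exists (Some z), z => //; exact: joined_refl.
Qed.

(** Joined points have the same set of candidates, and [xget] depends on that set alone, so a path
    component has one base point. *)
Lemma base_point_eq y z : joined y z -> base_point y = base_point z.
Proof.
move=> yz; congr (xget None _); apply/seteqP; split=> o [x ox xy]; exists x => //.
  exact: joined_trans xy yz.
exact: joined_trans xy (joined_sym yz).
Qed.

(** The potential at z is the defect of a chosen path from the base point to z. The chosen path to h
    0, then [h], then the chosen path to h 1 reversed form a loop, whose defect vanishes. *)
Lemma path_potential : exists g : B -> 'F_2, forall (h : R -> B) (ch : continuous h) b,
  coherent (F \o h) b -> s (path_sing ch 0 1) + (b 0 + b 1) = g (h 0) + g (h 1).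
Proof.
have /choice[g gP] : forall z, exists q, exists x (h : R -> B) (ch : continuous h),
    [/\ base_point z = Some x, h 0 = x, h 1 = z & path_defect ch q].
  move=> z; have [x bx [h [ch h0 h1]]] := base_pointP z.
  by have [q Hq] := path_defect_exists ch; exists q, x, h, ch.
exists g => h ch b cb.
have Hq : path_defect ch (s (path_sing ch 0 1) + (b 0 + b 1)) by exists b.
move: (s _ + _) Hq => q Hq.
have [x [k [ck [bx k0 k1 Dk]]]] := gP (h 0).
have [x' [k' [ck' [bx' k'0 k'1 Dk']]]] := gP (h 1).
have xx : x = x'.
  by apply: Some_inj; rewrite -bx -bx'; apply: base_point_eq; exists h.
have cc := cat_path_continuous ck ch k1.
have E1 : cat_path k h 1 = k' (1 - 0) by rewrite cat_path1 subr0 k'1.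
have cc' := cat_path_continuous cc (rev_path_continuous ck') E1.
have [q0 Q0] := path_defect_exists cc'.
have q00 : q0 = 0.
  by apply: path_defect_loop Q0; rewrite !cat_path0 cat_path1 subrr k0 k'0.
have [q1 [q2 [Q1 Q2 E]]] := path_defect_cat cc (rev_path_continuous ck') E1 Q0.
have [q3 [q4 [Q3 Q4 E']]] := path_defect_cat ck ch k1 Q1.
move: E; rewrite q00 E' (path_defect_unique Q3 Dk) (path_defect_unique Q4 Hq).
rewrite (path_defect_unique Q2 (path_defect_rev Dk')) => H.
by apply: F2_eq; rewrite addrA [q + _]addrC -H.
Qed.

End Potential.

(** * Equivalence of Cech cochains mod 2 *)

Section CechEquivalence.
Context (B : topologicalType) (U : open_cover B).
Implicit Types c : cochain2 U.

Lemma locally_constantD (A : set B) (g h : B -> 'F_2) :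
  locally_constant_on A g -> locally_constant_on A h -> locally_constant_on A (fun y => g y + h y).
Proof.
move=> lg lh y Ay; apply: filterS2 (lg y Ay) (lh y Ay) => z gz hz Az.
by rewrite gz // hz.
Qed.

Lemma locally_constant0 (A : set B) : locally_constant_on A (fun=> 0).
Proof. by move=> y _; apply: filterE. Qed.

Lemma equiv2_refl c : equiv2 c c.
Proof.
exists (fun _ _ => 0); split; first by move=> i; exact: locally_constant0.
by move=> i j y _; rewrite add0r subr0.
Qed.

Lemma equiv2_sym c c' : equiv2 c c' -> equiv2 c' c.
Proof.
move=> [th [lth E]]; exists th; split=> // i j y ij; rewrite E // !F2_opp.
by rewrite addrA addrA F2_addxx add0r F2_addK.
Qed.

Lemma equiv2_trans c' c c'' : equiv2 c c' -> equiv2 c' c'' -> equiv2 c c''.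
Proof.
move=> [th [lth E]] [th' [lth' E']]; exists (fun i y => th' i y + th i y); split.
  by move=> i; exact: locally_constantD.
by move=> i j y ij; rewrite E' // E //; ring.
Qed.

Lemma colim_equiv2_refl c : colim_equiv2 c c.
Proof. by exists U, id, id; split=> [k x|k x|] //; exact: (equiv2_refl c). Qed.

Lemma eps_equiv_det (R : realType) d (Om Om' : mx_cochain R U d) :
  (forall i j y, (U i `&` U j) y -> orth (Om i j y)) -> eps_equiv Om Om' ->
  equiv2 (det_cochain Om) (det_cochain Om').
Proof.
move=> oOm [Th [cTh oTh E]]; exists (fun i y => (\det (Th i y) != 1)%:R); split.
  by move=> i; apply: (det_bit_locally_constant _ (cTh i)) => [|y]; [exact: cset_open|exact: oTh].
move=> i j y [Ui Uj]; have oi : (Th i y)^T *m Th i y = 1%:M := oTh i y Ui.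
have oj : (Th j y)^T *m Th j y = 1%:M := oTh j y Uj.
have oo : (Om i j y)^T *m Om i j y = 1%:M := oOm i j y (conj Ui Uj).
have ioj : (invmx (Th j y))^T *m invmx (Th j y) = 1%:M.
  have -> : invmx (Th j y) = (Th j y)^T.
    have [_ u] := mulmx1_unit oj.
    by rewrite -[RHS]mulmx1 -(mulmxV u) mulmxA oj mul1mx.
  by rewrite trmxK; exact: mulmx1C.
have oio : (Th i y *m Om i j y)^T *m (Th i y *m Om i j y) = 1%:M.
  by rewrite trmx_mul -mulmxA (mulmxA (Th i y)^T) oi mul1mx.
rewrite /det_cochain E // det_bit_mul // det_bit_mul // F2_opp; congr (_ + _).
have [_ u] := mulmx1_unit oj; rewrite det_inv.
by case: (orth_det oj) => ->; rewrite ?invrN1 ?invr1.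
Qed.

End CechEquivalence.

(** * Comparison of det Omega with the first Stiefel-Whitney class *)

Section Comparison.
Context (R : realType) (B : topologicalType) (U : open_cover B) (m : nat)
  (E : vbundle R B m.+1) (w : stiefel_whitney R).
Variables (eps : R) (phi : cidx U -> B -> R) (iota : cidx U -> nat) (Om : mx_cochain R U m.+1)
  (g0 g f : B -> mxinf R).
Hypotheses (eps0 : 0 <= eps) (eps1 : eps < 2 / 9) (pou : partition_of_unity phi)
  (iota_inj : injective iota) (iota0 : forall i, (0 < iota i)%N) (cOm : eps_cocycle eps Om)
  (cl_g0 : is_cl_map phi iota Om g0)
  (g0g : homotopic_in R (Gr_thick m.+1 (Num.sqrt 2 * eps)) g0 g)
  (gf : homotopic_in R (Gr m.+1) (Gr_proj m.+1 \o g) f) (cE : classified_by E f).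

(** sqrt 2 <= 36/25, and 36/25 * 2/9 = 8/25. *)
Lemma thickness_bound : Num.sqrt 2 * eps < 8 / 25.
Proof.
have s2 : Num.sqrt 2 <= 36 / 25 :> R.
  have c0 : 0 <= 36 / 25 :> R by rewrite divr_ge0.
  by rewrite -(ger0_norm c0) -sqrtr_sqr ler_sqrt ?sqr_ge0 // expr2; lra.
have H : Num.sqrt 2 * eps <= 36 / 25 * eps by exact: ler_wpM2r.
apply: le_lt_trans H _; rewrite -ltr_pdivlMl ?divr_gt0 //.
by apply: (lt_le_trans eps1); rewrite le_eqVlt; apply/orP; left; apply/eqP; field.
Qed.

(** The holonomy is carried back from [f] to the closest points of [g], to [g], and to [g0]. The
    outer steps are homotopies; in the middle one the frames spanning the closest points also lie
    near the values of [g]. *)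
Lemma classifying_holonomy (h : R -> B) (ch : continuous h) s : h 0 = h 1 ->
  sval (sw w E 1) s -> holonomy m.+1 (g0 \o h) (s (path_sing ch 0 1)).
Proof.
move=> h01 Ks; case: g0g => H2 [cH2 tH2 H20 H21]; case: gf => H1 [cH1 tH1 H10 H11].
have Gf y : Gr m.+1 (f y) by rewrite -H11; apply: tH1; rewrite in_itv /= lexx ler01.
have GP y : Gr m.+1 (Gr_proj m.+1 (g y)) by rewrite -[Gr_proj _ _]H10; apply: tH1; rewrite in_itv /= lexx ler01.
have hf := loop_holonomy Gf cE ch h01 Ks.
set q := s _ in hf *.
have jA1 := homotopy_jointly_tame cH1 ch; have jA2 := homotopy_jointly_tame cH2 ch.
have nz (x : R) : (x \in `[0, 1]) = (0 <= x <= 1) by rewrite in_itv.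
have E1 : (fun t => H1 (h t, 1)) = f \o h by apply/funext => t; rewrite H11.
have E0 : (fun t => H1 (h t, 0)) = Gr_proj m.+1 \o g \o h by apply/funext => t; rewrite H10.
have E2 : (fun t => H2 (h t, 1)) = g \o h by apply/funext => t; rewrite H21.
have E3 : (fun t => H2 (h t, 0)) = g0 \o h by apply/funext => t; rewrite H20.
have hP : holonomy m.+1 (Gr_proj m.+1 \o g \o h) q.
  rewrite -E0; apply/(holonomy_homotopy (A := fun u t => H1 (h t, u)) q jA1).
  - by move=> u _; rewrite h01.
  - move=> u t u01 t01; have [|K uK dK] := @Gr_frame _ m.+1 (H1 (h t, u)).
      by apply: tH1; rewrite nz.
    by exists K; split=> //; rewrite dK divr_gt0.
  - by rewrite E1.
(* The path of closest points is tame because it is time 0 of the homotopy to [f]. *)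
have tP : tame (Gr_proj m.+1 \o g \o h).
  by rewrite -E0; apply: (jointly_tame_tame (A := fun u t => H1 (h t, u))); rewrite // lexx ler01.
have tg y : Gr_thick m.+1 (Num.sqrt 2 * eps) (g y).
  by rewrite -H21; apply: tH2; rewrite in_itv /= lexx ler01.
have /choice[K KP] : forall y, exists K : frame R m.+1,
    gram K K \in unitmx /\ frob_dist (Gr_proj m.+1 (g y)) (frame_mx K) = 0.
  by move=> y; have [K uK dK] := Gr_frame (GP y); exists K.
have hg : holonomy m.+1 (g \o h) q.
  have [||b cb qb] := holonomy_coherent (F := K \o h) tP _ _ hP.
  - by rewrite /= h01.
  - by move=> t t01; have [uK dK] := KP (h t); split=> //=; rewrite dK divr_gt0.
  exists (K \o h), b; split=> // t t01; have [uK dK] := KP (h t); split=> //=.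
  have d1 := Gr_proj_dist thickness_bound (tg (h t)) (GP (h t)).
  have := frob_dist_trans (Gr_proj m.+1 (g (h t))) (g (h t)) (frame_mx (K (h t))).
  by rewrite dK; lra.
rewrite -E3; apply/(holonomy_homotopy (A := fun u t => H2 (h t, u)) q jA2).
- by move=> u _; rewrite h01.
- by move=> u t u01 t01; apply: (Gr_thick_frame thickness_bound); apply: tH2; rewrite nz.
- by rewrite E2.
Qed.

Lemma g0_tame (h : R -> B) : continuous h -> tame (g0 \o h).
Proof.
move=> ch; case: g0g => H2 [cH2 tH2 H20 H21].
have E3 : (fun t => H2 (h t, 0)) = g0 \o h by apply/funext => t; rewrite H20.
rewrite -E3; apply: (jointly_tame_tame (A := fun u t => H2 (h t, u))).
  by rewrite lexx ler01.
exact: homotopy_jointly_tame.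
Qed.

(** The frames [F], chosen over all of [B], mediate between the members of the cover: [kappa i] is
    their potential plus the sign between [F] and Phi_i. Along paths in U_i the frames Phi_i have no
    sign changes, and the triple formula at a point gives the sign between Phi_i and Phi_j. *)
Lemma cech_sing_det s : sval (sw w E 1) s -> exists kappa : cidx U -> B -> 'F_2,
  (forall i h (ch : continuous h), (forall t, U i (h t)) ->
    s (path_sing ch 0 1) = kappa i (h 0) + kappa i (h 1)) /\
  (forall i j x, U i x -> U j x -> det_cochain Om i j x = kappa i x + kappa j x).
Proof.
move=> Ks; have cs := class_cocycle Ks.
have d0 : (0 < m.+1)%N by [].
have tg0 y : Gr_thick m.+1 (Num.sqrt 2 * eps) (g0 y).
  by case: g0g => H2 [cH2 tH2 <- _]; apply: tH2; rewrite in_itv /= lexx ler01.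
have /choice[F F25] : forall y, exists F : frame R m.+1, near_frame (8 / 25) (g0 y) F.
  by move=> y; exact: (Gr_thick_frame thickness_bound (tg0 y)).
have FP y : near_frame (1 / 3) (g0 y) (F y) by apply: near_frame_le (F25 y); lra.
have loops (h : R -> B) (ch : continuous h) : h 0 = h 1 ->
    exists2 b, coherent (F \o h) b & s (path_sing ch 0 1) = b 0 + b 1.
  move=> h01; have hol := classifying_holonomy ch h01 Ks.
  have [||b cb qb] := holonomy_coherent (F := F \o h) (g0_tame ch) _ _ hol.
  - by rewrite /= h01.
  - by move=> t _; exact: FP.
  by exists b => //; rewrite qb /= h01 frame_signxx ?addr0 //; case: (FP (h 1)).
have [pot potP] := path_potential cs loops.
pose Ph i y := Phi_frame d0 Om pou iota0 i y.
have PhP i y : U i y -> near_frame (1 / 3) (g0 y) (Ph i y).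
  move=> Ui; apply: (@near_frame_le _ _ (8 / 25)); first lra.
  exact: (near_Phi d0 eps1 pou iota_inj iota0 cOm cl_g0).
exists (fun i y => pot y + frame_sign (F y) (Ph i y)); split.
  move=> i h ch Uh.
  have cP : coherent (fun t => Ph i (h t)) (fun=> 0).
    move=> t t01; have H : \forall t' \near t, frame_sign (Ph i (h t)) (Ph i (h t')) = 0.
      exact: (ch t _ (Phi_sign_near d0 pou iota_inj iota0 cOm (Uh t))).
    by apply: filterS H => t' -> _; rewrite addr0.
  have := potP h ch _ (coherent_change (G := F \o h) (g0_tame ch) _ _ cP).
  move=> /(_ (fun t _ => PhP i (h t) (Uh t)) (fun t _ => FP (h t))).
  rewrite /= !add0r => H; rewrite addrACA -H !(frame_signC (F _)).
  by rewrite F2_addK.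
move=> i j x Ui Uj; rewrite addrACA F2_addxx add0r.
rewrite -(Phi_sign d0 eps1 pou iota_inj iota0 cOm Ui Uj).
rewrite (frame_signC (F x)); apply/esym.
exact: near_frame_triple1 (PhP i x Ui) (FP x) (PhP j x Uj).
Qed.

(** [s] is compared with a representative of w_1. On each member of a common refinement the
    difference has a potential, and these potentials agree on overlaps, so they form one 0-cochain
    of [B]. *)
Lemma cech_sing_unique (V : open_cover B) (c : cochain2 V) s :
  colim_equiv2 (det_cochain Om) c -> cech_sing c s -> cobound s = 0 -> sval (sw w E 1) s.
Proof.
move=> [W [r [r' [Wr Wr' [th [lth thE]]]]]] [F [Fs Fc]] cs.
have [s' Ks'] := class_exists (sw w E 1); have cs' := class_cocycle Ks'.
have [k [ks kc]] := cech_sing_det Ks'.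
(* The sum of the potential of [s], the potential of [s'] and the function relating the two Cech
   cochains; the last is locally constant and only serves to make the sum agree on overlaps. *)
pose M i x := F (r' i) (point_sing R x) + (k (r i) x + th i x).
have MM i j x : W i x -> W j x -> M i x = M j x.
  move=> Wi Wj; have := thE i j x (conj Wi Wj); rewrite /pull2.
  have Vi := Wr' i x Wi; have Vj := Wr' j x Wj.
  have rp : range (point_sing R x) `<=` V (r' i) `&` V (r' j) by move=> _ [t _ <-].
  have -> : c (r' i) (r' j) x = F (r' j) (point_sing R x) - F (r' i) (point_sing R x).
    exact: (Fc _ _ _ rp (vertex_point R)).
  rewrite (kc _ _ _ (Wr i x Wi) (Wr j x Wj)) !F2_opp => H; rewrite /M.
  apply: F2_eq; move: H; set a := F _ _; set b := F _ _ => H.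
  have -> : b + (k (r i) x + th i x) + (a + (k (r j) x + th j x)) =
    (a + b) + (th i x + (k (r i) x + k (r j) x) + th j x) by ring.
  by rewrite H F2_addxx.
have /choice[i Wi] : forall x, exists i, W i x.
  move=> x; have [i _ Wi] : (\bigcup_i W i) x by rewrite cset_cover.
  by exists i.
pose mu x := M (i x) x.
have muE j x : W j x -> mu x = M j x by exact: MM.
suff -> : s = s' + cobound (point_cochain (R := R) mu) by exact: class_add.
have ss : s + s' = cobound (point_cochain (R := R) mu).
  have css : cobound (s + s') = 0.
    apply/funext => t; have := congr1 (fun z => z t) cs; have := congr1 (fun z => z t) cs'.
    by rewrite /cobound /= big_split /= => -> ->; rewrite addr0.
  apply: cobound_of_paths => h ch; rewrite /point_cochain /=.
  apply: (path_local css (m := fun t => mu (h t))) => t t01.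
  pose j := i (h t); have Wj : W j (h t) := Wi (h t).
  have N1 : \forall t' \near t, W j (h t').
    by apply: (ch t (W j)); apply: open_nbhs_nbhs; split=> //; exact: cset_open.
  have N2 : \forall t' \near t, W j (h t') -> th j (h t') = th j (h t).
    exact: (ch t _ (lth j (h t) Wj)).
  have [e e0 Ne] := near_closed_ball (filterI N1 N2).
  exists e => // x y x0 xy y1 xt yt.
  (* The formula for [s'] on a member of the cover asks for a path that stays in it at every real
     parameter. *)
  pose h' z := h (clamp_at t e z).
  have ch' : continuous h'.
    by move=> z; apply: (@continuous_comp _ _ _ (clamp_at t e) h); [exact: clamp_at_continuous|exact: ch].
  have Wh' z : W j (h' z) by apply: (Ne _ _).1; exact: clamp_at_near.
  pose h2 z := h' (x + z * (y - x)).
  have caff : continuous (fun z : R => x + z * (y - x) : R^o).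
    move=> z; apply: (@cvgD R R^o); first exact: cvg_cst.
    by apply: (@cvgM R); [exact: cvg_id|exact: cvg_cst].
  have ch2 : continuous h2.
    by move=> z; apply: (@continuous_comp _ _ _ (fun z : R => x + z * (y - x)) h'); [exact: caff|exact: ch'].
  have hx z : x <= z <= y -> h' z = h z.
    move=> /andP[xz zy]; rewrite /h' clamp_at_id // ler_norml.
    by move: xt yt; rewrite !ltr_norml => /andP[? ?] /andP[? ?]; apply/andP; split; lra.
  have -> : path_sing ch x y = path_sing ch2 0 1.
    apply: path_sing_ext => a b a0 b0 ab; rewrite /h2.
    have aE : a = 1 - b by lra.
    have -> : x + (a * 0 + b * 1) * (y - x) = a * x + b * y by rewrite aE; ring.
    by rewrite hx // aE; apply/andP; split; nra.
  have h20 : h2 0 = h x by rewrite /h2 mul0r addr0 hx // lexx xy.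
  have h21 : h2 1 = h y by rewrite /h2 mul1r addrC subrK hx // lexx xy.
  have Wh2 z : W j (h2 z) by exact: Wh'.
  have thx z : `|z - t| < e -> th j (h z) = th j (h t).
    by move=> /ltW/Ne[Wz Nz]; exact: Nz.
  have Wz z : `|z - t| < e -> W j (h z) by move=> /ltW/Ne[].
  change (s (path_sing ch2 0 1) + s' (path_sing ch2 0 1) = mu (h x) + mu (h y)).
  rewrite (ks (r j)) => [|z]; last exact: Wr.
  have -> : s (path_sing ch2 0 1) = F (r' j) (point_sing R (h2 1)) + F (r' j) (point_sing R (h2 0)).
    rewrite (Fs (r' j)) ?cobound_path // => _ [z _ <-]; apply: (Wr' j); exact: Wh2.
  rewrite h20 h21 (muE j _ (Wz _ xt)) (muE j _ (Wz _ yt)) /M (thx x xt) (thx y yt).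
  rewrite [RHS]addrACA; congr (_ + _); first exact: addrC.
  by rewrite [RHS]addrACA F2_addxx addr0.
apply/funext => t; change (s t = s' t + cobound (point_cochain (R := R) mu) t).
by rewrite -ss; change (s t = s' t + (s t + s' t)); rewrite addrCA F2_addxx addr0.
Qed.

Lemma sing_cech_det s : sval (sw w E 1) s -> cech_sing (det_cochain Om) s.
Proof.
move=> Ks; have [k [ks kc]] := cech_sing_det Ks.
exists (fun i => point_cochain (k i)); split=> [i p|i j p] Up.
  have [h [ch [pE hp _ _]]] := sing1E p.
  rewrite pE cobound_path /point_cochain /= addrC (ks i) // => t.
  by apply: Up; exact: hp.
have [x pE] := sing0E p; move: Up; rewrite pE => Up t.
have [Ui Uj] : (U i `&` U j) x by apply: Up; exists t.
by rewrite /point_cochain /= kc // F2_opp addrC.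
Qed.

End Comparison.

(** * Equality of the two classes *)

Lemma equiv2_pull (B : topologicalType) (U W : open_cover B) (r : cidx W -> cidx U) (c c' : cochain2 U) :
  (forall k, W k `<=` U (r k)) -> equiv2 c c' -> equiv2 (pull2 r c) (pull2 r c').
Proof.
move=> Wr [th [lth thE]]; exists (fun k => th (r k)); split.
  move=> k y /Wr/(lth (r k) y); apply: (@filterS _ (nbhs y) (nbhs_filter y)) => z H Wz.
  exact/H/Wr.
by move=> i j y [Wi Wj]; apply: thE; split; exact: Wr.
Qed.

Theorem proposition6p8 (R : realType) (B : topologicalType)
    (U : open_cover B) (d : nat) (eps : R) (om : set (mx_cochain R U d))
    (f : B -> mxinf R) (E : vbundle R B d) (w : stiefel_whitney R) :
  locally_contractible R B -> paracompact B ->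
  countable [set: cidx U] -> (0 < d)%N ->
  0 <= eps -> eps < 2 / 9 ->
  H1_eps eps om ->
  pi_star d (cl eps om) f ->
  classified_by E f ->
  colim_to_sing (cech_to_colim (sw1 om)) = sval (sw w E 1%N).
Proof.
case: d om E => // m om E _ _ _ d0 eps0 eps1 [Om0 cOm0 ->]
  [g [Om [phi [iota [g0 [[cOm Om0Om] pou [ii i0] clg0 g0g]]]]] gf] cE.
have det_eq Om' : eps_equiv Om0 Om' -> equiv2 (det_cochain Om0) (det_cochain Om').
  by apply: eps_equiv_det; case: cOm0.
apply/seteqP; split=> s.
  move=> [s0 [V [c [cc [c0 [cc0 [Om1 [cOm1 Om0Om1] e1]] c0c]] cs]]].
  (* [cl] and [sw1] may have used different representatives [Om] and [Om1] of the class; their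
     determinants are equivalent through that of [Om0]. *)
  have e0 : equiv2 (det_cochain Om) c0.
    apply: equiv2_trans e1; apply: equiv2_trans (det_eq _ Om0Om1).
    exact/equiv2_sym/det_eq.
  apply: (cech_sing_unique w eps0 eps1 pou ii i0 cOm clg0 g0g gf cE _ cs s0).
  have [W [r [r' [Wr Wr' e2]]]] := c0c; exists W, r, r'; split=> //.
  exact: equiv2_trans (equiv2_pull Wr e0) e2.
move=> Ks; split; first exact: class_cocycle Ks.
have cc := det_cochain_cocycle2 d0 eps1 pou ii i0 cOm clg0.
exists U, (det_cochain Om); last exact: (sing_cech_det eps0 eps1 pou ii i0 cOm clg0 g0g gf cE Ks).
split=> //; exists (det_cochain Om); last exact: colim_equiv2_refl.
by split=> //; exists Om; [|exact: equiv2_refl].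
Qed.
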